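(* Let $u_0\in\mathcal{S}(\mathbb{R}^n)$ and $f\in C^\infty(\mathbb{R}_+,\mathcal{S}(\mathbb{R}^n))\cap C([0,\infty),\mathcal{S}(\mathbb{R}^n))$. Then the function $u:\mathbb{R}_+\times\mathbb{R}^n\to\mathbb{C}$ defined by $$u(t,x)=\operatorname{W}_{0,t}u_0(x)+\int_0^t\operatorname{W}_{s,t}f(s,x)\,ds,\qquad x\in\mathbb{R}^n,\ t\in\mathbb{R}_+,$$ where $\operatorname{W}_{s,t}f(s,x)$ means $(\operatorname{W}_{s,t}f(s,\cdot))(x)$, satisfies $$u\in C^\infty(\mathbb{R}_+,\mathcal{S}(\mathbb{R}^n))\cap C([0,\infty),\mathcal{S}(\mathbb{R}^n))$$ (with $u(0,\cdot)=u_0$) and solves the Cauchy problem $$\partial_tu(t,x)-\mathcal{L}_tu(t,x)=f(t,x)\quad\text{for all }x\in\mathbb{R}^n,\ t\in\mathbb{R}_+,\qquad \lim_{t\to0+}u(t,\cdot)=u_0.$$ Moreover, if $u_0\ge0$ and $f\ge0$, then $u\ge0$.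
   Context: $n\in\mathbb{N}$ (positive), $\mathbb{R}_+=(0,\infty)$, and $\mathcal{S}(\mathbb{R}^n)$ is the Schwartz space with its usual Fréchet topology. Standing assumption: $a=(a_{ij})\in C^\infty(\mathbb{R}_+,\mathrm{GL}(n))\cap C([0,\infty),\mathrm{GL}(n))$ is a real matrix-valued function such that $a(t)$ is symmetric positive definite for every $t\in[0,\infty)$. Put $$\mathcal{L}_tv(x)=\sum_{i,j=1}^na_{ij}(t)\,\partial^2_{x_ix_j}v(x),\qquad A(t)=\int_0^ta(s)\,ds\ \ (A(0)=0),$$ $\Delta=\{(s,t)\in[0,\infty)\times\mathbb{R}_+: s<t\}$, and for $(s,t)\in\Delta$ $$\mathcal{W}(x;s,t)=\frac{1}{\sqrt{(4\pi)^n\det[A(t)-A(s)]}}\,e^{-\frac14\langle x,[A(t)-A(s)]^{-1}x\rangle},\quad x\in\mathbb{R}^n.$$ The operators are $\operatorname{W}_{s,t}v=\mathcal{W}(\cdot;s,t)\ast v$ (convolution in $x$) for $(s,t)\in\Delta$, and $\operatorname{W}_{t,t}v=v$ for $t\ge0$. The limit as $t\to0+$ is in $\mathcal{S}(\mathbb{R}^n)$. *)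

(* Defs.v *)
From HB Require Import structures.
From mathcomp Require Import all_boot all_order all_algebra.
From mathcomp Require Import all_classical all_reals all_analysis.
From mathcomp.real_closed Require Import complex.

Set Implicit Arguments.
Unset Strict Implicit.
Unset Printing Implicit Defensive.
Import Order.TTheory GRing.Theory Num.Theory.
Import numFieldNormedType.Exports.
Local Open Scope classical_set_scope.
Local Open Scope complex_scope.
Local Open Scope ring_scope.

(* Points of R^n are row vectors 'rV[R]_n and complex numbers are R[i]; limits,
   derivatives and integrals of complex-valued functions are taken on real and
   imaginary parts. *)

(* Lebesgue measure on R^n, carried by n-tuples of reals (on which the library
   puts the product sigma-algebra), as an iterated product of measures. *)
Section lebesgue_tuple.
Context {R : realType}.
Local Notation rT := (measurableTypeR R).

Definition tuple_cons n (p : rT * n.-tuple rT) : n.+1.-tuple rT :=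
  [tuple of p.1 :: p.2].

Lemma measurable_tuple_cons n : measurable_fun setT (@tuple_cons n).
Proof. exact: measurable_cons measurable_fst measurable_snd. Qed.

Section step.
Context (n : nat) (m : {sigma_finite_measure set (n.-tuple rT) -> \bar R}).

Definition lebesgue_step : set (n.+1.-tuple rT) -> \bar R :=
  pushforward (@lebesgue_measure R \x m)%E (@tuple_cons n).

Let step0 : lebesgue_step set0 = 0%E.
Proof. by rewrite /lebesgue_step /pushforward preimage_set0 measure0. Qed.

Let step_ge0 A : (0 <= lebesgue_step A)%E.
Proof. by rewrite /lebesgue_step /pushforward measure_ge0. Qed.

Let step_sigma_additive : semi_sigma_additive lebesgue_step.
Proof.
move=> F mF tF mUF; rewrite /lebesgue_step /pushforward preimage_bigcup.
have mp A : measurable A -> measurable (@tuple_cons n @^-1` A).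
  by move=> mA; rewrite -[X in measurable X]setTI; exact: measurable_tuple_cons.
apply: measure_semi_sigma_additive.
- by move=> k; exact: mp.
- apply/trivIsetP => /= i j _ _ ij; rewrite -preimage_setI.
  by move/trivIsetP : tF => /(_ _ _ _ _ ij) ->//; rewrite preimage_set0.
- by rewrite -preimage_bigcup; exact: mp.
Qed.

HB.instance Definition _ := isMeasure.Build _ _ _ lebesgue_step
  step0 step_ge0 step_sigma_additive.

Let step_sigma_finite : sigma_finite setT lebesgue_step.
Proof.
have /sigma_finiteP[F [TF ndF Foo]] := sigma_finiteT (@lebesgue_measure R).
have /sigma_finiteP[G [TG ndG Goo]] := sigma_finiteT m.
pose h (t : n.+1.-tuple rT) : rT * n.-tuple rT := (thead t, [tuple of behead t]).
have mh : measurable_fun setT h.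
  apply: measurable_fun_pair; last exact: measurable_behead.
  exact: measurable_tnth.
have hK : cancel (@tuple_cons n) h.
  by move=> [x t]; rewrite /h /tuple_cons theadE; congr pair; exact/val_inj.
exists (fun k => h @^-1` (F k `*` G k)).
  rewrite -preimage_bigcup (_ : \bigcup_k _ = setT) ?preimage_setT//.
  rewrite -subTset => -[x y] _ /=.
  have [i _ Fix] : (\bigcup_k F k) x by rewrite -TF.
  have [j _ Gjy] : (\bigcup_k G k) y by rewrite -TG.
  exists (maxn i j) => //; split => /=.
    by move: x Fix; exact/subsetPset/ndF/leq_maxl.
  by move: y Gjy; exact/subsetPset/ndG/leq_maxr.
move=> k; have [mFk Fk] := Foo k; have [mGk Gk] := Goo k; split.
  by rewrite -[X in measurable X]setTI; apply: mh => //; exact: measurableX.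
rewrite /lebesgue_step /pushforward -comp_preimage.
rewrite (_ : h \o _ = id) ?preimage_id; last by apply/funext => p /=; rewrite hK.
by rewrite product_measure1E// lte_mul_pinfty// ge0_fin_numE.
Qed.

HB.instance Definition _ :=
  Measure_isSigmaFinite.Build _ _ _ lebesgue_step step_sigma_finite.

End step.

Fixpoint lebesgue_tuple n : {sigma_finite_measure set (n.-tuple rT) -> \bar R} :=
  if n is n'.+1 then lebesgue_step (lebesgue_tuple n')
  else \d_([tuple] : 0.-tuple rT).

End lebesgue_tuple.

Section complex_valued.
Context {R : realType}.

Definition cintegral d (T : measurableType d) (mu : {measure set T -> \bar R})
    (D : set T) (g : T -> R[i]) : R[i] :=
  (\int[mu]_(y in D) complex.Re (g y)) +i* (\int[mu]_(y in D) complex.Im (g y)).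

Context {V : normedModType R}.

Definition ccontinuous (g : V -> R[i]) : Prop :=
  continuous (fun x => complex.Re (g x)) /\ continuous (fun x => complex.Im (g x)).

Definition cderivable (g : V -> R[i]) (x v : V) : Prop :=
  derivable (fun y => complex.Re (g y)) x v /\
  derivable (fun y => complex.Im (g y)) x v.

Definition cderive (g : V -> R[i]) (x v : V) : R[i] :=
  'D_v (fun y => complex.Re (g y)) x +i* 'D_v (fun y => complex.Im (g y)) x.

End complex_valued.

Section schwartz.
Context {R : realType} {n : nat}.
Implicit Types (v w : 'rV[R]_n -> R[i]) (g : R -> 'rV[R]_n -> R[i]).

Definition unit_vec (i : 'I_n) : 'rV[R]_n := delta_mx 0 i.

Definition pderiv (i : 'I_n) v : 'rV[R]_n -> R[i] :=
  fun x => cderive v x (unit_vec i).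

Definition pderivs (s : seq 'I_n) v : 'rV[R]_n -> R[i] := foldr pderiv v s.

Definition smooth v : Prop := forall s : seq 'I_n,
  ccontinuous (pderivs s v) /\
  forall i x, cderivable (pderivs s v) x (unit_vec i).

Definition monomial (alpha : 'I_n -> nat) (x : 'rV[R]_n) : R :=
  \prod_(i < n) x 0 i ^+ alpha i.

Definition mpderiv (beta : 'I_n -> nat) v : 'rV[R]_n -> R[i] :=
  pderivs (flatten [seq nseq (beta i) i | i <- enum 'I_n]) v.

Definition seminorm (alpha beta : 'I_n -> nat) v : \bar R :=
  ereal_sup [set (Normc.normc ((monomial alpha x)%:C * mpderiv beta v x))%:E
            | x in setT].

Definition schwartz v : Prop :=
  smooth v /\ forall alpha beta, (seminorm alpha beta v < +oo)%E.

(* Convergence for the Frechet topology, which is the one generated by the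
   seminorms; to be used for [schwartz] members only. *)
Definition schwartz_cvg (T : Type) (F : set_system T)
    (g : T -> 'rV[R]_n -> R[i]) v : Prop :=
  forall alpha beta,
    seminorm alpha beta (fun x => g t x - v x) @[t --> F] --> 0%E.

(* C([0, oo), S(R^n)) *)
Definition schwartz_continuous g : Prop := forall t : R, 0 <= t ->
  schwartz (g t) /\ schwartz_cvg (within `[0, +oo[ (nbhs t)) g (g t).

Definition diff_quotient g (t h : R) : 'rV[R]_n -> R[i] :=
  fun x => (h^-1)%:C * (g (t + h) x - g t x).

(* C^k((0, oo), S(R^n)); g' is the derivative of g in the topology of S(R^n) *)
Fixpoint schwartz_Ck (k : nat) g : Prop :=
  (forall t : R, 0 < t -> schwartz (g t) /\ schwartz_cvg (nbhs t) g (g t)) /\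
  if k is k'.+1 then
    exists g' : R -> 'rV[R]_n -> R[i],
      (forall t : R, 0 < t -> schwartz_cvg (0 : R)^' (diff_quotient g t) (g' t)) /\
      schwartz_Ck k' g'
  else True.

Definition schwartz_Cinfty g : Prop := forall k, schwartz_Ck k g.

End schwartz.

Section propagator.
Context {R : realType} {n : nat}.
Implicit Types (a : R -> 'M[R]_n) (v : 'rV[R]_n -> R[i]).

Record coefficient_matrix a : Prop := {
  coef_smooth : forall i j k (t : R), 0 < t ->
    derivable (derive1n k (fun s => a s i j)) t 1 ;
  coef_continuous : {within `[0, +oo[, continuous a} ;
  coef_unit : forall t, 0 <= t -> a t \in unitmx ;
  coef_sym : forall t, 0 <= t -> (a t)^T = a t ;
  coef_posdef : forall t, 0 <= t -> forall x : 'rV[R]_n, x != 0 ->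
    0 < (x *m a t *m x^T) 0 0 }.

Definition elliptic_op a (t : R) v : 'rV[R]_n -> R[i] := fun x =>
  \sum_(i < n) \sum_(j < n) (a t i j)%:C * pderiv i (pderiv j v) x.

Definition primitive_mx a (t : R) : 'M[R]_n :=
  \matrix_(i, j) \int[lebesgue_measure]_(s in `[0, t]) a s i j.

Definition Wkernel a (s t : R) (x : 'rV[R]_n) : R :=
  let B := primitive_mx a t - primitive_mx a s in
  (Num.sqrt ((4 * pi) ^+ n * \det B))^-1
  * expR (- (4^-1 * (x *m invmx B *m x^T) 0 0)).

Definition row_of_tuple (y : n.-tuple (measurableTypeR R)) : 'rV[R]_n :=
  \row_i tnth y i.

Definition convolution (K : 'rV[R]_n -> R) v : 'rV[R]_n -> R[i] := fun x =>
  cintegral (lebesgue_tuple n) setT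
    (fun y => (K (x - row_of_tuple y))%:C * v (row_of_tuple y)).

(* meant for 0 <= s <= t, the second branch being s = t *)
Definition Wop a (s t : R) v : 'rV[R]_n -> R[i] :=
  if s < t then convolution (Wkernel a s t) v else v.

End propagator.

(* Main.v *)
(* Write A(t) - A(s) = U^T U with U upper triangular. Then W_{s,t} v (x) is the
   average of v(x + z U) over z with respect to a fixed Gaussian weight, for real
   v. Hence W_{s,t} commutes with spatial derivatives, preserves nonnegativity and
   is bounded in all weighted sup norms, uniformly for s <= t <= T; integration by
   parts against the Gaussian gives d/dt W_{s,t} v = L_t W_{s,t} v. Differentiating
   the Duhamel integral in its upper bound and in its integrand yields the equation
   for u. The mean value theorem in t makes u and its spatial derivatives Lipschitz
   in t in all weighted norms, which is continuity in S, and the equation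
   u' = L_t u + f then gives smoothness in S by induction on the order. Complex
   functions are treated through their real and imaginary parts. *)

(* The obstacle is the diagonal s = t, where A(t) - A(s) degenerates: the factor U is only of size
   sqrt(t - s), and its derivative in t is unbounded as s increases to t. That derivative is never
   estimated. After integration by parts it survives only as U^T U' + (U^T U')^T, contracted with a
   symmetric Hessian, and this is the derivative of U^T U, that is a(t), which is bounded on compact
   intervals. Hence W_{s,t} v(x) is Lipschitz in t uniformly in s, which dominates the difference
   quotients under the Duhamel integral.

   The weighted bounds rest on 1 + |x| <= (1 + |x + zU|)(1 + M|z|) whenever |zU| <= M|z|; the second
   factor costs an exponential moment of the Gaussian. Since x enters only through the argument of
   v, each spatial derivative of the mild solution is the mild solution for the differentiated data,
   so estimates are needed at order zero only. At t = 0 the coefficients are merely continuous, so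
   mean value arguments take derivatives in open intervals. *)
Require Import Defs.
From HB Require Import structures.
From mathcomp Require Import all_boot all_order all_algebra.
From mathcomp Require Import all_classical all_reals all_analysis.
From mathcomp Require Import measurable_realfun.
From mathcomp.real_closed Require Import complex.
From mathcomp Require Import ring lra.

Set Implicit Arguments.
Unset Strict Implicit.
Unset Printing Implicit Defensive.
Import Order.TTheory GRing.Theory Num.Theory.
Import numFieldNormedType.Exports.
Local Open Scope classical_set_scope.
Local Open Scope ring_scope.

(** * Partial derivatives of real functions on R^n *)

(* Locked, since unification would otherwise unfold it into a limit. *)
HB.lock Definition rpd (R : realType) (n : nat) (i : 'I_n) (f : 'rV[R]_n -> R) :
  'rV[R]_n -> R := 'D_(unit_vec i) f.

Arguments rpd {R n}.

Section calculus.
Context {R : realType}.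

Lemma is_derive_line (V : normedModType R) (f : V -> R) (x v : V) (r : R) :
  derivable f (x + r *: v) v ->
  is_derive r (1 : R) (fun r => f (x + r *: v)) ('D_v f (x + r *: v)).
Proof.
move=> fv; have E : (fun h : R => h^-1 *: (f (x + (h *: 1 + r) *: v) - f (x + r *: v)))
    = (fun h => h^-1 *: (f (h *: v + (x + r *: v)) - f (x + r *: v))).
  apply/funext => h; congr (_ *: (f _ - _)).
  by rewrite scaler1 scalerDl addrCA.
apply: DeriveDef; first by rewrite /derivable/= E.
by rewrite /derive/= E.
Qed.

Lemma is_derive1P (f : R -> R) (t l : R) :
  is_derive t (1 : R) f l <-> h^-1 * (f (t + h) - f t) @[h --> 0^'] --> l.
Proof.
have E : (fun h : R => h^-1 *: (f (h *: (1 : R) + t) - f t)) =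
    (fun h => h^-1 * (f (t + h) - f t)).
  by apply/funext => h; rewrite scaler1 (addrC h).
split=> [[+ <-]|fl]; first by rewrite /derivable/derive/= E.
apply: DeriveDef; first by rewrite /derivable/= E; apply: cvgP fl.
by rewrite /derive/= E; apply/cvg_lim.
Qed.

(** The endpoints are unordered, so increments of either sign are handled at once; the position of
    [c] is recorded only through its distance to [a]. *)
Lemma MVT_norm (f df : R -> R) (a b : R) :
  (forall x, is_derive x (1 : R) f (df x)) ->
  exists2 c, `|c - a| <= `|b - a| & f b - f a = (b - a) * df c.
Proof.
move=> fd.
have cf a' b' : {within `[a', b'], continuous f}.
  apply: continuous_subspaceT => x.
  by apply: differentiable_continuous; apply/derivable1_diffP; have [] := fd x.
have [ab|/ltW ba] := leP a b.
  have [c] := MVT_segment ab (fun x _ => fd x) (cf a b).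
  rewrite in_itv/= => /andP[ac cb] E; exists c; last by rewrite E mulrC.
  by rewrite !ger0_norm ?subr_ge0// lerB.
have [c] := MVT_segment ba (fun x _ => fd x) (cf b a).
rewrite in_itv/= => /andP[ac cb] E; exists c.
  by rewrite distrC [leRHS]distrC !ger0_norm ?subr_ge0// lerB.
by rewrite -opprB E -mulrN opprB mulrC.
Qed.

Section several_variables.
Context {n : nat}.
Implicit Types (x y h : 'rV[R]_n) (f : 'rV[R]_n -> R).
Local Notation e := (@unit_vec R n).

Lemma rpdE i f x : rpd i f x = 'D_(e i) f x. Proof. by rewrite rpd.unlock. Qed.

Definition rpds (s : seq 'I_n) f := foldr rpd f s.

Lemma coord_le_norm x i : `|x 0 i| <= `|x|.
Proof. by rewrite [leRHS]/Num.norm/= mx_normrE (le_bigmax _ _ (0, i)). Qed.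

Lemma row_norm_le x (M : R) : 0 <= M -> (forall i, `|x 0 i| <= M) -> `|x| <= M.
Proof.
move=> M0 xM; rewrite [leLHS]/Num.norm/= mx_normrE; apply/bigmax_leP; split => //.
by move=> [i j] _ /=; rewrite (ord1 i).
Qed.

Lemma norm_unit_vec i : `|e i| <= 1.
Proof.
by apply: row_norm_le => // j; rewrite /unit_vec !mxE/=; case: (_ == _); rewrite /= ?normr1 ?normr0.
Qed.

Lemma MVT_coord f i x (r : R) : (forall y, derivable f y (e i)) ->
  exists2 c, `|c| <= `|r| & f (x + r *: e i) - f x = r * rpd i f (x + c *: e i).
Proof.
move=> fd.
have [c] := MVT_norm 0 r (fun s => is_derive_line (fd (x + s *: e i))).
by rewrite !subr0 scale0r addr0 => cr E; exists c; rewrite ?rpdE.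
Qed.

(** The path from [x] to [x + h] follows edges parallel to the axes, and each edge gets its own mean
    value. The points [xi i] differ from one coordinate to the next, which is harmless because only
    their size matters. *)
Lemma telescope_coord f x h : (forall i y, derivable f y (e i)) ->
  exists2 xi : 'I_n -> 'rV[R]_n, (forall i, `|xi i| <= `|h|) &
    f (x + h) - f x = \sum_i h 0 i * rpd i f (x + xi i).
Proof.
(* [p k] keeps the first [k] coordinates of [h]: only coordinate [k] changes between [p k] and
   [p k.+1], and [p n] is [h]. *)
move=> fd; pose p k : 'rV[R]_n := \row_j (if (j < k)%N then h 0 j else 0).
have pS (i : 'I_n) : p i.+1 = p i + h 0 i *: e i.
  apply/rowP => j; rewrite !mxE ltnS leq_eqVlt eqxx/= eq_sym.
  have [->|ij] := eqVneq i j; first by rewrite eqxx/= ltnn add0r mulr1.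
  by rewrite (negbTE (_ : (i : nat) != j))//= mulr0 addr0.
have /choice[xi xiP] : forall i : 'I_n, exists c : R, `|c| <= `|h 0 i| /\
    f (x + p i + h 0 i *: e i) - f (x + p i) = h 0 i * rpd i f (x + p i + c *: e i).
  move=> i; by have [c c1 c2] := MVT_coord (x + p i) (h 0 i) (fd i); exists c.
exists (fun i : 'I_n => p i + xi i *: e i).
  move=> i; apply: row_norm_le => // j; rewrite !mxE eqxx/=.
  have [->|ij] := eqVneq j i.
    by rewrite ltnn add0r mulr1 (le_trans (xiP _).1) ?coord_le_norm.
  by rewrite mulr0 addr0; case: ifP => _; rewrite ?normr0 ?coord_le_norm.
transitivity (\sum_(0 <= k < n) (f (x + p k.+1) - f (x + p k))).
  rewrite telescope_sumr//; congr (f (x + _) - f _); apply/rowP => j; rewrite !mxE.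
    by rewrite ltn_ord.
  by rewrite addr0.
rewrite big_mkord; apply: eq_bigr => i _.
by rewrite addrA -(xiP i).2 pS addrA.
Qed.

Lemma lipschitz_rpd f (K : R) : (forall i y, derivable f y (e i)) ->
  (forall i y, `|rpd i f y| <= K) -> forall x y, `|f x - f y| <= n%:R * K * `|x - y|.
Proof.
move=> fd fK x y; have [xi _] := telescope_coord y (x - y) fd.
rewrite addrCA subrr addr0 => ->.
rewrite (le_trans (ler_norm_sum _ _ _))//.
apply: (@le_trans _ _ (\sum_(i < n) K * `|x - y|)).
  apply: ler_sum => i _; rewrite normrM mulrC ler_pM//.
  exact: coord_le_norm.
by rewrite sumr_const card_ord -[leLHS]mulr_natl mulrA.
Qed.

(** Continuous partial derivatives replace total differentiability of [f]: in the increment split by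
    [telescope_coord] the intermediate points tend to [p t], so each partial derivative converges to
    its value there. *)
Lemma chain_rule f (p : R -> 'rV[R]_n) (t : R) (dp : 'rV[R]_n) :
  (forall i y, derivable f y (e i)) -> (forall i, continuous (rpd i f)) ->
  (forall i, is_derive t (1 : R) (fun s => p s 0 i) (dp 0 i)) ->
  is_derive t (1 : R) (f \o p) (\sum_i dp 0 i * rpd i f (p t)).
Proof.
move=> fd fc pd.
have /choice[xi xiP] : forall h : R, exists xi : 'I_n -> 'rV[R]_n,
   (forall i, `|xi i| <= `|p (t + h) - p t|) /\
   f (p (t + h)) - f (p t) = \sum_i (p (t + h) - p t) 0 i * rpd i f (p t + xi i).
  move=> h; have [c c1 c2] := telescope_coord (p t) (p (t + h) - p t) fd.
  by exists c; split=> //; rewrite -c2 addrCA subrr addr0.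
have pc : p (t + h) - p t @[h --> 0^'] --> (0 : 'rV[R]_n).
  have : derivable p t (1 : R).
    by apply/derivable_mxP => i j; rewrite (ord1 i); have [] := pd j.
  move=> /derivable1_diffP/differentiable_continuous pt.
  rewrite -(subrr (p t)); apply: cvgB; last exact: cvg_cst.
  have := @continuous_cvg R R 'rV[R]_n (0^' : set_system R) _ (fun h : R => t + h) p t pt; apply.
  rewrite -[X in _ --> X]addr0.
  by apply: cvgD; [exact: cvg_cst|exact: cvg_within].
apply/is_derive1P => /=.
under eq_fun => h do rewrite (xiP h).2 mulr_sumr.
apply: cvg_big => [|i _]; first exact: add_continuous.
under eq_fun => h do rewrite mulrA.
apply: cvgM.
  under eq_fun => h do rewrite !mxE.
  exact: (is_derive1P _ _ _).1 (pd i).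
have H : p t + xi h i @[h --> (0 : R)^'] --> p t.
  rewrite -[X in _ --> X]addr0; apply: cvgD; first exact: cvg_cst.
  apply/cvgr0Pnorm_le => eps eps0.
  near=> h; rewrite (le_trans ((xiP h).1 i))//; near: h.
  by move/cvgr0Pnorm_le : pc; exact.
exact: (cvg_comp _ _ H (fc i _)).
Unshelve. all: by end_near. Qed.

(** Schwarz's argument. Two mean values turn the second difference of [f] over a square of side [r]
    into [r^2] times a mixed derivative, in either order, at points within [2r] of [x]; continuity
    at [x] then identifies the two limits. *)
Lemma rpd_comm f i j x : (forall y, derivable f y (e i)) ->
  (forall y, derivable f y (e j)) ->
  (forall y, derivable (rpd i f) y (e j)) -> (forall y, derivable (rpd j f) y (e i)) ->
  continuous (rpd i (rpd j f)) -> continuous (rpd j (rpd i f)) ->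
  rpd i (rpd j f) x = rpd j (rpd i f) x.
Proof.
move=> fi fj fij fji cij cji.
have key k l (r : R) : (forall y, derivable f y (e k)) ->
   (forall y, derivable (rpd k f) y (e l)) -> exists2 y, `|y - x| <= `|r| + `|r| &
   f (x + r *: e l + r *: e k) - f (x + r *: e k) - (f (x + r *: e l) - f x)
     = r * (r * rpd l (rpd k f) y).
  move=> fk fkl.
  have [c] := MVT_norm 0 r (fun s => is_deriveB
    (is_derive_line (fk (x + r *: e l + s *: e k))) (is_derive_line (fk (x + s *: e k)))).
  rewrite -!rpdE !fctE !subr0 !scale0r !addr0 => cr ->.
  have [d dr] := MVT_coord (x + c *: e k) r fkl.
  rewrite (addrAC x) => ->; exists (x + c *: e k + d *: e l) => //.
  rewrite addrAC (addrAC x) subrr add0r (le_trans (ler_normD _ _))// lerD//.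
    rewrite normrZ (le_trans _ cr)// ler_piMr ?norm_unit_vec//.
  by rewrite normrZ (le_trans _ dr)// ler_piMr ?norm_unit_vec//.
apply/eqP; rewrite -subr_eq0 -normr_le0; apply/ler_addgt0Pl => eps eps0.
have /cvgrPdist_le/(_ (eps / 2)) := cij x.
have /cvgrPdist_le/(_ (eps / 2)) := cji x.
have e2 : 0 < eps / 2 by rewrite divr_gt0.
move=> /(_ e2) /nbhs_ballP[d1/= d10 h1] /(_ e2) /nbhs_ballP[d2/= d20 h2].
have [r [r0 rd1 rd2]] : exists r : R, [/\ 0 < r, r + r < d1 & r + r < d2].
  exists (Num.min d1 d2 / 4); split; first by rewrite divr_gt0// lt_min d10.
    have : Num.min d1 d2 <= d1 by rewrite ge_min lexx.
    by lra.
  have : Num.min d1 d2 <= d2 by rewrite ge_min lexx orbT.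
  by lra.
have sw (b1 b2 b3 b4 : R) : b1 - b2 - (b3 - b4) = b1 - b3 - (b2 - b4) by ring.
have [y yr E] := key i j r fi fij.
have [z zr E'] := key j i r fj fji.
rewrite (gtr0_norm r0) in yr zr.
have yz : rpd j (rpd i f) y = rpd i (rpd j f) z.
  have r0' := lt0r_neq0 r0; apply: (mulfI r0'); apply: (mulfI r0').
  apply: (etrans (esym E)); apply: etrans E'.
  rewrite sw.
  rewrite (addrAC x (r *: e j)).
  by [].
have := h1 y; rewrite -ball_normE/= distrC => /(_ (le_lt_trans yr rd1)) H1.
have := h2 z; rewrite -ball_normE/= distrC => /(_ (le_lt_trans zr rd2)).
rewrite -yz => H2.
rewrite addr0 (le_trans (ler_distD (rpd j (rpd i f) y) _ _))// [leRHS](splitr eps) lerD//.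
by rewrite distrC.
Qed.

End several_variables.
End calculus.

(** * Lebesgue measure and the Gaussian weight on R^n *)

Section row_vectors.
Context {R : realType}.
Local Notation rT := (measurableTypeR R).

Section continuous_real_functions.
Context {T : topologicalType}.
Implicit Types f g : T -> R.

Lemma cont_cst (c : R) : continuous (fun _ : T => c).
Proof. exact: cst_continuous. Qed.

Lemma contD f g : continuous f -> continuous g -> continuous (fun t => f t + g t).
Proof. by move=> fc gc t; apply: cvgD; [exact: fc|exact: gc]. Qed.

Lemma contM f g : continuous f -> continuous g -> continuous (fun t => f t * g t).
Proof. by move=> fc gc t; apply: cvgM; [exact: fc|exact: gc]. Qed.

Lemma contN f : continuous f -> continuous (fun t => - f t).
Proof. by move=> fc t; apply: cvgN; exact: fc. Qed.

Lemma contB f g : continuous f -> continuous g -> continuous (fun t => f t - g t).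
Proof. by move=> fc gc; apply: contD => //; exact: contN. Qed.

Lemma cont_comp f (h : R -> R) : continuous f -> continuous h -> continuous (fun t => h (f t)).
Proof. by move=> fc hc t; apply: continuous_comp; [exact: fc|exact: hc]. Qed.

End continuous_real_functions.

Lemma cvg_sumr (T : Type) (F : set_system T) {FF : Filter F} (I : Type) (r : seq I)
    (f : I -> T -> R) (l : I -> R) :
  (forall i, f i t @[t --> F] --> l i) ->
  (\sum_(i <- r) f i t) @[t --> F] --> \sum_(i <- r) l i.
Proof. by move=> fl; apply: cvg_big => //; exact: add_continuous. Qed.

Lemma cvg_row (T : Type) (F : set_system T) {FF : Filter F} n
    (p : T -> 'rV[R]_n) (l : 'rV[R]_n) :
  (forall i, p t 0 i @[t --> F] --> l 0 i) -> p t @[t --> F] --> l.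
Proof.
move=> pl; apply/cvgrPdist_le => eps eps0.
near=> t; apply: row_norm_le => [|i]; first exact: ltW.
rewrite !mxE; move: i; near: t; apply: filter_forall => i.
by have /cvgrPdist_le := pl i; exact.
Unshelve. all: by end_near. Qed.

Lemma continuous_row (T : topologicalType) n (p : T -> 'rV[R]_n) :
  (forall i, continuous (fun t => p t 0 i)) -> continuous p.
Proof. by move=> pc t; apply: cvg_row => i; exact: pc. Qed.

Lemma continuous_comp_row (T : topologicalType) n (p : T -> 'rV[R]_n) (f : 'rV[R]_n -> R) :
  (forall i, continuous (fun t => p t 0 i)) -> continuous f -> continuous (fun t => f (p t)).
Proof.
move=> pc fc t.
have H : p s @[s --> t] --> p t by exact: continuous_row.
exact: (cvg_comp _ _ H (fc _)).
Qed.

Lemma continuous_mulmx_coord m n (U : 'M[R]_(m, n)) i :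
  continuous (fun z : 'rV[R]_m => (z *m U) 0 i).
Proof.
move=> z; under eq_fun do rewrite mxE; rewrite /=.
apply: (@cvg_sumr _ (nbhs z)) => j.
by apply: cvgM; [exact: coord_continuous|exact: cvg_cst].
Qed.

(* Continuity refers to the topology of 'rV[R]_n and measurability to the product
   sigma-algebra on tuples: f is the limit of its values on finer grids. *)
Lemma measurable_continuous_row n (f : 'rV[R]_n -> R) : continuous f ->
  measurable_fun setT (fun y : n.-tuple rT => f (row_of_tuple y)).
Proof.
move=> fc.
pose d k (y : n.-tuple rT) : 'rV[R]_n :=
  \row_i ((Num.floor (k.+1%:R * tnth y i))%:~R / k.+1%:R).
apply: (measurable_fun_cvg (h := fun k => f \o d k)) => [k|y _]; last first.
  apply: (@cvg_comp _ _ _ (fun k => d k y) f _ (nbhs (row_of_tuple y))); last exact: fc.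
  apply: cvg_row => i.
  have H : (fun k => k.+1%:R^-1 : R) @ \oo --> (0 : R) by exact: cvg_harmonic.
  apply/cvgrPdist_le => eps eps0; near=> k; rewrite !mxE.
  have k0 : (0 : R) < k.+1%:R by [].
  apply: (@le_trans _ _ (k.+1%:R^-1)); last first.
    near: k; apply: filterS (cvgr0_norm_le _ H _ eps0) => m.
    exact: le_trans (ler_norm _).
  rewrite -[X in `|X - _|](mulfK (lt0r_neq0 k0)) -mulrBl normrM (gtr0_norm (x := _^-1)) ?invr_gt0//.
  rewrite ler_piMl ?invr_ge0// (mulrC _ k.+1%:R).
  have /andP[h1 h2] := floor_itv (k.+1%:R * tnth y i).
  rewrite ger0_norm ?subr_ge0// lerBlDl.
  by rewrite rmorphD/= in h2; exact: ltW.
move=> _ Y mY; rewrite setTI.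
(* [A c] is the grid cell with integer corner [c]. The rounded function is constant on each cell, so
   a preimage is a countable union of cells, each a finite intersection of coordinate strips. *)
pose A (c : {ffun 'I_n -> int}) := \bigcap_i [set y : n.-tuple rT | Num.floor (k.+1%:R * tnth y i) = c i].
rewrite (_ : _ @^-1` _ = \bigcup_(c in [set: {ffun 'I_n -> int}]) (if `[< Y (f (\row_i ((c i)%:~R / k.+1%:R))) >] then A c else set0)).
  apply: countable_bigcupT_measurable; first exact: countableP.
  move=> c; case: ifP => // _; apply: fin_bigcap_measurable => // i _.
  rewrite (_ : [set y | _] = (fun y : n.-tuple rT => tnth y i) @^-1` `[(c i)%:~R / k.+1%:R, (c i + 1)%:~R / k.+1%:R[).
    by rewrite -[X in measurable X]setTI; exact: (measurable_tnth i).
  apply/seteqP; split => y /=; rewrite in_itv/= ler_pdivrMr// ltr_pdivlMr// mulrC.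
    by move=> <-; exact: floor_itv.
  exact: floor_def.
apply/seteqP; split=> [y/= Yy|y/= [c _]].
  exists [ffun i => Num.floor (k.+1%:R * tnth y i)] => //.
  rewrite ifT; first by move=> i _ /=; rewrite ffunE.
  apply/asboolP; rewrite (_ : \row_i _ = d k y)//.
  by apply/rowP => i; rewrite !mxE ffunE.
case: ifP => // /asboolP Yc Ac; rewrite (_ : d k y = \row_i ((c i)%:~R / k.+1%:R))//.
by apply/rowP => i; rewrite !mxE (Ac i).
Unshelve. all: by end_near. Qed.

Lemma row_of_tuple_cons n (p : rT * n.-tuple rT) :
  row_of_tuple (tuple_cons p) = row_mx p.1%:M (row_of_tuple p.2) :> 'rV[R]_(1 + n).
Proof.
apply/rowP => i; rewrite !mxE; case: split_ordP => j ->; rewrite !mxE.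
  by rewrite (ord1 j) eqxx mulr1n.
by rewrite (_ : rshift 1 j = lift ord0 j)//= ?tnthS//; exact/val_inj.
Qed.

Lemma lebesgue_tupleS n (h : n.+1.-tuple rT -> \bar R) :
  measurable_fun setT h -> (forall y, 0 <= h y)%E ->
  (\int[lebesgue_tuple n.+1]_y h y =
   \int[lebesgue_measure]_x \int[lebesgue_tuple n]_y h (tuple_cons (x, y)))%E.
Proof.
move=> mh h0; rewrite /= /lebesgue_step.
rewrite ge0_integral_pushforward//=; last exact: measurable_tuple_cons.
rewrite preimage_setT fubini_tonelli1//.
by apply: measurableT_comp => //; exact: measurable_tuple_cons.
Qed.

Lemma lebesgue_tupleS_swap n (h : n.+1.-tuple rT -> \bar R) :
  measurable_fun setT h -> (forall y, 0 <= h y)%E ->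
  (\int[lebesgue_tuple n.+1]_y h y =
   \int[lebesgue_tuple n]_y \int[lebesgue_measure]_x h (tuple_cons (x, y)))%E.
Proof.
move=> mh h0; rewrite lebesgue_tupleS//.
rewrite (@fubini_tonelli _ _ _ _ _ lebesgue_measure (lebesgue_tuple n) (h \o @tuple_cons R n))//;
  last by move=> p; exact: h0.
by apply: measurableT_comp => //; exact: measurable_tuple_cons.
Qed.

Lemma integral_affine (c b : R) (h : R -> R) : 0 < c -> continuous h -> (forall x, 0 <= h x) ->
  (\int[lebesgue_measure]_x (h x)%:E = \int[lebesgue_measure]_x (c * h (b + x * c))%:E)%E.
Proof.
move=> c0 hc h0.
have dF x : is_derive x (1 : R) (fun x => b + x * c) c.
  apply/is_derive1P; apply: cvg_near_cst; near=> t.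
  rewrite (_ : _ - _ = t * c); last by ring.
  by rewrite mulKf//; near: t; exact: nbhs_dnbhs_neq.
have F' : (fun x => b + x * c)^`()%classic = cst c.
  by apply/funext => x; rewrite derive1E derive_val.
rewrite (@increasing_ge0_integration_by_substitutionT _ (fun x => b + x * c))//.
- by apply: eq_integral => x _; rewrite F' !fctE mulrC.
- by move=> x y xy; rewrite ltrD2l ltr_pM2r.
- by rewrite F' => x; exact: cvg_cst.
- by rewrite F'; exact: is_cvg_cst.
- by rewrite F'; exact: is_cvg_cst.
- apply/cvgrNyPle => A; near=> x; rewrite -lerBrDl -(ler_pdivlMr _ _ c0).
  by near: x; exact: nbhs_ninfty_le (num_real _).
- apply/cvgryPge => A; near=> x; rewrite -lerBlDl -(ler_pdivrMr _ _ c0).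
  by near: x; exact: nbhs_pinfty_ge (num_real _).
Unshelve. all: by end_near. Qed.

(* Triangular matrices suffice below, and for them the change of variables is a
   one-dimensional one in each coordinate. *)
Definition upper_pos n (U : 'M[R]_n) :=
  (forall i j : 'I_n, (j < i)%N -> U i j = 0) /\ forall i, 0 < U i i.

(** Induction on [n]. In block form [U] has corner [u], first row [l] and lower block [U'], so with
    the first coordinate [x] fixed the others undergo the affine map with shift [b' + x l] and
    matrix [U'], covered by the induction hypothesis. Exchanging the integrals leaves a scalar
    substitution in [x]. *)
Lemma lebesgue_tuple_affine n (U : 'M[R]_n) (b : 'rV[R]_n) (h : 'rV[R]_n -> R) :
  upper_pos U -> continuous h -> (forall x, 0 <= h x) ->
  (\int[lebesgue_tuple n]_y (h (row_of_tuple y))%:E =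
   \int[lebesgue_tuple n]_y ((\prod_i U i i) * h (b + row_of_tuple y *m U))%:E)%E.
Proof.
elim: n U b h => [|n IH] U b h [U0 Ud] hc h0.
  apply: eq_integral => y _; rewrite big_ord0 mul1r; congr (h _)%:E.
  by apply/rowP => -[].
have mh (g : 'rV[R]_n.+1 -> R) : continuous g ->
    measurable_fun setT (fun y : n.+1.-tuple rT => (g (row_of_tuple y))%:E).
  by move=> gc; apply/measurable_EFinP; exact: measurable_continuous_row.
pose u := U 0 0; pose l := ursubmx (U : 'M[R]_(1 + n)); pose U' := drsubmx (U : 'M[R]_(1 + n)).
pose b' := rsubmx (b : 'rV[R]_(1 + n)).
pose k (x : R) (z : 'rV[R]_n) := h (row_mx x%:M z : 'rV[R]_(1 + n)).
have kc1 z : continuous (k ^~ z).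
  apply: continuous_comp_row => // i x; case: (split_ordP i) => j ->.
    under eq_fun do rewrite row_mxEl mxE.
    by rewrite (ord1 j) eqxx; exact: cvg_id.
  by under eq_fun do rewrite row_mxEr; exact: cvg_cst.
have kc2 x : continuous (k x).
  apply: continuous_comp_row => // i z; case: (split_ordP i) => j ->.
    by under eq_fun do rewrite row_mxEl mxE; exact: cst_continuous.
  by under eq_fun do rewrite row_mxEr; exact: coord_continuous.
have U'P : upper_pos U'.
  split=> [i j ij|i]; rewrite !mxE; first by apply: U0; exact: ij.
  exact: Ud.
have bU x (y : 'rV[R]_n) : b + (row_mx x%:M y : 'rV[R]_(1 + n)) *m U =
   row_mx (b 0 0 + x * u)%:M ((b' + x *: l) + y *m U') :> 'rV[R]_(1 + n).
  have EU : U = block_mx u%:M l 0 U' :> 'M[R]_(1 + n).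
    rewrite -[LHS](@submxK _ 1 n 1 n); congr block_mx.
      by rewrite [LHS]mx11_scalar !mxE; congr (U _ _)%:M; exact/val_inj.
    by apply/matrixP => i j; rewrite !mxE; apply: U0; rewrite (ord1 j).
  have Eb : b = row_mx (b 0 0)%:M b' :> 'rV[R]_(1 + n).
    rewrite -[LHS](@hsubmxK _ 1 1 n); congr row_mx.
    by rewrite [LHS]mx11_scalar !mxE; congr (b _ _)%:M; exact/val_inj.
  transitivity (row_mx (b 0 0)%:M b' + row_mx x%:M y *m block_mx u%:M l 0 U' : 'rV[R]_(1 + n)).
    exact: (f_equal2 (fun (p : 'rV[R]_(1 + n)) (q : 'M[R]_(1 + n)) => p + row_mx x%:M y *m q) Eb EU).
  rewrite mul_row_block add_row_mx mulmx0 addr0 !mul_scalar_mx addrA.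
  by rewrite scale_scalar_mx -raddfD.
have Eu : \prod_i U i i = u * \prod_i U' i i.
  rewrite big_ord_recl; congr (_ * _); apply: eq_bigr => i _.
  by rewrite !mxE; congr (U _ _); exact/val_inj.
rewrite [RHS]lebesgue_tupleS; last 2 first.
- apply: (mh (fun z => (\prod_i U i i) * h (b + z *m U))).
  apply: contM; first exact: cont_cst.
  apply: continuous_comp_row => // i.
  under eq_fun do rewrite mxE.
  by apply: contD; [exact: cont_cst|exact: continuous_mulmx_coord].
- by move=> y; rewrite lee_fin mulr_ge0//; apply: prodr_ge0 => i _; exact: ltW.
have -> : (\int[lebesgue_measure]_x \int[lebesgue_tuple n]_y
     ((\prod_i U i i) * h (b + row_of_tuple (tuple_cons (x, y)) *m U))%:E =
   \int[lebesgue_measure]_x \int[lebesgue_tuple n]_y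
     (u * k (b 0 0 + x * u)%R (row_of_tuple y))%:E)%E.
  apply: eq_integral => x _.
  rewrite [RHS](IH U' (b' + x *: l) (fun z => u * k (b 0 0 + x * u) z))//.
  - by apply: eq_integral => y _; rewrite row_of_tuple_cons bU Eu mulrA (mulrC u).
  - by apply: contM; [exact: cont_cst|exact: kc2].
  - by move=> z; exact: mulr_ge0 (ltW (Ud 0)) (h0 _).
rewrite (@fubini_tonelli _ _ _ _ _ lebesgue_measure (lebesgue_tuple n)
   (fun p => (u * k (b 0 0 + p.1 * u) (row_of_tuple p.2))%:E))//; last 2 first.
- pose g (z : 'rV[R]_(1 + n)) := u * k (b 0 0 + lsubmx z 0 0 * u) (rsubmx z).
  rewrite (_ : (fun p => _) = (fun y => (g (row_of_tuple y))%:E) \o @tuple_cons R n); last first.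
    by apply/funext => p /=; rewrite row_of_tuple_cons /g row_mxKr row_mxKl mxE eqxx mulr1n.
  apply: measurableT_comp; last exact: measurable_tuple_cons.
  apply: mh; apply: contM; first exact: cont_cst.
  apply: continuous_comp_row => // i.
  case: (split_ordP i) => j ->.
    under eq_fun do rewrite row_mxEl mxE; rewrite (ord1 j) eqxx/= ?mulr1n.
    apply: contD; first exact: cont_cst.
    apply: contM; last exact: cont_cst.
    under eq_fun do rewrite mxE; exact: coord_continuous.
  under eq_fun do rewrite row_mxEr mxE; exact: coord_continuous.
- by move=> [x y]; rewrite lee_fin; exact: mulr_ge0 (ltW (Ud 0)) (h0 _).
rewrite [LHS]lebesgue_tupleS_swap; last 2 first.
- exact: mh.
- by move=> y; rewrite lee_fin.
apply: eq_integral => y _.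
under eq_integral do rewrite row_of_tuple_cons/=.
exact: (@integral_affine u (b 0 0) (k ^~ (row_of_tuple y)) (Ud 0) (kc1 _) (fun _ => h0 _)).
Qed.

Lemma lebesgue_tuple_prod n (g : R -> R) (c : R) : continuous g -> (forall x, 0 <= g x) ->
  (\int[lebesgue_measure]_x (g x)%:E = c%:E)%E ->
  (\int[lebesgue_tuple n]_y (\prod_i g (row_of_tuple y 0 i))%:E = (c ^+ n)%:E)%E.
Proof.
move=> gc g0 gI.
have c0 : 0 <= c by rewrite -lee_fin -gI integral_ge0// => x _; rewrite lee_fin.
have mg : measurable_fun setT g by exact: continuous_measurable_fun.
elim: n => [|n IH].
  under eq_integral do rewrite big_ord0.
  by rewrite integral_cst//= diracT mule1 expr0.
have p0 m (y : m.-tuple rT) : 0 <= \prod_i g (row_of_tuple y 0 i) by exact: prodr_ge0.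
rewrite lebesgue_tupleS; last 2 first.
- apply/measurable_EFinP.
  by apply: measurable_prod => i _; apply: measurableT_comp => //=; under eq_fun do rewrite mxE;
    exact: measurable_tnth.
- by move=> y; rewrite lee_fin.
transitivity (\int[lebesgue_measure]_x ((c ^+ n)%:E * (g x)%:E))%E.
  apply: eq_integral => x _.
  rewrite muleC -IH -ge0_integralZl//.
  - apply: eq_integral => y _; rewrite -EFinM big_ord_recl !mxE; congr (_ * _)%:E.
    by apply: eq_bigr => i _; rewrite !mxE tnthS.
  - apply/measurable_EFinP.
    by apply: measurable_prod => i _; apply: measurableT_comp => //=; under eq_fun do rewrite mxE;
      exact: measurable_tnth.
  - by move=> y _; rewrite lee_fin.
  - by rewrite lee_fin.
rewrite ge0_integralZl//; last 3 first.
- exact/measurable_EFinP.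
- by move=> x _; rewrite lee_fin.
- by rewrite lee_fin exprn_ge0.
by rewrite gI -EFinM exprSr.
Qed.

(* The heat kernel at time 1, i.e. the normal density of variance 2. *)
Definition gauss1 (r : R) := (Num.sqrt (4 * pi))^-1 * expR (- (r ^+ 2 / 4)).
Definition gauss n (z : 'rV[R]_n) := \prod_i gauss1 (z 0 i).

Lemma gauss1_ge0 r : 0 <= gauss1 r.
Proof. by rewrite mulr_ge0 ?expR_ge0// invr_ge0 sqrtr_ge0. Qed.

Lemma gauss_ge0 n (z : 'rV[R]_n) : 0 <= gauss z.
Proof. by apply: prodr_ge0 => i _; exact: gauss1_ge0. Qed.

Lemma continuous_gauss1 : continuous gauss1.
Proof.
apply: contM; first exact: cont_cst.
apply: cont_comp; last exact: continuous_expR.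
apply: contN; apply: contM; last exact: cont_cst.
exact: exprn_continuous.
Qed.

Lemma integral_gauss1 : (\int[lebesgue_measure]_x (gauss1 x)%:E = 1%:E)%E.
Proof.
rewrite -(integral_normal_pdf 0 (Num.sqrt 2)); apply: eq_integral => x _.
rewrite normal_pdfE ?gt_eqF ?sqrtr_gt0// /gauss1 /normal_peak /normal_fun subr0 sqr_sqrtr//.
congr (_^-1 * expR _)%:E; last by lra.
by congr Num.sqrt; lra.
Qed.

Lemma integral_gauss1_exp (M : R) :
  exists c, (\int[lebesgue_measure]_x (gauss1 x * expR (M * `|x|))%:E = c%:E)%E.
Proof.
have cont : continuous (fun x => gauss1 x * expR (M * `|x|)).
  apply: contM; first exact: continuous_gauss1.
  apply: cont_comp; last exact: continuous_expR.
  by apply: contM; [exact: cont_cst|exact: norm_continuous].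
have g0 x : 0 <= gauss1 x * expR (M * `|x|) by rewrite mulr_ge0 ?gauss1_ge0 ?expR_ge0.
suff H : (\int[lebesgue_measure]_x (gauss1 x * expR (M * `|x|))%:E < +oo)%E.
  eexists; rewrite -[LHS]fineK// ge0_fin_numE//.
  by apply: integral_ge0 => x _; rewrite lee_fin.
(* Half of the Gaussian exponent absorbs the exponential: [M |x| - x^2/4 <= 2 M^2 - x^2/8], the
   difference being [(|x| - 4M)^2 / 8]. What remains is the normal density of standard deviation 2
   up to normalisation, whence the factors of [K]. *)
pose K := (Num.sqrt (4 * pi))^-1 / normal_peak (2 : R) * expR (2 * M ^+ 2) : R.
have p0 : 0 < normal_peak (2 : R) by apply: normal_peak_gt0; rewrite pnatr_eq0.
have K0 : 0 <= K.
  by rewrite mulr_ge0 ?expR_ge0// mulr_ge0// invr_ge0 ?sqrtr_ge0//; exact: ltW.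
apply: (@le_lt_trans _ _ (\int[lebesgue_measure]_x (K%:E * (normal_pdf 0 2 x)%:E))%E); last first.
  rewrite ge0_integralZl//=; last 2 first.
  - by apply/measurable_EFinP; exact: measurable_normal_pdf.
  - by move=> x _; rewrite lee_fin normal_pdf_ge0.
  by rewrite integral_normal_pdf mule1 ltry.
apply: ge0_le_integral => //.
- by move=> x _; rewrite lee_fin.
- by apply/measurable_EFinP; exact: continuous_measurable_fun.
- by apply: measurable_funeM; apply/measurable_EFinP; exact: measurable_normal_pdf.
move=> x _; rewrite -EFinM lee_fin normal_pdfE ?pnatr_eq0// /normal_fun subr0 /K /gauss1.
rewrite [leRHS](_ : _ = (Num.sqrt (4 * pi))^-1 * (expR (2 * M ^+ 2) * expR (- x ^+ 2 / (2 ^+ 2 *+ 2)))); last first.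
  move: (expR (2 * _)) (expR (- x ^+ 2 / _)) (_ ^-1) p0 => e1 e2 e3 p0.
  by field; rewrite gt_eqF.
rewrite -mulrA ler_wpM2l ?invr_ge0 ?sqrtr_ge0// -!expRD ler_expR -subr_ge0.
rewrite [leRHS](_ : _ = (`|x| - 4 * M) ^+ 2 / 8); first by rewrite divr_ge0 ?sqr_ge0.
by rewrite -[x ^+ 2]real_normK ?num_real//; field.
Qed.

Lemma norm_le_sum n (z : 'rV[R]_n) : `|z| <= \sum_i `|z 0 i|.
Proof.
apply: row_norm_le => [|i]; first exact: sumr_ge0.
by rewrite (bigD1 i)//= lerDl sumr_ge0.
Qed.

Lemma continuous_gauss n : continuous (@gauss n).
Proof.
rewrite /gauss; apply: continuous_big => [|i _]; first exact: mul_continuous.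
by apply: cont_comp; [exact: coord_continuous|exact: continuous_gauss1].
Qed.

(** The sup norm is at most the sum of the absolute values of the coordinates, so the integrand is
    dominated by a product of one-variable functions with finite integral. *)
Lemma integrable_gauss_exp n (M : R) : 0 <= M ->
  (lebesgue_tuple n).-integrable setT
    (fun y => (gauss (row_of_tuple y) * expR (M * `|row_of_tuple y|))%:E).
Proof.
move=> M0.
have c1 (T : topologicalType) (g : T -> R) : continuous g -> continuous (fun x => expR (M * g x)).
  move=> gc; apply: cont_comp; last exact: continuous_expR.
  by apply: contM => //; exact: cont_cst.
have cn : continuous (fun z : 'rV[R]_n => gauss z * expR (M * `|z|)).
  apply: contM; first exact: continuous_gauss.
  by apply: (c1 _ (fun z : 'rV[R]_n => `|z|)); exact: norm_continuous.
apply/integrableP; split; first by apply/measurable_EFinP; exact: (measurable_continuous_row cn).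
have [c Ec] := integral_gauss1_exp M.
apply: (@le_lt_trans _ _ ((c ^+ n)%:E)); last by rewrite ltry.
rewrite -(@lebesgue_tuple_prod n (fun x => gauss1 x * expR (M * `|x|)))//; last 2 first.
- apply: contM; first exact: continuous_gauss1.
  by apply: (c1 _ (fun x : R => `|x|)); exact: norm_continuous.
- by move=> x; rewrite mulr_ge0 ?expR_ge0 ?gauss1_ge0.
apply: ge0_le_integral => //.
- apply: measurableT_comp => //; apply/measurable_EFinP; exact: (measurable_continuous_row cn).
- apply/measurable_EFinP; apply: measurable_prod => i _.
  apply: (@measurableT_comp _ _ _ _ _ _ (fun x => gauss1 x * expR (M * `|x|))).
    apply: continuous_measurable_fun; apply: contM; first exact: continuous_gauss1.
    by apply: (c1 _ (fun x : R => `|x|)); exact: norm_continuous.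
  by under eq_fun do rewrite mxE; exact: measurable_tnth.
move=> y _; rewrite lee_fin ger0_norm ?mulr_ge0 ?gauss_ge0 ?expR_ge0//.
rewrite big_split/= ler_wpM2l ?gauss_ge0// -expR_sum ler_expR -mulr_sumr.
by rewrite ler_wpM2l// norm_le_sum.
Qed.

Lemma integral_gauss n : (\int[lebesgue_tuple n]_y (gauss (row_of_tuple y))%:E = 1%:E)%E.
Proof.
rewrite (@lebesgue_tuple_prod n gauss1 1) ?expr1n//; first exact: continuous_gauss1.
- exact: gauss1_ge0.
- exact: integral_gauss1.
Qed.

Lemma gaussE n (z : 'rV[R]_n) :
  gauss z = (Num.sqrt ((4 * pi) ^+ n))^-1 * expR (- (4^-1 * (z *m z^T) 0 0)).
Proof.
rewrite /gauss /gauss1 big_split/= prodr_const card_ord -expR_sum.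
have p0 : (0 : R) <= 4 * pi by rewrite mulr_ge0// pi_ge0.
congr (_ * expR _).
  rewrite exprVn; congr (_^-1).
  by apply: (pexpIrn (n := 2)); rewrite ?nnegrE ?exprn_ge0 ?sqrtr_ge0// exprAC !sqr_sqrtr//
    exprn_ge0.
rewrite mxE mulr_sumr -sumrN; apply: eq_bigr => i _.
by rewrite mxE mulrC expr2.
Qed.

End row_vectors.

(** * Gaussian averages *)

Section derivation_under_integral.
Context {R : realType} d (T : measurableType d) (mu : {measure set T -> \bar R}).

Lemma RintegrableB (D : set T) (f g : T -> R) : measurable D ->
  mu.-integrable D (EFin \o f) -> mu.-integrable D (EFin \o g) ->
  mu.-integrable D (EFin \o (fun y => f y - g y)).
Proof. by move=> mD fi gi; exact: (integrableB mD fi gi). Qed.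

Lemma RintegrableZ (D : set T) (c : R) (f : T -> R) : measurable D ->
  mu.-integrable D (EFin \o f) -> mu.-integrable D (EFin \o (fun y => c * f y)).
Proof. by move=> mD fi; exact: (integrableZl mD c fi). Qed.

(* The difference quotients are only dominated at t0, unlike in the library, so
   that phi' need not exist near t0 nor, at t0, for every y. *)
Lemma is_derive_integral (D : set T) (phi : R -> T -> R) (phi' g : T -> R) (t0 : R) :
  measurable D ->
  (\forall t \near t0, mu.-integrable D (EFin \o phi t)) ->
  measurable_fun D phi' -> mu.-integrable D (EFin \o g) ->
  (\forall t \near t0, forall y, D y -> `|phi t y - phi t0 y| <= `|t - t0| * g y) ->
  {ae mu, forall y, D y -> is_derive t0 (1 : R) (phi^~ y) (phi' y)} ->
  mu.-integrable D (EFin \o phi') /\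
  is_derive t0 (1 : R) (fun t => \int[mu]_(y in D) phi t y) (\int[mu]_(y in D) phi' y).
Proof.
move=> mD iphi mphi' ig phig dphi.
have iphi0 : mu.-integrable D (EFin \o phi t0) by exact: nbhs_singleton iphi.
(* Dominated convergence along an arbitrary sequence tending to 0. The shift by [N] makes both local
   hypotheses hold for every index; integrability of [phi'] comes out of any single such
   sequence. *)
have main (u : R^nat) : (forall n, u n != 0) -> u n @[n --> \oo] --> (0 : R) ->
   mu.-integrable D (EFin \o phi') /\
   (u n)^-1 * (\int[mu]_(y in D) phi (t0 + u n) y - \int[mu]_(y in D) phi t0 y) @[n --> \oo]
     --> \int[mu]_(y in D) phi' y.
  move=> u0 uc.
  have tc : t0 + u n @[n --> \oo] --> t0.
    by rewrite -[X in _ --> X]addr0; apply: cvgD => //; exact: cvg_cst.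
  have [N1 _ h1] := tc _ phig; have [N2 _ h2] := tc _ iphi; pose N := maxn N1 N2.
  have hi n : mu.-integrable D (EFin \o phi (t0 + u (n + N)%N)).
    by apply: h2; rewrite /= (leq_trans (leq_maxr N1 N2))// leq_addl.
  have hg n y : D y -> `|phi (t0 + u (n + N)%N) y - phi t0 y| <= `|u (n + N)%N| * g y.
    move=> Dy; have := h1 (n + N)%N _ y Dy; rewrite (addrC t0) addrK addrC; apply.
    by rewrite /= (leq_trans (leq_maxl N1 N2))// leq_addl.
  pose q n y := (u (n + N)%N)^-1 * (phi (t0 + u (n + N)%N) y - phi t0 y).
  have iq n : mu.-integrable D (EFin \o q n).
    by apply: RintegrableZ => //; exact: RintegrableB.
  have mq n : measurable_fun D (EFin \o q n) by have /integrableP[] := iq n.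
  have mphi'E : measurable_fun D (EFin \o phi') by exact/measurable_EFinP.
  have qc : {ae mu, forall y, D y -> (EFin \o q n) y @[n --> \oo] --> (EFin \o phi') y}.
    apply: filterS dphi => y + Dy; move=>
      /(_ Dy) /is_derive1P /cvgr_dnbhsP /(_ (fun n => u (n + N)%N)).
    have uN : (forall n, u (n + N)%N != 0) /\ u (n + N)%N @[n --> \oo] --> (0 : R).
      by split => //; rewrite cvg_shiftn.
    move=> /(_ uN) H; apply: cvg_EFin; first exact: nearW.
    exact: H.
  have qg : {ae mu, forall y n, D y -> (`|(EFin \o q n) y| <= (EFin \o g) y)%E}.
    apply: aeW => y n Dy; rewrite /= lee_fin /q normrM normfV ler_pdivrMl ?normr_gt0//.
    exact: hg.
  have [ip' _ cv] := dominated_convergence mD mq mphi'E qc ig qg; split => //.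
  rewrite -(cvg_shiftn N).
  have -> : (fun n => (u (n + N)%N)^-1 * (\int[mu]_(y in D) phi (t0 + u (n + N)%N) y - \int[mu]_(y in D) phi t0 y))
      = (fun n => \int[mu]_(y in D) q n y).
    apply/funext => n; rewrite -RintegralB// -RintegralZl//.
    exact: RintegrableB.
  apply: fine_cvg; rewrite fineK//.
  exact: integrable_fin_num.
split.
  have [] := main (fun n => n.+1%:R^-1) => //.
  exact: cvg_harmonic.
apply/is_derive1P/cvgr_dnbhsP => u [u0 uc].
by have [] := main u u0 uc.
Qed.

End derivation_under_integral.

Section gaussian_average.
Context {R : realType} {n : nat}.
Local Notation rT := (measurableTypeR R).
Implicit Types (w : 'rV[R]_n -> R).

Definition gint w : R :=
  \int[lebesgue_tuple n]_y (gauss (row_of_tuple y) * w (row_of_tuple y)).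

(** Exponential rather than polynomial growth: the class then contains the majorants
    [expR (M * |z|)] and the factor created by translating the Gaussian, is stable under products,
    and remains integrable against [gauss]. *)
Definition exp_growth w := continuous w /\ exists KM : R * R, forall z, `|w z| <= KM.1 * expR (KM.2 * `|z|).

Definition gmoment (M : R) := gint (fun z => expR (M * `|z|)).

Lemma exp_growth_integrable w : exp_growth w -> (lebesgue_tuple n).-integrable setT
  (fun y => (gauss (row_of_tuple y) * w (row_of_tuple y))%:E).
Proof.
move=> [wc [[K M]/= wK]].
have K0 : 0 <= K by have := wK 0; rewrite normr0 mulr0 expR0 mulr1; exact: le_trans.
pose M' := Num.max M 0; have M'0 : 0 <= M' by rewrite le_max lexx orbT.
apply: (@le_integrable _ _ _ _ _ _ _ (fun y => (K%:E * (gauss (row_of_tuple y) * expR (M' * `|row_of_tuple y|))%:E)%E)) => //.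
- apply/measurable_EFinP; apply: (measurable_continuous_row (f := fun z => gauss z * w z)).
  by apply: contM => //; exact: continuous_gauss.
- move=> y _; rewrite /= lee_fin.
  move: (row_of_tuple y) => z.
  have h0 : 0 <= K * (gauss z * expR (M' * `|z|)) by rewrite !mulr_ge0 ?gauss_ge0 ?expR_ge0.
  rewrite (ger0_norm h0) normrM (ger0_norm (gauss_ge0 z)) mulrCA.
  rewrite ler_wpM2l ?gauss_ge0// (le_trans (wK _))// ler_wpM2l// ler_expR.
  by rewrite ler_wpM2r// le_max lexx.
- by apply: integrableZl => //; exact: integrable_gauss_exp.
Qed.

Lemma exp_growthD w1 w2 : exp_growth w1 -> exp_growth w2 -> exp_growth (fun z => w1 z + w2 z).
Proof.
move=> [c1 [[K1 M1]/= h1]] [c2 [[K2 M2]/= h2]]; split; first exact: contD.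
exists (K1 + K2, Num.max M1 M2) => z /=; rewrite (le_trans (ler_normD _ _))// mulrDl.
have K10 : 0 <= K1 by have := h1 0; rewrite normr0 mulr0 expR0 mulr1; exact: le_trans.
have K20 : 0 <= K2 by have := h2 0; rewrite normr0 mulr0 expR0 mulr1; exact: le_trans.
apply: lerD.
  rewrite (le_trans (h1 z))// ler_wpM2l// ler_expR ler_wpM2r//.
  by rewrite le_max lexx.
rewrite (le_trans (h2 z))// ler_wpM2l// ler_expR ler_wpM2r//.
by rewrite le_max lexx orbT.
Qed.

Lemma exp_growthM w1 w2 : exp_growth w1 -> exp_growth w2 -> exp_growth (fun z => w1 z * w2 z).
Proof.
move=> [c1 [[K1 M1]/= h1]] [c2 [[K2 M2]/= h2]]; split; first exact: contM.
exists (K1 * K2, M1 + M2) => z /=; rewrite normrM mulrDl expRD mulrACA.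
by rewrite ler_pM.
Qed.

Lemma exp_growth_cst (c : R) : exp_growth (fun _ => c).
Proof.
split; first exact: cont_cst.
by exists (`|c|, 0) => z /=; rewrite mul0r expR0 mulr1.
Qed.

Lemma exp_growth_coord i : exp_growth (fun z => z 0 i).
Proof.
split; first exact: coord_continuous.
exists (1, 1) => z /=; rewrite !mul1r (le_trans (coord_le_norm _ _))//.
by rewrite (le_trans _ (expR_ge1Dx _))// lerDr.
Qed.

Lemma exp_growth_expR (M : R) : exp_growth (fun z => expR (M * `|z|)).
Proof.
split; last by exists (1, M) => z /=; rewrite mul1r ger0_norm ?expR_ge0.
apply: cont_comp; last exact: continuous_expR.
by apply: contM; [exact: cont_cst|exact: norm_continuous].
Qed.

Lemma exp_growth_sum (I : Type) (r : seq I) (w : I -> 'rV[R]_n -> R) :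
  (forall i, exp_growth (w i)) -> exp_growth (fun z => \sum_(i <- r) w i z).
Proof.
move=> wok; elim: r => [|i r IH].
  by under eq_fun do rewrite big_nil; exact: exp_growth_cst.
by under eq_fun do rewrite big_cons; exact: exp_growthD.
Qed.

Lemma gintD w1 w2 : exp_growth w1 -> exp_growth w2 ->
  gint (fun z => w1 z + w2 z) = gint w1 + gint w2.
Proof.
move=> h1 h2; rewrite /gint -RintegralD//; try exact: exp_growth_integrable.
by apply: eq_Rintegral => y _; rewrite mulrDr.
Qed.

Lemma gintZ (c : R) w : exp_growth w -> gint (fun z => c * w z) = c * gint w.
Proof.
move=> h; rewrite /gint -RintegralZl//; last exact: exp_growth_integrable.
by apply: eq_Rintegral => y _; rewrite mulrCA.
Qed.

Lemma eq_gint w1 w2 : w1 =1 w2 -> gint w1 = gint w2.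
Proof. by move=> /funext ->. Qed.

Lemma gint_cst (c : R) : gint (fun _ => c) = c.
Proof.
transitivity (c * gint (fun _ => 1)).
  by rewrite -gintZ; [apply: eq_gint => z; rewrite mulr1|exact: exp_growth_cst].
by rewrite /gint; under eq_Rintegral do rewrite mulr1; rewrite /Rintegral integral_gauss mulr1.
Qed.

Lemma gint_sum (I : Type) (r : seq I) (w : I -> 'rV[R]_n -> R) :
  (forall i, exp_growth (w i)) -> gint (fun z => \sum_(i <- r) w i z) = \sum_(i <- r) gint (w i).
Proof.
move=> wok; elim: r => [|i r IH].
  by rewrite big_nil -[RHS](gint_cst 0); apply: eq_gint => z; rewrite big_nil.
rewrite big_cons -IH -gintD//; last exact: exp_growth_sum.
by apply: eq_gint => z; rewrite big_cons.
Qed.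

Lemma le_gint w1 w2 : exp_growth w1 -> exp_growth w2 -> (forall z, w1 z <= w2 z) ->
  gint w1 <= gint w2.
Proof.
move=> h1 h2 w12; apply: le_Rintegral => //; try exact: exp_growth_integrable.
by move=> y _; rewrite ler_wpM2l ?gauss_ge0.
Qed.

Lemma gint_ge0 w : (forall z, 0 <= w z) -> 0 <= gint w.
Proof. by move=> w0; apply: Rintegral_ge0 => y _; rewrite mulr_ge0 ?gauss_ge0. Qed.

Lemma le_norm_gint w (K M : R) : exp_growth w -> (forall z, `|w z| <= K * expR (M * `|z|)) ->
  `|gint w| <= K * gmoment M.
Proof.
move=> h wK; rewrite -gintZ; last exact: exp_growth_expR.
have gK : exp_growth (fun z => K * expR (M * `|z|)) by apply: exp_growthM;
  [exact: exp_growth_cst|exact: exp_growth_expR].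
rewrite ler_norml; apply/andP; split.
  rewrite lerNl -mulN1r -gintZ//; apply: le_gint => //.
    by apply: exp_growthM => //; exact: exp_growth_cst.
  by move=> z; rewrite mulN1r (le_trans _ (wK z))// -normrN ler_norm.
by apply: le_gint => // z; rewrite (le_trans _ (wK z))// ler_norm.
Qed.

Lemma gmoment_ge0 M : 0 <= gmoment M.
Proof. by apply: gint_ge0 => z; exact: expR_ge0. Qed.

Lemma gint_derive (w : R -> 'rV[R]_n -> R) (w' : 'rV[R]_n -> R) (t0 K M : R) :
  (\forall t \near t0, exp_growth (w t)) -> exp_growth w' ->
  (\forall t \near t0, forall z, `|w t z - w t0 z| <= `|t - t0| * (K * expR (M * `|z|))) ->
  (forall z, is_derive t0 (1 : R) (w^~ z) (w' z)) ->
  is_derive t0 (1 : R) (fun t => gint (w t)) (gint w').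
Proof.
move=> wok w'ok wK dw.
apply: (proj2 (is_derive_integral (g := fun y => gauss (row_of_tuple y) * (K * expR (M * `|row_of_tuple y|))) _ _ _ _ _ _)) => //.
- by near=> t; apply: exp_growth_integrable; near: t.
- have /integrableP[] := exp_growth_integrable w'ok; by move=> /measurable_EFinP.
- apply: (exp_growth_integrable (w := fun z => K * expR (M * `|z|))).
  by apply: exp_growthM; [exact: exp_growth_cst|exact: exp_growth_expR].
- near=> t => y _; rewrite -mulrBr normrM (ger0_norm (gauss_ge0 _)) mulrCA ler_wpM2l ?gauss_ge0//.
  by move: (row_of_tuple y); near: t.
- apply: aeW => y _; apply/is_derive1P.
  under eq_fun do rewrite -mulrBr mulrCA.
  apply: cvgM; first exact: cvg_cst.
  exact: (is_derive1P _ _ _).1 (dw _).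
Unshelve. all: by end_near. Qed.

End gaussian_average.
Arguments gmoment {R} n M.

(** * Directional derivatives, increments and matrix norms *)

Section real_derivatives.
Context {R : realType}.

Lemma is_derive_lineP (V : normedModType R) (f : V -> R) (x v : V) (l : R) :
  is_derive (0 : R) (1 : R) (fun r : R => f (x + r *: v)) l -> is_derive x v f l.
Proof.
move=> /is_derive1P fl.
have fl' : h^-1 *: (f (h *: v + x) - f x) @[h --> (0 : R)^'] --> l.
  apply: cvg_trans fl; apply: near_eq_cvg; near=> h.
  by rewrite add0r scale0r addr0 [x + _]addrC.
apply: DeriveDef; first by apply: cvgP fl'.
by rewrite /derive; apply/cvg_lim.
Unshelve. all: by end_near. Qed.

Lemma is_derive_affine (a c t : R) : is_derive t (1 : R) (fun r => a + r * c) c.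
Proof.
apply/is_derive1P; apply: cvg_near_cst; near=> h.
rewrite (_ : _ - _ = h * c); last by ring.
by rewrite mulKf//; near: h; exact: nbhs_dnbhs_neq.
Unshelve. all: by end_near. Qed.

Lemma is_derive_lipschitz (g : R -> R) (t l : R) : is_derive t (1 : R) g l ->
  \forall s \near t, `|g s - g t| <= `|s - t| * (`|l| + 1).
Proof.
move=> /is_derive1P gl.
have : \forall h \near (0 : R)^', `|h^-1 * (g (t + h) - g t)| <= `|l| + 1.
  near=> h; rewrite -[X in `|X|](subrK l) addrC (le_trans (ler_normD _ _))// lerD2l.
  by rewrite distrC; near: h; move/cvgrPdist_le : gl; apply.
move=> /nbhs_ballP[d/= d0 H]; apply/nbhs_ballP; exists d => //= s.
rewrite /ball/= distrC => sd.
have [->|st] := eqVneq s t; first by rewrite !subrr normr0 mul0r.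
have := H (s - t); rewrite /ball/= sub0r normrN => /(_ sd).
rewrite subr_eq0 => /(_ st); rewrite addrCA subrr addr0 normrM normfV.
by rewrite ler_pdivrMl// normr_gt0 subr_eq0.
Unshelve. all: by end_near. Qed.

(** For [s >= 0], multiply [1 - s <= expR (- s)] by [expR s]; for [s < 0], [1 + s <= expR s] already
    suffices. *)
Lemma norm_expR_sub1 (s : R) : `|expR s - 1| <= `|s| * expR `|s|.
Proof.
have h1 := expR_ge1Dx s; have h2 := expR_ge1Dx (- s).
have h3 : expR s - 1 <= s * expR s.
  have : (1 - s) * expR s <= expR (- s) * expR s by rewrite ler_wpM2r ?expR_ge0.
  by rewrite -expRD addNr expR0; lra.
have [s0|s0] := leP 0 s.
  by rewrite !ger0_norm//; lra.
rewrite ler0_norm; last by rewrite subr_le0 -expR0 ler_expR ltW.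
rewrite (ltr0_norm s0); apply: (@le_trans _ _ (- s * 1)); first lra.
by rewrite ler_wpM2l ?oppr_ge0 ?ltW// -expR0 ltr_expR oppr_gt0.
Qed.

Lemma entry_le_norm m n (U : 'M[R]_(m, n)) i j : `|U i j| <= `|U|.
Proof. by rewrite [leRHS]/Num.norm/= mx_normrE (le_bigmax _ _ (i, j)). Qed.

Lemma mx_norm_le m n (U : 'M[R]_(m, n)) (M : R) : 0 <= M ->
  (forall i j, `|U i j| <= M) -> `|U| <= M.
Proof.
move=> M0 UM; rewrite [leLHS]/Num.norm/= mx_normrE; apply/bigmax_leP; split => // -[i j] _;
  exact: UM.
Qed.

Lemma norm_mulmx m n (z : 'rV[R]_m) (U : 'M[R]_(m, n)) : `|z *m U| <= m%:R * `|U| * `|z|.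
Proof.
apply: row_norm_le => [|j]; first by rewrite !mulr_ge0.
rewrite mxE (le_trans (ler_norm_sum _ _ _))//.
apply: (@le_trans _ _ (\sum_(i < m) `|U| * `|z|)).
  apply: ler_sum => i _; rewrite normrM mulrC.
  by rewrite ler_pM ?entry_le_norm ?coord_le_norm.
by rewrite sumr_const card_ord -[leLHS]mulr_natl mulrA.
Qed.

Lemma norm_mx_derive_lipschitz m n (U : R -> 'M[R]_(m, n)) (U' : 'M[R]_(m, n)) (t : R) :
  (forall i j, is_derive t (1 : R) (fun s => U s i j) (U' i j)) ->
  \forall s \near t, `|U s - U t| <= `|s - t| * (`|U'| + 1).
Proof.
move=> dU; near=> s; apply: mx_norm_le => [|i j]; first by rewrite mulr_ge0// addr_ge0.
rewrite !mxE (le_trans (y := `|s - t| * (`|U' i j| + 1)))//; last first.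
  by rewrite ler_wpM2l// lerD2r entry_le_norm.
move: i j; near: s; apply: filter_forall => i; apply: filter_forall => j.
exact: is_derive_lipschitz (dU i j).
Unshelve. all: by end_near. Qed.

End real_derivatives.

(** * The averaging operator and its bounds *)

Section gaussian_operator.
Context {R : realType} {n : nat}.
Implicit Types (f w : 'rV[R]_n -> R) (x y z : 'rV[R]_n) (U : 'M[R]_n).
Local Notation e := (@unit_vec R n).

(** One constant serves the function and its first derivatives: the first bound gives integrability
    against the Gaussian, the second a Lipschitz estimate that dominates difference quotients. *)
Definition bounded_C1 (K : R) f := [/\ forall i x, derivable f x (e i),
  forall i, continuous (rpd i f), forall x, `|f x| <= K & forall i x, `|rpd i f x| <= K].

Lemma bounded_C1_lipschitz K f : bounded_C1 K f -> forall x y, `|f x - f y| <= n%:R * K * `|x - y|.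
Proof. by move=> [fd _ _ fK] x y; exact: lipschitz_rpd. Qed.

Lemma bounded_C1_ge0 K f : bounded_C1 K f -> 0 <= K.
Proof. by move=> [_ _ fK _]; exact: le_trans (fK 0). Qed.

Lemma bounded_C1_continuous K f : bounded_C1 K f -> continuous f.
Proof.
move=> fK x; apply/(@cvgrPdist_le _ _ _ (nbhs x)) => eps eps0.
have K0 := bounded_C1_ge0 fK.
have c0 : 0 < n%:R * K + 1 by rewrite ltr_wpDl// mulr_ge0.
apply/nbhs_ballP; exists (eps / (n%:R * K + 1)); first by rewrite /= divr_gt0.
move=> y; rewrite -ball_normE/= => xy.
rewrite (le_trans (bounded_C1_lipschitz fK _ _))//.
apply: (@le_trans _ _ ((n%:R * K + 1) * `|x - y|)); first by rewrite ler_wpM2r// lerDl.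
by rewrite mulrC -ler_pdivlMr// ltW.
Qed.

Lemma continuous_affine f x U : continuous f -> continuous (fun z : 'rV[R]_n => f (x + z *m U)).
Proof.
move=> fc; apply: continuous_comp_row => // i.
under eq_fun do rewrite mxE.
by apply: contD; [exact: cont_cst|exact: continuous_mulmx_coord].
Qed.

Lemma exp_growth_bounded w K : continuous w -> (forall z, `|w z| <= K) -> exp_growth w.
Proof. by move=> wc wK; split => //; exists (K, 0) => z; rewrite mul0r expR0 mulr1. Qed.

Lemma gmoment0 : @gmoment R n 0 = 1.
Proof.
by rewrite -[RHS](@gint_cst R n) /gmoment; apply: eq_gint => z; rewrite mul0r expR0.
Qed.

Lemma exp_growthB w1 w2 : exp_growth w1 -> exp_growth w2 -> exp_growth (fun z => w1 z - w2 z).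
Proof.
move=> h1 h2; rewrite (_ : (fun _ => _) = (fun z => w1 z + -1 * w2 z)).
  by apply: exp_growthD => //; apply: exp_growthM => //; exact: exp_growth_cst.
by apply/funext => z; rewrite mulN1r.
Qed.

Lemma gintB w1 w2 : exp_growth w1 -> exp_growth w2 ->
  gint (fun z => w1 z - w2 z) = gint w1 - gint w2.
Proof.
move=> h1 h2; have h3 : exp_growth (fun z => -1 * w2 z) by apply: exp_growthM => //;
  exact: exp_growth_cst.
rewrite -[- gint w2]mulN1r -gintZ// -gintD//.
by apply: eq_gint => z; rewrite mulN1r.
Qed.

(* For U^T U = A(t) - A(s) this is W_{s,t} f. The Gaussian being fixed, the
   dependence on x and t goes through the argument of f alone. *)
Definition gavg U f x := gint (fun z => f (x + z *m U)).

Lemma exp_growth_gavg f K U x : continuous f -> (forall z, `|f z| <= K) ->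
  exp_growth (fun z => f (x + z *m U)).
Proof. by move=> fc fK; apply: (@exp_growth_bounded _ K) => //; exact: continuous_affine. Qed.

Lemma bounded_C1_gok f K U x : bounded_C1 K f -> exp_growth (fun z => f (x + z *m U)).
Proof.
by move=> fK; apply: (@exp_growth_gavg f K); [exact: bounded_C1_continuous fK|case: fK].
Qed.

Lemma bounded_C1_gok_rpd f K U x i : bounded_C1 K f -> exp_growth (fun z => rpd i f (x + z *m U)).
Proof. by case=> _ fc _ fK; apply: (@exp_growth_gavg _ K). Qed.

Lemma gavg_norm f K U x : continuous f -> (forall z, `|f z| <= K) -> `|gavg U f x| <= K.
Proof.
move=> fc fK; rewrite -[K]mulr1 -gmoment0; apply: le_norm_gint; first exact: exp_growth_gavg fK.
by move=> z; rewrite mul0r expR0 mulr1.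
Qed.

Lemma gavg_ge0 f U x : (forall z, 0 <= f z) -> 0 <= gavg U f x.
Proof. by move=> f0; apply: gint_ge0. Qed.

Lemma gavg0 f x : gavg 0 f x = f x.
Proof. by rewrite -[RHS](@gint_cst R n); apply: eq_gint => z; rewrite mulmx0 addr0. Qed.

Lemma norm_le_expR x : `|x| <= expR (1 * `|x|).
Proof. by rewrite mul1r (le_trans _ (expR_ge1Dx _))// lerDr. Qed.

(** The arguments [x + zU] and [y + zV] differ by at most [|x - y| + n |z| |U - V|], the inner [n]
    coming from the entrywise maximum norm of matrices. Both terms are at most their coefficient
    times [expR |z|], whence the moment of order 1. *)
Lemma gavg_lipschitz f K U V x y : bounded_C1 K f ->
  `|gavg U f x - gavg V f y| <= n%:R * K * (`|x - y| + n%:R * `|U - V|) * gmoment n 1.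
Proof.
move=> fK; have K0 := bounded_C1_ge0 fK.
rewrite -gintB; [|exact: bounded_C1_gok fK|exact: bounded_C1_gok fK].
apply: le_norm_gint.
  by apply: exp_growthB; exact: bounded_C1_gok fK.
move=> z; rewrite (le_trans (bounded_C1_lipschitz fK _ _))// -[leRHS]mulrA ler_wpM2l ?mulr_ge0//.
rewrite [X in `|X|](_ : _ = (x - y) + z *m (U - V)); last first.
  by rewrite mulmxBr opprD addrACA.
rewrite (le_trans (ler_normD _ _))// mulrDl lerD//.
  by rewrite ler_peMr// -[leLHS]expR0 ler_expR mul1r.
rewrite (le_trans (norm_mulmx _ _))// ler_wpM2l ?mulr_ge0//.
exact: norm_le_expR.
Qed.

(** A Peetre-type inequality moves the weight from [x] to the argument of [f]:
    [1 + |x| <= (1 + |x + zU|) (1 + M |z|)], and [(1 + M |z|)^m <= expR (m M |z|)] is a Gaussian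
    moment. The constant depends on [U] only through [M], which makes the bound uniform in time
    later. *)
Lemma gavg_weight f K M U x m : continuous f -> 0 <= M -> n%:R * `|U| <= M ->
  (forall z, (1 + `|z|) ^+ m * `|f z| <= K) ->
  (1 + `|x|) ^+ m * `|gavg U f x| <= K * gmoment n (m%:R * M).
Proof.
move=> fc M0 UM fK.
have wt0 (z : 'rV[R]_n) : 0 <= (1 + `|z|) ^+ m by rewrite exprn_ge0// addr_ge0.
have K0 : 0 <= K by apply: le_trans (fK 0); rewrite mulr_ge0.
have fK' z : `|f z| <= K.
  rewrite (le_trans _ (fK z))// ler_peMl// exprn_ege1// lerDl//.
rewrite -(ger0_norm (wt0 x)) -normrM -gintZ; last exact: exp_growth_gavg fK'.
apply: le_norm_gint.
  by apply: exp_growthM; [exact: exp_growth_cst|exact: exp_growth_gavg fK'].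
move=> z; rewrite normrM (ger0_norm (wt0 x)).
have h1 : 1 + `|x| <= (1 + `|x + z *m U|) * (1 + M * `|z|).
  have : `|x| <= `|x + z *m U| + `|z *m U|.
    by rewrite -[X in `|X| <= _](addrK (z *m U)) (le_trans (ler_normB _ _)).
  have : `|z *m U| <= M * `|z| by rewrite (le_trans (norm_mulmx _ _))// ler_wpM2r.
  have := normr_ge0 (x + z *m U); have : 0 <= M * `|z| by rewrite mulr_ge0.
  move: `|x| `|x + _| `|_ *m _| (M * _) => a b c d h1 h2 h3 h4.
  have : 0 <= b * d by rewrite mulr_ge0.
  by rewrite mulrDl mulrDr !mul1r; lra.
apply: (@le_trans _ _ (((1 + `|x + z *m U|) * (1 + M * `|z|)) ^+ m * `|f (x + z *m U)|)).
  by rewrite ler_wpM2r// lerXn2r// nnegrE ?mulr_ge0 ?addr_ge0// mulr_ge0.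
rewrite exprMn mulrAC ler_pM ?mulr_ge0 ?wt0 ?exprn_ge0 ?addr_ge0 ?mulr_ge0//.
rewrite -mulrA expRM_natl lerXn2r ?nnegrE ?expR_ge0 ?addr_ge0 ?mulr_ge0//.
exact: expR_ge1Dx.
Qed.

Lemma gavg_is_derive f K U x i : bounded_C1 K f ->
  is_derive x (e i) (gavg U f) (gavg U (rpd i f) x).
Proof.
move=> fK; have K0 := bounded_C1_ge0 fK; apply: is_derive_lineP.
apply: (@gint_derive _ _ (fun r z => f (x + r *: e i + z *m U)) _ 0 (n%:R * K) 0).
- by near=> r; exact: bounded_C1_gok fK.
- exact: bounded_C1_gok_rpd fK.
- near=> r => z; rewrite scale0r addr0 subr0 mul0r expR0 mulr1.
  rewrite (le_trans (bounded_C1_lipschitz fK _ _))//.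
  rewrite (_ : _ - _ = r *: e i); last by rewrite opprD addrACA subrr addr0 addrAC subrr add0r.
  by rewrite [leRHS]mulrC ler_wpM2l ?mulr_ge0// normrZ ler_piMr// norm_unit_vec.
- move=> z; have [fd _ _ _] := fK.
  have := is_derive_line (f := f) (x := x + z *m U) (v := e i) (r := 0) (fd i _).
  rewrite scale0r addr0 -rpdE.
  by under eq_fun do rewrite (addrAC x).
Unshelve. all: by end_near. Qed.

Lemma chain_affine f K U x z k : bounded_C1 K f ->
  is_derive z (e k) (fun z => f (x + z *m U)) (\sum_i U k i * rpd i f (x + z *m U)).
Proof.
move=> [fd fc _ _]; apply: is_derive_lineP.
have := @chain_rule _ _ f (fun r : R => x + (z + r *: e k) *m U) 0 (row k U) fd fc.
rewrite scale0r addr0 => H.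
have <- : \sum_i row k U 0 i * rpd i f (x + z *m U) = \sum_i U k i * rpd i f (x + z *m U).
  by apply: eq_bigr => i _; rewrite mxE.
apply: H => i.
have -> : (fun s : R => (x + (z + s *: e k) *m U) 0 i) = (fun s => (x + z *m U) 0 i + s * row k U 0 i).
  by apply/funext => s; rewrite mulmxDl -scalemxAl -rowE addrA !mxE.
exact: is_derive_affine.
Qed.

(** Brings the integrand of [gavg], as a function of [z], under the hypotheses of
    [gint_by_parts]. *)
Lemma bounded_C1_affine f K U x : bounded_C1 K f ->
  bounded_C1 (K + n%:R * `|U| * K) (fun z => f (x + z *m U)).
Proof.
move=> fK; have K0 := bounded_C1_ge0 fK.
have dE k z : rpd k (fun z => f (x + z *m U)) z = \sum_i U k i * rpd i f (x + z *m U).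
  by rewrite rpdE; have [_ ->] := chain_affine U x z k fK.
have [fd fc fb fdb] := fK.
split.
- by move=> k z; have [] := chain_affine U x z k fK.
- move=> k; rewrite (_ : rpd k _ = fun z => \sum_i U k i * rpd i f (x + z *m U)); last exact/funext.
  move=> z; apply: (@cvg_sumr _ _ (nbhs z)) => i.
  have : continuous (fun z => U k i * rpd i f (x + z *m U)).
    by apply: contM; [exact: cont_cst|exact: continuous_affine].
  exact.
- by move=> z; rewrite (le_trans (fb _))// lerDl !mulr_ge0.
- move=> k z; rewrite dE (le_trans (ler_norm_sum _ _ _))//.
  apply: (@le_trans _ _ (\sum_(i < n) `|U| * K)).
    by apply: ler_sum => i _; rewrite normrM ler_pM ?entry_le_norm.
  by rewrite sumr_const card_ord -[leLHS]mulr_natl mulrA lerDr.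
Qed.

End gaussian_operator.

(** * One-variable derivation rules for functions written pointwise *)

Section derivative_rules.
Context {R : realType}.
Implicit Types (f g : R -> R) (t a b c : R).

Lemma is_deriveR_cst c t : is_derive t (1 : R) (fun _ => c) 0.
Proof. exact: is_derive_cst. Qed.

Lemma is_deriveR_id t : is_derive t (1 : R) (fun s => s) 1.
Proof. exact: is_derive_id. Qed.

Lemma is_deriveRD f g t a b : is_derive t (1 : R) f a -> is_derive t (1 : R) g b ->
  is_derive t (1 : R) (fun s => f s + g s) (a + b).
Proof. exact: is_deriveD. Qed.

Lemma is_deriveRN f t a : is_derive t (1 : R) f a -> is_derive t (1 : R) (fun s => - f s) (- a).
Proof. exact: is_deriveN. Qed.

Lemma is_deriveRM f g t a b : is_derive t (1 : R) f a -> is_derive t (1 : R) g b ->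
  is_derive t (1 : R) (fun s => f s * g s) (a * g t + f t * b).
Proof.
move=> fa gb; have := is_deriveM fa gb.
by rewrite /GRing.scale/= addrC (mulrC (g t)).
Qed.

Lemma is_deriveRZ f t a c : is_derive t (1 : R) f a ->
  is_derive t (1 : R) (fun s => c * f s) (c * a).
Proof. by move=> fa; have := is_deriveRM (is_deriveR_cst c t) fa; rewrite mul0r add0r. Qed.

Lemma is_deriveR_sum (I : Type) (r : seq I) (f : I -> R -> R) t (a : I -> R) :
  (forall i, is_derive t (1 : R) (f i) (a i)) ->
  is_derive t (1 : R) (fun s => \sum_(i <- r) f i s) (\sum_(i <- r) a i).
Proof.
move=> fa; elim: r => [|i r IH].
  by under eq_fun do rewrite big_nil; rewrite big_nil; exact: is_deriveR_cst.
by under eq_fun do rewrite big_cons; rewrite big_cons; exact: is_deriveRD.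
Qed.

Lemma is_deriveR_comp f g t a b : is_derive (g t) (1 : R) f a -> is_derive t (1 : R) g b ->
  is_derive t (1 : R) (fun s => f (g s)) (a * b).
Proof. exact: is_derive1_comp. Qed.

Lemma is_deriveR_ext f g t a b : is_derive t (1 : R) f a -> f =1 g -> a = b ->
  is_derive t (1 : R) g b.
Proof. by move=> fa /funext <- <-. Qed.

End derivative_rules.

(** * Integration by parts against the Gaussian *)

Section integration_by_parts.
Context {R : realType} {n : nat}.
Implicit Types (f w : 'rV[R]_n -> R) (x y z : 'rV[R]_n) (U : 'M[R]_n).
Local Notation e := (@unit_vec R n).

Lemma Rintegral_affine U (b : 'rV[R]_n) f : upper_pos U -> continuous f ->
  \int[lebesgue_tuple n]_y f (row_of_tuple y) =
  \int[lebesgue_tuple n]_y ((\prod_i U i i) * f (b + row_of_tuple y *m U)).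
Proof.
(* The positive and negative parts of [f] are continuous and nonnegative, so the affine change of
   variables applies to each. *)
move=> Up fc; congr fine; rewrite integralE [RHS]integralE.
have p0 : 0 <= \prod_i U i i by apply: prodr_ge0 => i _; apply: ltW; exact: Up.2.
have mc (g h : 'rV[R]_n -> R) : continuous g -> continuous h -> continuous (fun z => Num.max (g z) (h z)).
  by move=> gc hc z; apply: continuous_max; [exact: gc|exact: hc].
have pos (g : n.-tuple (measurableTypeR R) -> R) :
    (\int[lebesgue_tuple n]_v (fun v => (g v)%:E)^\+ v = \int[lebesgue_tuple n]_v (Num.max (g v) 0)%:E)%E.
  exact: (congr1 (fun h => \int[lebesgue_tuple n]_v h v)%E (funerpos g)).
have neg (g : n.-tuple (measurableTypeR R) -> R) :
    (\int[lebesgue_tuple n]_v (fun v => (g v)%:E)^\- v = \int[lebesgue_tuple n]_v (Num.max (- g v) 0)%:E)%E.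
  exact: (congr1 (fun h => \int[lebesgue_tuple n]_v h v)%E (funerneg g)).
congr (_ - _)%E.
  rewrite !pos (@lebesgue_tuple_affine R n U b (fun z => Num.max (f z) 0))//.
  - by apply: eq_integral => v _; rewrite maxr_pMr// mulr0.
  - by apply: mc => //; exact: cont_cst.
  - by move=> x; rewrite le_max lexx orbT.
rewrite !neg (@lebesgue_tuple_affine R n U b (fun z => Num.max (- f z) 0))//.
- by apply: eq_integral => v _; rewrite maxr_pMr// mulr0 mulrN.
- by apply: mc; [exact: contN|exact: cont_cst].
- by move=> x; rewrite le_max lexx orbT.
Qed.

(** Only the factor of coordinate [k] changes, and [(z_k + r)^2 / 4] expands to
    [z_k^2 / 4 + r z_k / 2 + r^2 / 4]. The derivative of this exponent at [r = 0] is the source of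
    the factor 2 in the integration by parts. *)
Lemma gauss_shift z k (r : R) :
  gauss (r *: e k + z) = gauss z * expR (- (r * z 0 k / 2 + r ^+ 2 / 4)).
Proof.
have E : gauss1 ((r *: e k + z) 0 k) = gauss1 (z 0 k) * expR (- (r * z 0 k / 2 + r ^+ 2 / 4)).
  rewrite /gauss1 !mxE eqxx/= -mulrA -expRD; congr (_ * expR _).
  by rewrite eqxx mulr1; field.
rewrite /gauss (bigD1 k)//= [in RHS](bigD1 k)//= E [LHS]mulrAC; congr (_ * _ * _).
by apply: eq_bigr => i ik; rewrite !mxE (negbTE ik) mulr0 add0r.
Qed.

Lemma gint_shift w k (r : R) : continuous w ->
  gint w = gint (fun z => expR (- (r * z 0 k / 2 + r ^+ 2 / 4)) * w (r *: e k + z)).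
Proof.
move=> wc; rewrite /gint.
rewrite (@Rintegral_affine 1%:M (r *: e k) (fun z => gauss z * w z)); last 2 first.
- split=> [i j ij|i]; rewrite !mxE ?eqxx// -val_eqE/=.
  by rewrite gtn_eqF.
- by apply: contM => //; exact: continuous_gauss.
apply: eq_Rintegral => v _; rewrite big1 ?mul1r ?mulmx1 ?gauss_shift ?mulrA//.
by move=> i _; rewrite !mxE eqxx.
Qed.

(* After a translation by r e_k the integral depends on r through a factor and
   through w, but its value does not: the derivative at r = 0 vanishes. *)
Lemma gint_by_parts w (K : R) k : bounded_C1 K w ->
  gint (fun z => z 0 k * w z) = 2 * gint (rpd k w).
Proof.
move=> wK; have K0 := bounded_C1_ge0 wK; have wc := bounded_C1_continuous wK.
have [wd wdc wb wdb] := wK.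
pose s (r : R) z := - (r * z 0 k / 2 + r ^+ 2 / 4).
pose W r z := expR (s r z) * w (r *: e k + z).
have gokw : exp_growth w by exact: exp_growth_bounded wb.
have gokdw : exp_growth (rpd k w) by exact: exp_growth_bounded (wdb k).
have D : is_derive (0 : R) (1 : R) (fun r => gint (W r))
   (gint (fun z => rpd k w z - 2^-1 * (z 0 k * w z))).
  (* For [|r| <= 1] the exponent [S] satisfies [|S| <= |r| (1 + |z|)], so [|expR S - 1|] is at most
     [|r| expR |z| expR (1 + |z|)]. This gives [K * expR 1] and the rate 2; the increment of [w]
     contributes [n K]. *)
  apply: (@gint_derive _ _ W _ 0 (K * expR 1 + n%:R * K) 2).
  - near=> r; apply: exp_growthM.
      split.
        apply: cont_comp; last exact: continuous_expR.
        apply: contN; apply: contD; last exact: cont_cst.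
        apply: contM; last exact: cont_cst.
        by apply: contM; [exact: cont_cst|exact: coord_continuous].
      exists (1, `|r|) => z /=; rewrite mul1r ger0_norm ?expR_ge0// ler_expR /s.
      have h1 := coord_le_norm z k.
      have h2 : - (r * z 0 k) <= `|r| * `|z|.
        by rewrite (le_trans (ler_norm _))// normrN normrM ler_wpM2l.
      have h3 : 0 <= `|r| * `|z| by rewrite mulr_ge0.
      by have := sqr_ge0 r; lra.
    split; last by exists (K, 0) => z /=; rewrite mul0r expR0 mulr1.
    apply: continuous_comp_row => // i; under eq_fun do rewrite mxE.
    by apply: contD; [exact: cont_cst|exact: coord_continuous].
  - apply: exp_growthB => //; apply: exp_growthM; first exact: exp_growth_cst.
    by apply: exp_growthM => //; exact: exp_growth_coord.
  - have near1 : \forall r \near (0 : R), `|r| <= 1.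
      by apply/nbhs_ballP; exists 1 => //= r; rewrite /ball/= sub0r normrN => /ltW.
    apply: filterS near1 => r r1 z.
    rewrite subr0 /W /s expr0n/= !mul0r addr0 oppr0 expR0 mul1r scale0r add0r.
    set S := - _.
    have hS : `|S| <= `|r| * (1 + `|z|).
      rewrite /S normrN (le_trans (ler_normD _ _))// !normrM (@ger0_norm _ 2^-1)//
        (@ger0_norm _ 4^-1)//.
      have h1 := coord_le_norm z k.
      have h2 : `|r| * `|z 0 k| <= `|r| * `|z| by rewrite ler_wpM2l.
      have h3 : `|r| * `|r| <= `|r| * 1 by rewrite ler_wpM2l.
      have h4 : 0 <= `|r| * `|z| by rewrite mulr_ge0.
      by have h5 := normr_ge0 r; rewrite mulrDr; lra.
    have -> : expR S * w (r *: e k + z) - w z = (expR S - 1) * w (r *: e k + z) + (w (r *: e k + z) - w z) by ring.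
    rewrite (le_trans (ler_normD _ _))// (mulrDl (K * _)) (mulrDr `|r|) lerD//.
      rewrite normrM [leRHS](_ : _ = `|r| * expR `|z| * expR (1 + `|z|) * K); last first.
        by rewrite -[2 * _]/((1 + 1) * _) mulrDl !expRD mul1r; ring.
      rewrite ler_pM// (le_trans (norm_expR_sub1 _))// ler_pM ?expR_ge0//.
        by rewrite (le_trans hS)// ler_wpM2l// expR_ge1Dx.
      by rewrite ler_expR (le_trans hS)// ler_piMl// addr_ge0.
    rewrite (le_trans (bounded_C1_lipschitz wK _ _))// addrK normrZ.
    rewrite [leRHS]mulrCA ler_wpM2l ?mulr_ge0//.
    apply: (@le_trans _ _ (`|r| * 1)); first by rewrite ler_wpM2l// norm_unit_vec.
    by rewrite mulr1 ler_peMr// -[leLHS]expR0 ler_expR mulr_ge0.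
  - move=> z.
    have dl := is_derive_line (f := w) (x := z) (v := e k) (r := 0) (wd k _).
    have ds : is_derive (0 : R) (1 : R) (fun r => s r z) (- (z 0 k / 2)).
      apply: is_deriveRN.
      have := is_deriveRD (is_deriveRM (is_deriveR_id (0 : R)) (is_deriveR_cst (z 0 k / 2) 0)) (is_deriveRZ 4^-1 (is_deriveRM (is_deriveR_id (0 : R)) (is_deriveR_id 0))).
      by move/is_deriveR_ext; apply=> [r|]; lra.
    have := is_deriveRM (@is_deriveR_comp _ _ (fun r => s r z) 0 _ _ (is_derive_expR (s 0 z)) ds) dl.
    rewrite scale0r addr0 -rpdE => /is_deriveR_ext; apply=> [r|]; first by rewrite addrC.
    by rewrite /s expr0n/= !mul0r addr0 oppr0 expR0; lra.
have C : is_derive (0 : R) (1 : R) (fun r => gint (W r)) 0.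
  rewrite (_ : (fun r => _) = fun _ => gint w); first exact: is_deriveR_cst.
  by apply/funext => r; rewrite [RHS](gint_shift k r wc).
have : gint (fun z => rpd k w z - 2^-1 * (z 0 k * w z)) = 0.
  by have [_ <-] := D; have [_ ->] := C.
have gokz : exp_growth (fun z => z 0 k * w z) by apply: exp_growthM => //; exact: exp_growth_coord.
rewrite gintB//; last by apply: exp_growthM => //; exact: exp_growth_cst.
by rewrite gintZ//; lra.
Unshelve. all: by end_near. Qed.

Lemma gavg_by_parts f K U x k : bounded_C1 K f ->
  gint (fun z => z 0 k * f (x + z *m U)) = 2 * \sum_i U k i * gavg U (rpd i f) x.
Proof.
move=> fK; rewrite (gint_by_parts k (bounded_C1_affine U x fK)); congr (_ * _).
have okd i : exp_growth (fun z => rpd i f (x + z *m U)) := bounded_C1_gok_rpd U x i fK.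
transitivity (gint (fun z => \sum_i U k i * rpd i f (x + z *m U))).
  by apply: eq_gint => z; rewrite rpdE; have [_ ->] := chain_affine U x z k fK.
rewrite gint_sum; last by move=> i; apply: exp_growthM => //; exact: exp_growth_cst.
by apply: eq_bigr => i _; rewrite gintZ.
Qed.

(* d/dt f(x + z U) = z U' . grad f, and integrating by parts turns the factor z
   into a second derivative. *)
Lemma gavg_derive_path f K K' (U : R -> 'M[R]_n) (U' : 'M[R]_n) (t : R) x :
  bounded_C1 K f -> (forall i, bounded_C1 K' (rpd i f)) ->
  (forall i j, is_derive t (1 : R) (fun s => U s i j) (U' i j)) ->
  is_derive t (1 : R) (fun s => gavg (U s) f x)
    (\sum_i \sum_j 2 * ((U t)^T *m U') i j * gavg (U t) (rpd i (rpd j f)) x).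
Proof.
move=> fK dfK dU; have K0 := bounded_C1_ge0 fK.
have [fd fc _ _] := fK.
have okd j : exp_growth (fun z => rpd j f (x + z *m U t)) := bounded_C1_gok_rpd (U t) x j fK.
have okzd k j : exp_growth (fun z => z 0 k * rpd j f (x + z *m U t)).
  by apply: exp_growthM => //; exact: exp_growth_coord.
have D : is_derive t (1 : R) (fun s => gavg (U s) f x)
    (gint (fun z => \sum_j (\sum_k U' k j * (z 0 k * rpd j f (x + z *m U t))))).
  (* The constant collects the Lipschitz constant [n K] of [f], the factor [n] from bounding
     [z (U s - U t)], and the local slope [|U'| + 1] of [U] at [t]; the remaining [|z|] is bounded
     by [expR |z|]. *)
  apply: (@gint_derive _ _ (fun s z => f (x + z *m U s)) _ t (n%:R * K * n%:R * (`|U'| + 1)) 1).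
  - by near=> s; exact: bounded_C1_gok fK.
  - apply: exp_growth_sum => j; apply: exp_growth_sum => k; apply: exp_growthM => //;
    exact: exp_growth_cst.
  - near=> s => z; rewrite (le_trans (bounded_C1_lipschitz fK _ _))//.
    rewrite opprD addrACA subrr add0r -mulmxBr.
    rewrite [leRHS](_ : _ = n%:R * K * (n%:R * (`|s - t| * (`|U'| + 1)) * expR (1 * `|z|)));
      last by ring.
    rewrite ler_wpM2l ?mulr_ge0// (le_trans (norm_mulmx _ _))// ler_pM ?norm_le_expR//.
    rewrite ler_wpM2l//; near: s; exact: norm_mx_derive_lipschitz.
  - move=> z.
    have H := @chain_rule _ _ f (fun s : R => x + z *m U s) t (z *m U') fd fc.
    rewrite (_ : \sum_j _ = \sum_j (z *m U') 0 j * rpd j f (x + z *m U t)); last first.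
      apply: eq_bigr => j _; rewrite !mxE mulr_suml; apply: eq_bigr => k _.
      by rewrite mulrA (mulrC (z 0 k)).
    apply: H => i.
    have := is_deriveRD (is_deriveR_cst (x 0 i) t) (is_deriveR_sum (index_enum 'I_n) (fun k => is_deriveRZ (z 0 k) (dU k i))).
    by move/is_deriveR_ext; apply=> [s|]; rewrite ?add0r !mxE.
move/is_deriveR_ext: D; apply => //.
rewrite gint_sum; last by move=> j; apply: exp_growth_sum => k; apply: exp_growthM => //;
  exact: exp_growth_cst.
rewrite exchange_big/=; apply: eq_bigr => j _.
rewrite gint_sum; last by move=> k; apply: exp_growthM => //; exact: exp_growth_cst.
transitivity (\sum_k \sum_i 2 * (U t k i * U' k j) * gavg (U t) (rpd i (rpd j f)) x).
  apply: eq_bigr => k _; rewrite gintZ// (gavg_by_parts (U t) x k (dfK j)) mulrA mulr_sumr.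
  by apply: eq_bigr => i _; ring.
rewrite exchange_big/=; apply: eq_bigr => i _.
rewrite -mulr_suml -mulr_sumr; congr (_ * _ * _); rewrite mxE.
by apply: eq_bigr => k _; rewrite mxE.
Unshelve. all: by end_near. Qed.

End integration_by_parts.

(** * Cholesky factorisation and the convolution kernel *)

Section cholesky.
Context {R : realType}.

Section derivable_rules.
Implicit Types (f g : R -> R) (t : R).

Lemma derivableRM f g t : derivable f t (1 : R) -> derivable g t (1 : R) ->
  derivable (fun s => f s * g s) t (1 : R).
Proof. exact: derivableM. Qed.

Lemma derivableRB f g t : derivable f t (1 : R) -> derivable g t (1 : R) ->
  derivable (fun s => f s - g s) t (1 : R).
Proof. exact: derivableB. Qed.

Lemma derivableRV f t : f t != 0 -> derivable f t (1 : R) ->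
  derivable (fun s => (f s)^-1) t (1 : R).
Proof. by move=> f0 fd; exact: derivableV. Qed.

End derivable_rules.

Definition posdef n (B : 'M[R]_n) :=
  B^T = B /\ forall x : 'rV[R]_n, x != 0 -> 0 < (x *m B *m x^T) 0 0.

Definition schur n (B : 'M[R]_(1 + n)) : 'M[R]_n :=
  drsubmx B - (B 0 0)^-1 *: ((ursubmx B)^T *m ursubmx B).

(* The upper triangular factor of B = U^T U; unlike the square root, it is a
   rational function of the entries and of square roots of positive numbers,
   hence differentiable entry by entry. *)
Fixpoint uchol n : 'M[R]_n -> 'M[R]_n :=
  match n with
  | 0 => fun=> 0
  | n'.+1 => fun B : 'M[R]_(1 + n') =>
      block_mx (Num.sqrt (B 0 0))%:M ((Num.sqrt (B 0 0))^-1 *: ursubmx B) 0 (uchol (schur B))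
  end.

Section uchol_entries.
Context (n : nat) (B : 'M[R]_(1 + n)).
Local Notation U := (@uchol n.+1 B : 'M[R]_(1 + n)).

Lemma uchol_ul i j : U (lshift n i) (lshift n j) = Num.sqrt (B 0 0).
Proof. by apply: etrans (block_mxEul _ _ _ _ i j) _; rewrite (ord1 i) (ord1 j) mxE eqxx mulr1n. Qed.

Lemma uchol_ur i j : U (lshift n i) (rshift 1 j) = (Num.sqrt (B 0 0))^-1 * B (lshift n i) (rshift 1 j).
Proof. by apply: etrans (block_mxEur _ _ _ _ i j) _; rewrite !mxE. Qed.

Lemma uchol_dl i j : U (rshift 1 i) (lshift n j) = 0.
Proof. by apply: etrans (block_mxEdl _ _ _ _ i j) _; rewrite mxE. Qed.

Lemma uchol_dr i j : U (rshift 1 i) (rshift 1 j) = uchol (schur B) i j.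
Proof. exact: (block_mxEdr _ _ _ _ i j). Qed.

End uchol_entries.

Lemma posdef_block n (B : 'M[R]_(1 + n)) : B^T = B ->
  B = block_mx (B 0 0)%:M (ursubmx B) (ursubmx B)^T (drsubmx B).
Proof.
move=> Bs; rewrite -[LHS]submxK; congr block_mx.
  by rewrite [LHS]mx11_scalar !mxE; congr (B _ _)%:M; exact/val_inj.
by apply/matrixP => i j; rewrite !mxE -{1}Bs mxE.
Qed.

Lemma posdef_diag n (B : 'M[R]_n) i : posdef B -> 0 < B i i.
Proof.
move=> [_ /(_ (delta_mx 0 i : 'rV[R]_n))]; rewrite -rowE.
have -> : (row i B *m (delta_mx 0 i : 'rV[R]_n)^T) 0 0 = B i i.
  by rewrite trmx_delta -colE !mxE.
apply; apply/eqP => /rowP/(_ i); rewrite !mxE !eqxx/= => /eqP.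
by rewrite oner_eq0.
Qed.

Lemma schur_posdef n (B : 'M[R]_(1 + n)) : posdef B -> posdef (schur B).
Proof.
move=> Bp; have [Bs B0] := Bp; have EB := posdef_block Bs.
have b0 : 0 < B 0 0 by exact: posdef_diag.
split.
  rewrite /schur raddfB/= linearZ/= trmx_mul trmxK; congr (_ - _).
  by rewrite -[in RHS]Bs; apply/matrixP => i j; rewrite !mxE.
move=> y y0; rewrite /schur; move: EB b0; set b := B 0 0; set c := ursubmx B; set D := drsubmx B =>
  EB b0.
(* Completion of the square: this [t] kills the first coordinate of [(t, y) B], so the form of [B]
   at [(t, y)] is the form of the Schur complement at [y]. *)
pose t := - (b^-1 * (y *m c^T) 0 0).
have /B0 : row_mx t%:M y != 0.
  apply: contraNneq y0 => /(congr1 (@rsubmx _ 1 1 n)); rewrite row_mxKr => ->.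
  by rewrite raddf0.
rewrite EB mul_row_block tr_row_mx mul_row_col.
have -> : t%:M *m b%:M + y *m c^T = 0.
  rewrite -scalar_mxM [y *m c^T]mx11_scalar -raddfD/= /t mulNr mulrAC mulVf ?lt0r_neq0//.
  by rewrite mul1r addNr raddf0.
rewrite mul0mx add0r mul_scalar_mx => H.
rewrite (_ : y *m _ = t *: c + y *m D)//.
rewrite mulmxBr -scalemxAr mulmxA [X in X *m c]mx11_scalar mul_scalar_mx scalerA.
by rewrite /t scaleNr addrC.
Qed.

Lemma uchol_upper n (B : 'M[R]_n) : posdef B -> upper_pos (uchol B).
Proof.
elim: n B => [|n IH] B Bp; first by split=> -[].
have [U0 Ud] := IH _ (schur_posdef Bp).
split=> [i j|i].
  case: (split_ordP (i : 'I_(1 + n))) => i' ->; case: (split_ordP (j : 'I_(1 + n))) => j' ->.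
  - by rewrite (ord1 i') (ord1 j').
  - by rewrite (ord1 i') /= ltn0.
  - by rewrite uchol_dl.
  - by rewrite uchol_dr => ij; apply: U0.
case: (split_ordP (i : 'I_(1 + n))) => i' ->.
  by rewrite uchol_ul sqrtr_gt0 posdef_diag.
by rewrite uchol_dr.
Qed.

Lemma uchol_mul n (B : 'M[R]_n) : posdef B -> (uchol B)^T *m uchol B = B.
Proof.
elim: n B => [|n IH] B Bp; first by apply/matrixP => -[].
have b0 : 0 < B 0 0 by exact: posdef_diag.
have [Bs _] := Bp.
pose V : 'M[R]_(1 + n) :=
  block_mx (Num.sqrt (B 0 0))%:M ((Num.sqrt (B 0 0))^-1 *: ursubmx (B : 'M[R]_(1 + n))) 0 (uchol (schur B)).
suff H : V^T *m V = B :> 'M[R]_(1 + n) by exact: H.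
rewrite [in RHS](posdef_block Bs) /V.
have s0 : Num.sqrt (B 0 0) != 0 by rewrite gt_eqF// sqrtr_gt0.
rewrite tr_block_mx mulmx_block.
rewrite !trmx0 !mul0mx !mulmx0 !addr0 (IH _ (schur_posdef Bp)).
rewrite tr_scalar_mx -scalar_mxM -expr2 sqr_sqrtr ?ltW//.
congr block_mx.
- by rewrite mul_scalar_mx scalerA divff// scale1r.
- by rewrite linearZ/= mul_mx_scalar scalerA divff// scale1r.
- rewrite -scalemxAr [X in X *m _]linearZ/= -scalemxAl scalerA -invfM -expr2 sqr_sqrtr ?ltW//.
  by rewrite /schur addrC subrK.
Qed.

(** Positivity is asked at [t] only: the recursion makes sense for every matrix, and its square
    roots and inverses are differentiable as soon as the pivots at [t] are positive. *)
Lemma uchol_derivable n (B : R -> 'M[R]_n) (t : R) : posdef (B t) ->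
  (forall i j, derivable (fun s => B s i j) t 1) ->
  forall i j, derivable (fun s => uchol (B s) i j) t 1.
Proof.
elim: n B => [|n IH] B Bp Bd; first by case.
have b0 : 0 < B t 0 0 by exact: posdef_diag.
have dsq : derivable (fun s => Num.sqrt (B s 0 0)) t 1.
  have [] // := is_derive1_comp (is_derive1_sqrt b0) (derivableP (Bd 0 0)).
have dS i j : derivable (fun s => schur (B s : 'M[R]_(1 + n)) i j) t 1.
  rewrite (_ : (fun s => _) = (fun s => B s (rshift 1 i) (rshift 1 j) -
     (B s 0 0)^-1 * (B s (lshift n (0 : 'I_1)) (rshift 1 i) * B s (lshift n (0 : 'I_1)) (rshift 1 j)))); last first.
    by apply/funext => s; rewrite !mxE big_ord1 !mxE.
  apply: derivableRB; first exact: Bd.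
  apply: derivableRM; last by apply: derivableRM; exact: Bd.
  by apply: derivableRV; [rewrite lt0r_neq0|exact: Bd].
move=> i j.
case: (split_ordP (i : 'I_(1 + n))) => i' ->; case: (split_ordP (j : 'I_(1 + n))) => j' ->.
- rewrite (_ : (fun s => _) = (fun s => Num.sqrt (B s 0 0))) //; apply/funext => s.
  by rewrite uchol_ul.
- rewrite (_ : (fun s => _) = (fun s => (Num.sqrt (B s 0 0))^-1 * B s (lshift n i') (rshift 1 j'))); last first.
    by apply/funext => s; rewrite uchol_ur.
  apply: derivableRM; last exact: Bd.
  by apply: derivableRV => //; rewrite gt_eqF// sqrtr_gt0.
- rewrite (_ : (fun s => _) = (fun s => 0)); first exact: derivable_cst.
  by apply/funext => s; rewrite uchol_dl.
- rewrite (_ : (fun s => _) = (fun s => uchol (schur (B s : 'M[R]_(1 + n))) i' j')); last first.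
    by apply/funext => s; rewrite uchol_dr.
  by apply: (IH (fun s => schur (B s : 'M[R]_(1 + n)))) => //; exact: schur_posdef.
Qed.

(** Since [B = U^T U], the diagonal entry [B j j] is the sum of the squares of column [j] of [U]. *)
Lemma norm_uchol n (B : 'M[R]_n) (M : R) : posdef B -> (forall i, B i i <= M) ->
  `|uchol B| <= Num.sqrt M.
Proof.
move=> Bp BM; apply: mx_norm_le => [|i j]; first exact: sqrtr_ge0.
rewrite -sqrtr_sqr ler_wsqrtr// (le_trans _ (BM j))//.
rewrite -[in leRHS](uchol_mul Bp) mxE (bigD1 i)//= mxE -expr2 lerDl.
by apply: sumr_ge0 => k _; rewrite mxE -expr2 sqr_ge0.
Qed.

End cholesky.

(** * The heat kernel as an image of the standard Gaussian *)

Section kernel.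
Context {R : realType} {n : nat}.
Implicit Types (x v : 'rV[R]_n) (B : 'M[R]_n) (phi : 'rV[R]_n -> R).

(* [Wkernel a s t] with B for A(t) - A(s). *)
Definition gkernel B v :=
  (Num.sqrt ((4 * pi) ^+ n * \det B))^-1 * expR (- (4^-1 * (v *m invmx B *m v^T) 0 0)).

Lemma continuous_gkernel B : continuous (gkernel B).
Proof.
apply: contM; first exact: cont_cst.
apply: cont_comp; last exact: continuous_expR.
apply: contN; apply: contM; first exact: cont_cst.
under eq_fun do rewrite mxE.
move=> v; apply: (@cvg_sumr _ _ (nbhs v)) => i.
have : continuous (fun v => (v *m invmx B) 0 i * v^T i 0).
  apply: contM; first exact: continuous_mulmx_coord.
  by under eq_fun do rewrite mxE; exact: coord_continuous.
exact.
Qed.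

(** The substitution [y = x + z U] evaluates the kernel at [x - y = - z U]. Its Jacobian is the
    product of the diagonal of [U], which equals [det U], the square root of [det B], and cancels
    the normalisation. *)
Lemma gkernel_uchol B v : posdef B ->
  (\prod_i uchol B i i) * gkernel B (- (v *m uchol B)) = gauss v.
Proof.
move=> Bp; have EB := uchol_mul Bp; have [U0 Ud] := uchol_upper Bp.
set U := uchol B in EB U0 Ud *; set P := \prod_i U i i.
have P0 : 0 < P by apply: prodr_gt0 => i _; exact: Ud.
have detU : \det U = P.
  rewrite -det_tr det_trig; first by apply: eq_bigr => i _; rewrite mxE.
  by apply/is_trig_mxP => i j ij; rewrite mxE U0.
have Uu : U \in unitmx by rewrite unitmxE detU unitfE gt_eqF.
have UTu : U^T \in unitmx by rewrite unitmx_tr.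
rewrite gaussE /gkernel -EB det_mulmx det_tr detU.
rewrite sqrtrM ?exprn_ge0 ?mulr_ge0 ?pi_ge0// -expr2 sqrtr_sqr gtr0_norm//.
rewrite invfM mulrA mulrCA mulfV ?gt_eqF// mulr1; congr (_ * expR (- (_ * _ 0 0))).
(* This identity reduces the quadratic form of the inverse of [B] at [z U] to [z z^T]. *)
have E : U *m (invmx (U^T *m U) *m U^T) = 1%:M.
  by apply: mulmx1C; rewrite -mulmxA mulVmx// unitmx_mul UTu.
rewrite raddfN/= !mulNmx mulmxN opprK trmx_mul.
by rewrite -!mulmxA (mulmxA (invmx _)) (mulmxA U) E mul1mx.
Qed.

Lemma gkernel_convolution B phi x : posdef B -> continuous phi ->
  \int[lebesgue_tuple n]_y (gkernel B (x - row_of_tuple y) * phi (row_of_tuple y)) =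
  gavg (uchol B) phi x.
Proof.
move=> Bp phic; have Up := uchol_upper Bp.
rewrite (@Rintegral_affine R n (uchol B) x (fun v => gkernel B (x - v) * phi v))//; last first.
  apply: contM => //; apply: continuous_comp_row; last exact: continuous_gkernel.
  move=> i; under eq_fun do rewrite !mxE.
  by apply: contB; [exact: cont_cst|exact: coord_continuous].
apply: eq_Rintegral => y _.
by rewrite opprD addrA subrr add0r mulrA gkernel_uchol.
Qed.

End kernel.

Lemma mx_subE (V : zmodType) m n (B C : 'M[V]_(m, n)) i j : (B - C) i j = B i j - C i j.
Proof. by rewrite !mxE. Qed.

Lemma near_above (R : realType) (c t : R) : c < t -> \forall r \near t, c < r.
Proof.
move=> ct; apply/nbhs_ballP; exists (t - c); rewrite /= ?subr_gt0// => r.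
by rewrite /ball/= ltr_norml => /andP[_]; rewrite ltrD2l ltrN2.
Qed.

Lemma near_below (R : realType) (c t : R) : t < c -> \forall r \near t, r < c.
Proof.
move=> ct; apply/nbhs_ballP; exists (c - t); rewrite /= ?subr_gt0// => r.
by rewrite /ball/= distrC ltr_norml => /andP[_]; rewrite ltrD2r.
Qed.

(** * The matrix A(t) - A(s) *)

Section primitive.
Context {R : realType} {n : nat} (a : R -> 'M[R]_n) (ha : coefficient_matrix a).
Local Notation A := (primitive_mx a).
Local Notation mu := (@lebesgue_measure R).
Implicit Types (s t : R) (i j : 'I_n).

Lemma coef_within i j : {within `[0, +oo[, continuous (fun s : R => a s i j)}.
Proof.
move=> x; have H := @coef_continuous _ _ _ ha x.
exact: (cvg_comp _ _ H (@coord_continuous _ _ _ i j (a x))).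
Qed.

Lemma coef_within_itv (s t : R) i j : 0 <= s -> {within `[s, t], continuous (fun s : R => a s i j)}.
Proof.
move=> s0; apply: (continuous_subspaceW _ (@coef_within i j)) => x /=.
by rewrite !in_itv/= andbT => /andP[+ _]; exact: le_trans.
Qed.

Lemma coef_continuous_at t i j : 0 < t -> {for t, continuous (fun s : R => a s i j)}.
Proof.
move=> t0; apply: differentiable_continuous; apply/derivable1_diffP.
exact: (@coef_smooth _ _ _ ha i j 0%N t t0).
Qed.

Lemma coef_integrable t i j : mu.-integrable `[0, t] (EFin \o (fun s => a s i j)).
Proof.
apply: continuous_compact_integrable; first exact: segment_compact.
exact: coef_within_itv.
Qed.

Lemma coef_bounded (T : R) : exists2 M, 0 <= M & forall t i j, 0 <= t <= T -> `|a t i j| <= M.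
Proof.
have [T0|T0] := leP 0 T; last first.
  by exists 0 => // t i j /andP[t0 tT]; have := le_lt_trans (le_trans t0 tT) T0; rewrite ltxx.
have /choice[M HM] : forall ij : 'I_n * 'I_n, exists M, forall t, 0 <= t <= T -> `|a t ij.1 ij.2| <= M.
  move=> [i j] /=.
  have [|c _ cmax] := @EVT_max R (fun t => `|a t i j|) 0 T T0.
    exact: (@cont_comp R (subspace `[0, T]) (fun s => a s i j) (fun x => `|x|)
      (@coef_within_itv 0 T i j (lexx 0)) (@norm_continuous _ _)).
  by exists `|a c i j| => t tT; apply: cmax; rewrite in_itv.
exists (\sum_ij `|M ij|); first exact: sumr_ge0.
move=> t i j tT; rewrite (le_trans (HM (i, j) t tT))// (bigD1 (i, j))//=.
by rewrite (le_trans (ler_norm _))// lerDl sumr_ge0.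
Qed.

Lemma primitive_derive t i j : 0 < t -> is_derive t (1 : R) (fun s => A s i j) (a t i j).
Proof.
move=> t0; under eq_fun do rewrite mxE.
have tt1 : t < t + 1 by rewrite ltrDl.
have [d1 d2] := continuous_FTC1_closed tt1 (coef_integrable (t + 1) i j) t0 (@coef_continuous_at t i j t0).
exact: (DeriveDef d1 (etrans (esym (derive1E _ _)) d2)).
Qed.

Lemma primitive_within (s t : R) i j : 0 <= s -> s <= t ->
  {within `[s, t], continuous (fun s => A s i j)}.
Proof.
move=> s0 st; have -> : (fun r => A r i j) = (fun r => \int[mu]_(x in `[0, r]) a x i j)%R.
  by apply/funext => r; rewrite mxE.
have t0 : 0 <= t := le_trans s0 st.
have := parameterized_integral_continuous t0 (coef_integrable t i j).
apply: continuous_subspaceW => x /=.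
by rewrite !in_itv/= => /andP[sx ->]; rewrite (le_trans s0 sx).
Qed.

(** The mean value theorem asks for the derivative in the open interval only, so [s = 0], where [a]
    is merely continuous, is covered. *)
Lemma primitive_lipschitz (M T : R) : (forall t i j, 0 <= t <= T -> `|a t i j| <= M) ->
  forall s t i j, 0 <= s -> s <= t -> t <= T -> `|A t i j - A s i j| <= M * (t - s).
Proof.
move=> aM s t i j s0 st tT.
have [] := @MVT_segment R (fun r => A r i j) (fun r => a r i j) s t st.
- move=> x; rewrite in_itv/= => /andP[sx _]; apply: primitive_derive.
  exact: le_lt_trans sx.
- exact: primitive_within.
move=> c; rewrite in_itv/= => /andP[sc ct] ->.
rewrite normrM (@ger0_norm _ (t - s)) ?subr_ge0// ler_wpM2r ?subr_ge0//.
by rewrite aM// (le_trans s0 sc) (le_trans ct).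
Qed.

Lemma primitive_sym t : 0 <= t -> (A t)^T = A t.
Proof.
move=> t0; apply/matrixP => i j; rewrite !mxE; apply: eq_Rintegral => s.
rewrite inE/= in_itv/= => /andP[s0 _].
by have /matrixP/(_ i j) := coef_sym ha s0; rewrite mxE.
Qed.

(** By the mean value theorem applied to the form of [A r] at a fixed [x], the difference is [t - s]
    times the form of [a c] at [x] for some [c] strictly between [s] and [t]. *)
Lemma primitive_posdef s t : 0 <= s -> s < t -> posdef (A t - A s).
Proof.
move=> s0 st; split.
  by rewrite raddfB/= !primitive_sym// (le_trans s0)// ltW.
move=> x x0.
have qE (B : 'M[R]_n) : (x *m B *m x^T) 0 0 = \sum_i \sum_j x 0 i * x 0 j * B i j.
  rewrite mxE exchange_big/=; apply: eq_bigr => j _; rewrite !mxE mulr_suml.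
  by apply: eq_bigr => i _; rewrite mulrAC.
have -> : (x *m (A t - A s) *m x^T) 0 0 =
    \sum_i \sum_j x 0 i * x 0 j * A t i j - \sum_i \sum_j x 0 i * x 0 j * A s i j.
  rewrite qE -sumrB; apply: eq_bigr => i _; rewrite -sumrB; apply: eq_bigr => j _.
  by rewrite -mulrBr !mxE.
have [] := @MVT R (fun r => \sum_i \sum_j x 0 i * x 0 j * A r i j)
  (fun r => \sum_i \sum_j x 0 i * x 0 j * a r i j) s t st.
- move=> r; rewrite in_itv/= => /andP[sr _].
  apply: is_deriveR_sum => i; apply: is_deriveR_sum => j; apply: is_deriveRZ;
    apply: primitive_derive.
  exact: le_lt_trans sr.
- move=> r; apply: (@cvg_sumr _ _ (nbhs r)) => i; apply: (@cvg_sumr _ _ (nbhs r)) => j.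
  apply: cvgM; first exact: cvg_cst.
  exact: (@primitive_within s t i j s0 (ltW st) r).
move=> c; rewrite in_itv/= => /andP[sc _]; rewrite -!qE => ->.
rewrite mulr_gt0 ?subr_gt0//; apply: (coef_posdef ha) => //.
by rewrite (le_trans s0)// ltW.
Qed.

(* The value 0 for t <= s makes [gavg (cholU s t)] the identity there, in
   agreement with W_{t,t}. *)
Definition cholU (s t : R) : 'M[R]_n := if s < t then uchol (A t - A s) else 0.

Lemma cholU_mul s t : 0 <= s -> s <= t -> (cholU s t)^T *m cholU s t = A t - A s.
Proof.
move=> s0; rewrite /cholU le_eqVlt => /predU1P[->|st].
  by rewrite ltxx mulmx0 subrr.
by rewrite st uchol_mul//; exact: primitive_posdef.
Qed.

(** This square-root decay is what makes the average tend to the identity as [t] decreases to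
    [s]. *)
Lemma norm_cholU (M T : R) : 0 <= M -> (forall t i j, 0 <= t <= T -> `|a t i j| <= M) ->
  forall s t, 0 <= s -> s <= t -> t <= T -> `|cholU s t| <= Num.sqrt (M * (t - s)).
Proof.
move=> M0 aM s t s0 + tT; rewrite /cholU; case: ifPn => [st _|_ _]; last first.
  by rewrite normr0 sqrtr_ge0.
apply: norm_uchol; first exact: primitive_posdef.
move=> i; rewrite mx_subE (le_trans (ler_norm _))//.
exact: (primitive_lipschitz aM i i s0 (ltW st) tT).
Qed.

Lemma cholU_derivable s t i j : 0 <= s -> s < t -> derivable (fun r => cholU s r i j) t (1 : R).
Proof.
move=> s0 st.
have H : derivable (fun r => uchol (A r - A s) i j) t (1 : R).
  apply: (uchol_derivable (B := fun r => A r - A s)); first exact: primitive_posdef.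
  move=> k l; under eq_fun do rewrite mx_subE.
  apply: derivableRB; last exact: derivable_cst.
  by have [] := primitive_derive k l (le_lt_trans s0 st).
apply: near_eq_derivable H.
near=> r; rewrite /cholU ifT//; near: r; exact: near_above.
Unshelve. all: by end_near. Qed.

(** Continuity in the starting time is read off from differentiability of the factor, which is why
    [s] must be positive and distinct from [t]; [cholU_near] treats the diagonal. *)
Lemma cholU_continuous s t i j : 0 < s -> s < t -> {for s, continuous (fun r => cholU r t i j)}.
Proof.
move=> s0 st.
have H : derivable (fun r => uchol (A t - A r) i j) s (1 : R).
  apply: (uchol_derivable (B := fun r => A t - A r)); first by apply: primitive_posdef => //;
    exact: ltW.
  move=> k l; under eq_fun do rewrite mx_subE.
  apply: derivableRB; first exact: derivable_cst.
  by have [] := primitive_derive k l s0.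
apply: differentiable_continuous; apply/derivable1_diffP.
apply: near_eq_derivable H.
near=> r; rewrite /cholU ifT//; near: r; exact: near_below.
Unshelve. all: by end_near. Qed.

(** The derivative [U'] of the factor is never computed. The Hessian is symmetric, so only the
    symmetric part of [U^T U'] counts, and twice that part is the derivative of [U^T U = A t - A s],
    namely [a t]. *)
Lemma gavg_cholU_derive (f : 'rV[R]_n -> R) (K K' s t : R) x :
  bounded_C1 K f -> (forall i, bounded_C1 K' (rpd i f)) ->
  (forall i j, rpd i (rpd j f) = rpd j (rpd i f)) -> 0 <= s -> s < t ->
  is_derive t (1 : R) (fun r => gavg (cholU s r) f x)
    (\sum_i \sum_j a t i j * gavg (cholU s t) (rpd i (rpd j f)) x).
Proof.
move=> fK dfK sym s0 st.
pose U' : 'M[R]_n := \matrix_(i, j) 'D_1 (fun r => cholU s r i j) t.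
have dU i j : is_derive t (1 : R) (fun r => cholU s r i j) (U' i j).
  by rewrite mxE; apply: derivableP; exact: cholU_derivable.
have EA i j : ((cholU s t)^T *m U') i j + ((cholU s t)^T *m U') j i = a t i j.
  have D1 : is_derive t (1 : R) (fun r => ((cholU s r)^T *m cholU s r) i j)
      (((cholU s t)^T *m U') i j + ((cholU s t)^T *m U') j i).
    have := is_deriveR_sum (index_enum 'I_n) (fun k => is_deriveRM (dU k i) (dU k j)).
    move/is_deriveR_ext; apply=> [r|]; first by rewrite mxE; apply: eq_bigr => k _; rewrite mxE.
    rewrite big_split/= addrC !mxE; congr (_ + _); apply: eq_bigr => k _; rewrite !mxE//.
    by rewrite mulrC.
  have D2 : is_derive t (1 : R) (fun r => ((cholU s r)^T *m cholU s r) i j) (a t i j).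
    have H : is_derive t (1 : R) (fun r => A r i j - A s i j) (a t i j).
      have := is_deriveRD (primitive_derive i j (le_lt_trans s0 st)) (is_deriveR_cst (- A s i j) t).
      by rewrite addr0.
    apply: near_eq_is_derive H.
    near=> r; rewrite cholU_mul//; first by rewrite mx_subE.
    by apply: ltW; near: r; exact: near_above.
  by have [_ <-] := D1; have [_ <-] := D2.
have := gavg_derive_path x fK dfK dU.
move/is_deriveR_ext; apply => //.
(* The factor 2 is split into two copies of the sum; exchanging [i] and [j] in the second one
   produces the transpose needed by [EA]. *)
transitivity (\sum_i \sum_j (((cholU s t)^T *m U') i j * gavg (cholU s t) (rpd i (rpd j f)) x) +
   \sum_i \sum_j (((cholU s t)^T *m U') i j * gavg (cholU s t) (rpd i (rpd j f)) x)).
  rewrite -big_split/=; apply: eq_bigr => i _; rewrite -big_split/=.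
  by apply: eq_bigr => j _; ring.
rewrite [X in _ + X]exchange_big/= -big_split/=; apply: eq_bigr => i _.
rewrite -big_split/=; apply: eq_bigr => j _.
by rewrite (sym j i) -mulrDl EA.
Unshelve. all: by end_near. Qed.

End primitive.

(** * Real Schwartz functions and the mild solution *)

Section schwartz_real.
Context {R : realType} {n : nat}.
Implicit Types (t r eps T K : R) (f g : 'rV[R]_n -> R) (x : 'rV[R]_n) (F : R -> 'rV[R]_n -> R).
Local Notation e := (@unit_vec R n).

(** A radial weight replaces the monomials of the seminorms because it behaves well under the
    translations [x + zU]. The comparison with the seminorms is made in [weighted_le_seminorm] and
    [seminorm_weighted_le]. *)
Definition weighted_le (m : nat) (K : R) f := forall x, (1 + `|x|) ^+ m * `|f x| <= K.

Record rschwartz f : Prop := {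
  rschwartz_cont : forall s, continuous (rpds s f) ;
  rschwartz_der : forall s i x, derivable (rpds s f) x (e i) ;
  rschwartz_bound : forall m s, exists K, weighted_le m K (rpds s f) }.

(** The real counterpart of [schwartz_continuous], with derivatives taken before the difference;
    [rpdsB] shows that the order does not matter. *)
Definition schwartz_path F := (forall t : R, 0 <= t -> rschwartz (F t)) /\
  forall m s (t eps : R), 0 <= t -> 0 < eps ->
    \forall r \near t, 0 <= r -> weighted_le m eps (fun x => rpds s (F r) x - rpds s (F t) x).

Lemma weight_ge1 m x : 1 <= (1 + `|x|) ^+ m.
Proof. by rewrite exprn_ege1// lerDl. Qed.

Lemma weight_ge0 m x : 0 <= (1 + `|x|) ^+ m.
Proof. by rewrite exprn_ge0// addr_ge0. Qed.

Lemma weight_gt0 m x : 0 < (1 + `|x|) ^+ m.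
Proof. by rewrite (lt_le_trans _ (weight_ge1 m x)). Qed.

Lemma weighted_le_norm m K f x : weighted_le m K f -> `|f x| <= K.
Proof. by move=> /(_ x); apply: le_trans; rewrite ler_peMl// weight_ge1. Qed.

Lemma weighted_le_le m K K' f : K <= K' -> weighted_le m K f -> weighted_le m K' f.
Proof. by move=> KK fK x; exact: le_trans (fK x) KK. Qed.

Lemma weighted_leD m K K' f g : weighted_le m K f -> weighted_le m K' g ->
  weighted_le m (K + K') (fun x => f x + g x).
Proof.
move=> fK gK x; apply: le_trans (lerD (fK x) (gK x)).
by rewrite -mulrDr ler_wpM2l ?weight_ge0// ler_normD.
Qed.

Lemma weighted_leZ m K f (c : R) : weighted_le m K f -> weighted_le m (`|c| * K) (fun x => c * f x).
Proof. by move=> fK x; rewrite normrM mulrCA ler_wpM2l. Qed.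

Lemma rpds_rcons s i f : rpds s (rpd i f) = rpds (rcons s i) f.
Proof. by rewrite /rpds foldr_rcons. Qed.

Lemma rschwartz_rpd i f : rschwartz f -> rschwartz (rpd i f).
Proof.
move=> [fc fd fb]; split.
- by move=> s; rewrite rpds_rcons.
- by move=> s j x; rewrite rpds_rcons.
- by move=> m s; rewrite rpds_rcons.
Qed.

Lemma rschwartz_sym f i j : rschwartz f -> rpd i (rpd j f) = rpd j (rpd i f).
Proof.
move=> [fc fd fb]; apply/funext => x; apply: rpd_comm.
- exact: (fd [::]).
- exact: (fd [::]).
- exact: (fd [:: i]).
- exact: (fd [:: j]).
- exact: (fc [:: i; j]).
- exact: (fc [:: j; i]).
Qed.

Lemma rschwartz_continuous f : rschwartz f -> continuous f.
Proof. by move=> /rschwartz_cont/(_ [::]). Qed.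

Lemma schwartz_path_rpd i F : schwartz_path F -> schwartz_path (fun t => rpd i (F t)).
Proof.
move=> [FS Fc]; split=> [t t0|m s t eps t0 eps0]; first by apply: rschwartz_rpd; exact: FS.
by apply: filterS (Fc m (rcons s i) t eps t0 eps0) => r H r0; rewrite !rpds_rcons; exact: H.
Qed.

(** Compactness of [[0, T]]: if [K] bounds the norm at [t], continuity gives [K + 1] near [t], and
    finitely many such neighbourhoods suffice. *)
Lemma schwartz_path_bound F (T : R) m s : schwartz_path F -> exists K, forall t, 0 <= t <= T ->
  weighted_le m K (rpds s (F t)).
Proof.
move=> [FS Fc].
have := @segment_compact R 0 T; rewrite compact_near_coveringP.
move=> /(_ R +oo%R (fun K t => 0 <= t -> weighted_le m K (rpds s (F t))) _) [].
  move=> t; rewrite /= in_itv/= => /andP[t0 tT].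
  have [K HK] := rschwartz_bound (FS t t0) m s.
  exists ([set r | 0 <= r -> weighted_le m 1 (fun x => rpds s (F r) x - rpds s (F t) x)], [set M | K + 1 <= M]).
    by split => /=; [exact: Fc|exact: nbhs_pinfty_ge (num_real _)].
  move=> [r M]/= [hr hM] r0; have := weighted_leD (hr r0) HK.
  rewrite (_ : (fun _ => _) = rpds s (F r)); last by apply/funext => x; rewrite subrK.
  by apply: weighted_le_le; rewrite addrC.
move=> M [_ HM]; exists (M + 1) => t /andP[t0 tT]; apply: HM => //; first by rewrite ltrDl.
by rewrite /= in_itv/= t0.
Qed.

Lemma schwartz_path_nice F (T : R) : schwartz_path F -> exists K, forall t, 0 <= t <= T ->
  bounded_C1 K (F t).
Proof.
move=> FC; have [FS _] := FC.
have [K0 HK0] := schwartz_path_bound T 0 [::] FC.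
have /choice[K HK] : forall i, exists K, forall t, 0 <= t <= T -> weighted_le 0 K (rpds [:: i] (F t)).
  by move=> i; exact: schwartz_path_bound.
exists (`|K0| + \sum_i `|K i|) => t tT; have [fc fd _] := FS t (andP tT).1.
split.
- exact: (fd [::]).
- by move=> i; exact: (fc [:: i]).
- move=> x; rewrite (le_trans (weighted_le_norm x (HK0 t tT)))// (le_trans (ler_norm _))// lerDl.
  exact: sumr_ge0.
- move=> i x; rewrite (le_trans (weighted_le_norm x (HK i t tT)))// (bigD1 i)//= addrCA.
  by rewrite (le_trans (ler_norm _))// lerDl addr_ge0// sumr_ge0.
Qed.

Lemma schwartz_path_cst f : rschwartz f -> schwartz_path (fun _ => f).
Proof.
move=> fS; split=> // m s t eps t0 eps0; near=> r => _ x.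
by rewrite subrr normr0 mulr0 ltW.
Unshelve. all: by end_near. Qed.

Lemma rschwartz_nice f : rschwartz f -> exists K, bounded_C1 K f.
Proof. by move=> /schwartz_path_cst /(schwartz_path_nice 0)[K /(_ 0)]; rewrite lexx => /(_ isT);
  exists K. Qed.

Lemma MVT_lipschitz (g dg : R -> R) (c d C : R) : c <= d ->
  (forall r, c < r < d -> is_derive r (1 : R) g (dg r)) ->
  {within `[c, d], continuous g} -> (forall r, c < r < d -> `|dg r| <= C) ->
  `|g d - g c| <= C * (d - c).
Proof.
rewrite le_eqVlt => /predU1P[->|cd gd gc gC]; first by rewrite !subrr normr0 mulr0.
have gd' r : r \in `]c, d[ -> is_derive r (1 : R) g (dg r) by rewrite in_itv; exact: gd.
have [r + ->] := MVT cd gd' gc; rewrite in_itv/= => rcd.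
by rewrite normrM (ger0_norm (x := d - c)) ?subr_ge0 ?(ltW cd)// ler_wpM2r ?subr_ge0 ?(ltW cd)// gC.
Qed.

End schwartz_real.

(** * Dependence of the Duhamel integrand on the source time *)

Section propagated_source.
Context {R : realType} {n : nat} (a : R -> 'M[R]_n) (ha : coefficient_matrix a).
Local Notation mu := (@lebesgue_measure R).
Implicit Types (s t r T : R) (i j : 'I_n) (x : 'rV[R]_n) (F : R -> 'rV[R]_n -> R)
  (f : 'rV[R]_n -> R).

Definition duhamel_integrand F x s t := gavg (cholU a s t) (F s) x.

Lemma cholU_ge s t : t <= s -> cholU a s t = 0.
Proof. by rewrite leNgt /cholU => /negbTE ->. Qed.

Lemma duhamel_integrand_ge F x s t : t <= s -> duhamel_integrand F x s t = F s x.
Proof. by move=> ts; rewrite /duhamel_integrand cholU_ge// gavg0. Qed.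

Lemma cholU_small T (eps : R) : 0 < eps -> exists2 d, 0 < d &
  forall s t, 0 <= s -> t <= T -> t - s <= d -> `|cholU a s t| <= eps.
Proof.
move=> eps0; have [M M0 aM] := coef_bounded ha T.
(* Chosen so that [sqrt (M (t - s)) <= eps]; [M + 1] avoids dividing by zero. *)
exists (eps ^+ 2 / (M + 1)); first by rewrite divr_gt0 ?exprn_gt0// ltr_wpDl.
move=> s t s0 tT; have [ts _|st] := leP t s; first by rewrite cholU_ge// normr0 ltW.
rewrite ler_pdivlMr ?ltr_wpDl// => std.
rewrite (le_trans (norm_cholU ha M0 aM s0 (ltW st) tT))//.
rewrite -[leRHS]gtr0_norm// -sqrtr_sqr ler_wsqrtr// (le_trans _ std)// mulrC.
by rewrite ler_wpM2l ?subr_ge0 ?(ltW st)// lerDl.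
Qed.

(** Three regimes: below [t] the factor is continuous, above [t] it vanishes identically, and at
    [s = t] both sides are small by [cholU_small]. *)
Lemma cholU_near s t (eps : R) : 0 < s -> 0 < eps ->
  \forall r \near s, `|cholU a r t - cholU a s t| <= eps.
Proof.
move=> s0 eps0; have [st|ts|st] := ltgtP s t.
- near=> r; apply: mx_norm_le => [|i j]; first exact: ltW.
  rewrite mx_subE distrC; move: i j; near: r; apply: filter_forall => i; apply: filter_forall => j.
  have /cvgrPdist_le := @cholU_continuous _ _ _ ha s t i j s0 st; exact.
- near=> r; rewrite !cholU_ge ?subrr ?normr0 ?ltW//; near: r; exact: near_above.
- have [d d0 H] := cholU_small t eps0; rewrite -st in H *.
  rewrite [cholU a s s]cholU_ge//; near=> r; rewrite subr0; apply: H => //.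
    by apply: ltW; near: r; exact: near_above.
  by rewrite lerBlDl -lerBlDr; apply: ltW; near: r; apply: near_above; rewrite ltrBlDr ltrDl.
Unshelve. all: by end_near. Qed.

Lemma gavgB U f1 f2 K1 K2 x : continuous f1 -> continuous f2 ->
  (forall z, `|f1 z| <= K1) -> (forall z, `|f2 z| <= K2) ->
  gavg U f1 x - gavg U f2 x = gavg U (fun z : 'rV[R]_n => f1 z - f2 z) x.
Proof.
by move=> c1 c2 b1 b2; rewrite /gavg gintB//; [exact: exp_growth_gavg b1|exact: exp_growth_gavg b2].
Qed.

(** The change of the source is bounded in sup norm, which averaging does not increase; the change
    of the matrix is handled by the Lipschitz bound of the fixed function [F s]. *)
Lemma duhamel_integrand_continuous F x s t : schwartz_path F -> 0 < s ->
  {for s, continuous (fun r => duhamel_integrand F x r t)}.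
Proof.
move=> FC s0; have [FS Fc] := FC; have [K HK] := schwartz_path_nice (s + 1) FC.
have s00 := ltW s0.
have sK : bounded_C1 K (F s) by apply: HK; apply/andP; split => //; rewrite lerDl ler01.
pose C := n%:R * K * n%:R * gmoment n 1 + 1.
have C0 : 0 < C by rewrite ltr_wpDl// !mulr_ge0 ?gmoment_ge0 ?(bounded_C1_ge0 sK).
apply/cvgrPdist_le => eps eps0.
have H : \forall r \near s, weighted_le 0%N (eps / 2) (fun z => F r z - F s z).
  apply: filterS2 (near_above s0) (Fc 0%N [::] s (eps / 2) s00 (divr_gt0 eps0 (ltr0n _ 2))) => r r0.
  by apply; exact: ltW.
near=> r.
have Hr : weighted_le 0%N (eps / 2) (fun z => F r z - F s z) by near: r; exact: H.
have r0 : 0 < r by near: r; exact: near_above.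
have r1 : r < s + 1 by near: r; apply: near_below; rewrite ltrDl.
have rK : bounded_C1 K (F r) by apply: HK; rewrite !ltW.
have h1 : `|gavg (cholU a r t) (F s) x - gavg (cholU a r t) (F r) x| <= eps / 2.
  have [_ _ sb _] := sK; have [_ _ rb _] := rK.
  rewrite (@gavgB _ _ _ K K)//; [|exact: bounded_C1_continuous sK|exact: bounded_C1_continuous rK].
  apply: gavg_norm; first by apply: contB;
    [exact: bounded_C1_continuous sK|exact: bounded_C1_continuous rK].
  by move=> z; rewrite distrC; exact: (weighted_le_norm z Hr).
have h2 : `|gavg (cholU a s t) (F s) x - gavg (cholU a r t) (F s) x| <= eps / 2.
  rewrite (le_trans (gavg_lipschitz _ _ _ _ sK))// subrr normr0 add0r.
  apply: (@le_trans _ _ (C * `|cholU a r t - cholU a s t|)).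
    have d0 := normr_ge0 (cholU a r t - cholU a s t); rewrite distrC /C.
    move: `|cholU a r t - cholU a s t| d0 (gmoment n 1) => d d0 c.
    by rewrite (mulrDl _ 1) mul1r (_ : _ * c = n%:R * K * n%:R * c * d) ?lerDl//; ring.
  rewrite mulrC -ler_pdivlMr//; near: r; apply: cholU_near => //.
  by rewrite !divr_gt0.
rewrite [eps]splitr (le_trans (ler_distD (gavg (cholU a r t) (F s) x) _ _))//.
by rewrite lerD.
Unshelve. all: by end_near. Qed.

Lemma duhamel_integrand_bound F T K m : schwartz_path F ->
  (forall s, 0 <= s <= T -> weighted_le m K (F s)) ->
  exists2 C, 0 <= C & forall s t x, 0 <= s <= T -> t <= T -> (1 + `|x|) ^+ m * `|duhamel_integrand F x s t| <= C.
Proof.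
move=> FC FK; have [M M0 aM] := coef_bounded ha T.
(* [L] bounds [n |cholU a s t|] for all times up to [T], so one Gaussian moment serves every [s] and
   [t]. *)
pose L := n%:R * Num.sqrt (M * T).
have L0 : 0 <= L by rewrite mulr_ge0// sqrtr_ge0.
have [T0|T0] := ltP T 0.
  by exists 0 => // s' t' x' /andP[s0 sT]; have := le_lt_trans (le_trans s0 sT) T0; rewrite ltxx.
have K0 : 0 <= K.
  by have := FK 0; rewrite lexx T0 => /(_ isT 0); apply: le_trans; rewrite mulr_ge0 ?weight_ge0.
exists (K * gmoment n (m%:R * L)); first by rewrite mulr_ge0 ?gmoment_ge0.
move=> s' t' x' /andP[s0 sT] tT; apply: gavg_weight => //.
- by apply: rschwartz_continuous; apply: FC.1.
- rewrite ler_wpM2l//; have [ts|st] := leP t' s'; first by rewrite cholU_ge// normr0 sqrtr_ge0.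
  rewrite (le_trans (norm_cholU ha M0 aM s0 (ltW st) tT))// ler_wsqrtr// ler_wpM2l//.
  by rewrite lerBlDr (le_trans tT)// lerDl.
- by apply: FK; rewrite s0.
Qed.

End propagated_source.

(** * Time derivative of the Duhamel integral *)

Section duhamel_integral.
Context {R : realType} {n : nat} (a : R -> 'M[R]_n) (ha : coefficient_matrix a).
Local Notation mu := (@lebesgue_measure R).
Implicit Types (s t r T : R) (i j : 'I_n) (x : 'rV[R]_n) (F : R -> 'rV[R]_n -> R)
  (f : 'rV[R]_n -> R).
Local Notation e := (@unit_vec R n).
Local Notation duhamel_integrand := (duhamel_integrand a).

(** Measurability is asked on the open interval because continuity of the integrand in [s] is
    established for [s > 0] only; the endpoints are negligible. *)
Lemma itv_bounded_integrable (g : R -> R) (c d C : R) :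
  measurable_fun `]c, d[ g -> (forall s, c <= s <= d -> `|g s| <= C) ->
  mu.-integrable `[c, d] (EFin \o g).
Proof.
move=> mg gC; apply: measurable_bounded_integrable => //.
- by rewrite /= lebesgue_measure_itv/=; case: ifP => // _; rewrite -EFinB ltry.
- by apply/measurable_fun_itv_bndo_bndcP; apply/measurable_fun_itv_obnd_cbndP.
- exists C; split; first exact: num_real.
  by move=> M CM s /=; rewrite in_itv/= => scd; rewrite (le_trans (gC s scd))// ltW.
Qed.

(** [T] and [t] are independent, the integrand being [F s x] beyond [t]: this allows an integration
    range that stays fixed while [t] varies. *)
Lemma duhamel_integrand_integrable F x t T : schwartz_path F ->
  mu.-integrable `[0, T] (EFin \o (fun s => duhamel_integrand F x s t)).
Proof.
move=> FC; have [K HK] := schwartz_path_bound (Num.max T t) 0 [::] FC.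
have [C C0 HC] := duhamel_integrand_bound ha FC HK.
apply: (@itv_bounded_integrable _ _ _ C).
  apply: open_continuous_measurable_fun => // s; rewrite inE/= in_itv/= => /andP[s0 _].
  exact: (@duhamel_integrand_continuous _ _ _ ha F x s t FC s0).
move=> s /andP[s0 sT]; have := HC s t x; rewrite expr0 mul1r; apply.
  by rewrite s0 le_max sT.
by rewrite le_max lexx orbT.
Qed.

Lemma rschwartz_bounded_C1_rpd f : rschwartz f ->
  exists2 K, bounded_C1 K f & forall i, bounded_C1 K (rpd i f).
Proof.
move=> fS; have [K0 HK0] := rschwartz_nice fS.
have /choice[K HK] : forall i, exists K, bounded_C1 K (rpd i f) by move=> i; apply: rschwartz_nice;
  exact: rschwartz_rpd.
have niceW (g : 'rV[R]_n -> R) (K1 K2 : R) : K1 <= K2 -> bounded_C1 K1 g -> bounded_C1 K2 g.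
  by move=> KK [g1 g2 g3 g4]; split => //= *; exact: le_trans KK.
have pos i : 0 <= K i by exact: bounded_C1_ge0 (HK i).
exists (K0 + \sum_i K i); first by apply: niceW HK0; rewrite lerDl sumr_ge0.
move=> i; apply: niceW (HK i); rewrite (bigD1 i)//= addrCA lerDl addr_ge0 ?(bounded_C1_ge0 HK0)//.
exact: sumr_ge0.
Qed.

Lemma gavg_cholU_is_derive f s t x : rschwartz f -> 0 <= s -> s < t ->
  is_derive t (1 : R) (fun r => gavg (cholU a s r) f x)
    (\sum_i \sum_j a t i j * gavg (cholU a s t) (rpd i (rpd j f)) x).
Proof.
move=> fS s0 st; have [K fK dfK] := rschwartz_bounded_C1_rpd fS.
by apply: (gavg_cholU_derive ha x fK dfK) => // i j; exact: rschwartz_sym.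
Qed.

Lemma gavg_cholU_right f s x : rschwartz f -> 0 <= s ->
  gavg (cholU a s r) f x @[r --> s^'+] --> f x.
Proof.
move=> fS s0; have [K fK] := rschwartz_nice fS; have K0 := bounded_C1_ge0 fK.
pose C := n%:R * K * n%:R * gmoment n 1 + 1.
have C0 : 0 < C by rewrite ltr_wpDl// !mulr_ge0 ?gmoment_ge0.
apply/cvgrPdist_le => eps eps0.
have [d d0 H] := cholU_small ha (s + 1) (divr_gt0 eps0 C0).
near=> r.
have sr : s < r by near: r; exact: nbhs_right_gt.
have : `|cholU a s r| <= eps / C.
  apply: H => //; first by apply: ltW; near: r; apply: nbhs_right_lt; rewrite ltrDl.
  by rewrite lerBlDl; apply: ltW; near: r; apply: nbhs_right_lt; rewrite ltrDl.
rewrite ler_pdivlMr// => HU.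
rewrite -[f x](gavg0 f x) (le_trans (gavg_lipschitz _ _ _ _ fK))// subrr normr0 add0r sub0r normrN.
apply: le_trans HU.
have d1 := normr_ge0 (cholU a s r); rewrite /C.
move: `|cholU a s r| d1 (gmoment n 1) => u u0 c.
by rewrite mulrDr mulr1 (_ : _ * c = u * (n%:R * K * n%:R * c)) ?lerDl//; ring.
Unshelve. all: by end_near. Qed.

Lemma is_derive_continuous (g : R -> R) (t l : R) : is_derive t (1 : R) g l ->
  {for t, continuous g}.
Proof. by move=> [gd _]; apply: differentiable_continuous; apply/derivable1_diffP. Qed.

Lemma within_itv_right (g : R -> R) (c d : R) : c < d ->
  g r @[r --> c^'+] --> g c -> (forall r, c < r -> {for r, continuous g}) ->
  {within `[c, d], continuous g}.
Proof.
move=> cd gc g1; apply/continuous_within_itvP => //; split => //.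
- by move=> r; rewrite in_itv/= => /andP[cr _]; exact: g1.
- by apply: cvg_at_left_filter; exact: g1.
Qed.

(** Uniform in [s], although the factor has unbounded slope near [t = s]: the derivative of the
    average involves only [a] and second derivatives of [f]. *)
Lemma gavg_cholU_lipschitz f (K M T : R) s t1 t2 x : rschwartz f ->
  (forall i j z, `|rpd i (rpd j f) z| <= K) ->
  (forall t i j, 0 <= t <= T -> `|a t i j| <= M) ->
  0 <= s -> 0 <= t1 -> t1 <= t2 -> t2 <= T ->
  `|gavg (cholU a s t2) f x - gavg (cholU a s t1) f x| <= (\sum_(i < n) \sum_(j < n) M * K) * (t2 - t1).
Proof.
move=> fS fK aM s0 t10 t12 t2T.
have KM : 0 <= \sum_(i < n) \sum_(j < n) M * K.
  apply: sumr_ge0 => i _; apply: sumr_ge0 => j _; rewrite mulr_ge0//.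
    by apply: le_trans (aM t1 i j _); rewrite ?t10 ?(le_trans t12).
  exact: le_trans (fK i j 0).
have [ts|st2] := leP t2 s.
  rewrite (cholU_ge a ts) (cholU_ge a (le_trans t12 ts)) subrr normr0.
  by rewrite mulr_ge0// subr_ge0.
(* The average does not move for times up to [s], so [t1] may be raised to [s] before the mean value
   theorem is applied. *)
pose t1' := Num.max s t1.
have st1' : s <= t1' by rewrite le_max lexx.
have t1't2 : t1' <= t2 by rewrite ge_max (ltW st2).
have -> : gavg (cholU a s t1) f x = gavg (cholU a s t1') f x.
  by rewrite /t1'; have [//|ts] := leP s t1; rewrite (cholU_ge a (ltW ts)) (cholU_ge a (lexx s)).
apply: (@le_trans _ _ ((\sum_(i < n) \sum_(j < n) M * K) * (t2 - t1'))); last first.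
  by rewrite ler_wpM2l// lerD2l lerN2 le_max lexx orbT.
apply: (@MVT_lipschitz _ (fun r => gavg (cholU a s r) f x)
  (fun r => \sum_i \sum_j a r i j * gavg (cholU a s r) (rpd i (rpd j f)) x)) => //.
- by move=> r /andP[r1 _]; apply: gavg_cholU_is_derive => //; exact: le_lt_trans r1.
- apply: (@continuous_subspaceW _ _ _ `[s, t2]).
    by move=> r /=; rewrite !in_itv/= => /andP[r1 ->]; rewrite (le_trans st1').
  apply: within_itv_right => //.
    by rewrite [cholU a s s]cholU_ge// gavg0; exact: gavg_cholU_right.
  by move=> r sr; exact: is_derive_continuous (gavg_cholU_is_derive x fS s0 sr).
- move=> r /andP[r1 r2]; rewrite (le_trans (ler_norm_sum _ _ _))//.
  apply: ler_sum => i _; rewrite (le_trans (ler_norm_sum _ _ _))//.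
  apply: ler_sum => j _; rewrite normrM ler_pM//.
    by apply: aM; rewrite (le_trans s0) ?(le_trans st1')//= ltW// (lt_le_trans r2).
  by apply: gavg_norm => //; exact: (@rschwartz_cont _ _ _ fS [:: i; j]).
Qed.

Lemma Rintegral_sum d (X : measurableType d) (nu : {measure set X -> \bar R}) (D : set X)
    (I : Type) (l : seq I) (g : I -> X -> R) : measurable D ->
  (forall k, nu.-integrable D (EFin \o g k)) ->
  nu.-integrable D (EFin \o (fun y => \sum_(k <- l) g k y)) /\
  \int[nu]_(y in D) (\sum_(k <- l) g k y) = \sum_(k <- l) \int[nu]_(y in D) g k y.
Proof.
move=> mD ig; elim: l => [|k l [IH1 IH2]].
  have E : (fun y : X => \sum_(k <- [::]) g k y) = cst 0 by apply/funext => y; rewrite big_nil.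
  rewrite E big_nil Rintegral_cst// mul0r; split => //.
  exact: (@integrable0 _ _ _ nu D).
have E : (fun y => \sum_(k <- k :: l) g k y) = (fun y => g k y + \sum_(k <- l) g k y).
  by apply/funext => y; rewrite big_cons.
rewrite E big_cons -IH2 RintegralD//; split => //.
exact: (integrableD mD (ig k) IH1).
Qed.

Definition duhamel F t x := \int[mu]_(s in `[0, t]) duhamel_integrand F x s t.

(* The upper bound of the integral is frozen at T > t by integrating F(s) over
   (t, T], where the integrand of the Duhamel integral is constant in t. *)
Lemma duhamel_derive F x t : schwartz_path F -> 0 < t ->
  is_derive t (1 : R) (fun r => duhamel F r x)
   (\sum_i \sum_j a t i j * duhamel (fun s => rpd i (rpd j (F s))) t x + F t x).
Proof.
move=> FC t0; pose T := t + 1.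
have tT : t < T by rewrite ltrDl.
have FC2 i j : schwartz_path (fun s => rpd i (rpd j (F s))) by do 2!apply: schwartz_path_rpd.
have intF T' : mu.-integrable `[0, T'] (EFin \o (fun s => F s x)).
  have := duhamel_integrand_integrable x 0 T' FC.
  apply: eq_integrable => // s; rewrite inE/= in_itv/= => /andP[s0 _].
  by rewrite duhamel_integrand_ge.
pose G r := \int[mu]_(s in `[0, T]) duhamel_integrand F x s r.
pose Phi r := \int[mu]_(s in `[0, r]) F s x.
have dPhi : is_derive t (1 : R) Phi (F t x).
  have cF : {for t, continuous (fun s => F s x)}.
    have H : duhamel_integrand F x s 0 @[s --> t] --> F t x.
      rewrite -(duhamel_integrand_ge a F x (ltW t0));
        exact: (@duhamel_integrand_continuous _ _ _ ha F x t 0 FC t0).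
    have H' : F s x @[s --> t] --> F t x.
      apply: cvg_trans H; apply: near_eq_cvg; near=> s.
      by rewrite duhamel_integrand_ge//; apply: ltW; near: s; exact: near_above.
    exact: H'.
  have [d1 d2] := continuous_FTC1_closed tT (intF T) t0 cF.
  exact: (DeriveDef d1 (etrans (esym (derive1E _ _)) d2)).
(* Beyond [r] the integrand equals [F s x], so the part of [G r] over []r, T]] is [Phi T - Phi r].
   The variable bound survives only in [Phi], where the fundamental theorem of calculus applies. *)
have decomp r : 0 < r -> r < T -> duhamel F r x = G r + Phi r - Phi T.
  move=> r0 rT.
  have E1 := @Rintegral_itvB _ (fun s => duhamel_integrand F x s r) (BLeft 0) (BRight T) r (duhamel_integrand_integrable x r T FC).
  have E2 := @Rintegral_itvB _ (fun s => F s x) (BLeft 0) (BRight T) r (intF T).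
  have r0' : (BLeft 0 <= BRight r)%O by rewrite bnd_simp ltW.
  have rT' : (BRight r <= BRight T)%O by rewrite bnd_simp ltW.
  have E3 : \int[mu]_(s in `]r, T]) duhamel_integrand F x s r = \int[mu]_(s in `]r, T]) F s x.
    apply: eq_Rintegral => s; rewrite inE/= in_itv/= => /andP[rs _].
    by rewrite duhamel_integrand_ge// ltW.
  move: (E1 r0' rT') (E2 r0' rT'); rewrite E3 => <-.
  rewrite /G /Phi /duhamel => H.
  by move: H; move: (\int[mu]_(s in `[0, T]) duhamel_integrand F x s r) (\int[mu]_(s in `[0, r]) duhamel_integrand F x s r)
    (\int[mu]_(s in `[0, T]) F s x) (\int[mu]_(s in `[0, r]) F s x) => b1 b2 b3 b4; lra.
pose dg s := \sum_i \sum_j a t i j * duhamel_integrand (fun s => rpd i (rpd j (F s))) x s t.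
have [M M0 aM] := coef_bounded ha T.
have /choice[K HK] : forall ij : 'I_n * 'I_n, exists K, forall s, 0 <= s <= T ->
    weighted_le 0 K (rpd ij.1 (rpd ij.2 (F s))).
  by move=> [i j]; exact: (schwartz_path_bound T 0 [::] (FC2 i j)).
pose K' := \sum_ij `|K ij|.
have HK' s i j z : 0 <= s <= T -> `|rpd i (rpd j (F s)) z| <= K'.
  move=> sT; rewrite (le_trans (weighted_le_norm z (HK (i, j) s sT)))// /K' (bigD1 (i, j))//=.
  by rewrite (le_trans (ler_norm _))// lerDl sumr_ge0.
have intdg : mu.-integrable `[0, t] (EFin \o dg).
  apply: (Rintegral_sum _ _ _).1 => // i; apply: (Rintegral_sum _ _ _).1 => // j.
  by apply: RintegrableZ => //; exact: duhamel_integrand_integrable.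
(* For [s < t] the derivative in time is [dg s]; for [s > t] the integrand is locally constant in
   time, hence the restriction of [dg] to []-oo, t[]. *)
have dG : is_derive t (1 : R) G (\int[mu]_(s in `[0, T]) (dg \_ `]-oo, t[) s).
  apply: (proj2 (is_derive_integral (g := fun=> \sum_(i < n) \sum_(j < n) M * K') _ _ _ _ _ _)) =>
    //.
  - by near=> r; exact: duhamel_integrand_integrable.
  - apply/measurable_restrict => //.
    have -> : `[0, T] `&` `]-oo, t[ = `[0, t[%classic :> set R.
      apply/seteqP; split=> s /=; rewrite !in_itv/=; first by move=> [/andP[-> _] ->].
      by move=> /andP[-> st]; rewrite st (ltW (lt_trans st tT)).
    have /integrableP[/measurable_EFinP H _] := intdg.
    by apply: measurable_funS H => // s /=; rewrite !in_itv/= => /andP[-> /ltW].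
  - apply: (@itv_bounded_integrable _ _ _ `|\sum_(i < n) \sum_(j < n) M * K'|) => //.
  - have near1 : \forall r \near t, 0 < r < T.
      by apply: filterS2 (near_above t0) (near_below tT) => r -> ->.
    apply: filterS near1 => r /andP[r0 rT] s; rewrite /= in_itv/= => /andP[s0 sT].
    have sS : rschwartz (F s) by apply: FC.1.
    have sK i j z : `|rpd i (rpd j (F s)) z| <= K' by apply: HK'; rewrite s0.
    have [tr|rt] := leP t r.
      rewrite mulrC (ger0_norm (x := r - t)) ?subr_ge0//.
      by apply: (gavg_cholU_lipschitz x sS sK aM) => //; exact: ltW.
    rewrite distrC (distrC r) mulrC (ger0_norm (x := t - r)) ?subr_ge0 ?(ltW rt)//.
    by apply: (gavg_cholU_lipschitz x sS sK aM) => //; exact: ltW.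
  (* At [s = t] the integrand may have a corner in time; this single point is discarded as a null
     set. *)
  - exists [set t]; split => //; first exact: lebesgue_measure_set1.
    move=> s /= /not_implyP[]; rewrite in_itv/= => /andP[s0 sT] H; apply: contrapT => /eqP st.
    apply: H; rewrite /patch; case: ifPn; rewrite ?inE ?notin_setE/= in_itv/=.
      by move=> st'; exact: gavg_cholU_is_derive (FC.1 s s0) s0 st'.
    move=> /negP; rewrite -leNgt => ts; have {}ts : t < s by rewrite lt_neqAle eq_sym st.
    apply: near_eq_is_derive (is_deriveR_cst (F s x) t).
    by near=> r; rewrite duhamel_integrand_ge//; apply: ltW; near: r; exact: near_below.
have E0 : \int[mu]_(s in `[0, T]) (dg \_ `]-oo, t[) s =
   \sum_i \sum_j a t i j * duhamel (fun s => rpd i (rpd j (F s))) t x.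
  rewrite -Rintegral_mkcondr.
  have -> : `[0, T] `&` `]-oo, t[ = `[0, t[%classic :> set R.
    apply/seteqP; split=> s /=; rewrite !in_itv/=; first by move=> [/andP[-> _] ->].
    by move=> /andP[-> st]; rewrite st (ltW (lt_trans st tT)).
  rewrite Rintegral_itv_bndo_bndc; last first.
    by apply: integrableS intdg => // s /=; rewrite !in_itv/= => /andP[-> /ltW].
  rewrite (Rintegral_sum _ _ _).2//; last first.
    move=> i; apply: (Rintegral_sum _ _ _).1 => // j.
    by apply: RintegrableZ => //; exact: duhamel_integrand_integrable.
  apply: eq_bigr => i _; rewrite (Rintegral_sum _ _ _).2//; last first.
    by move=> j; apply: RintegrableZ => //; exact: duhamel_integrand_integrable.
  apply: eq_bigr => j _; rewrite RintegralZl//; exact: duhamel_integrand_integrable.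
have D : is_derive t (1 : R) (fun r => G r + Phi r - Phi T)
  (\int[mu]_(s in `[0, T]) (dg \_ `]-oo, t[) s + F t x).
  have := is_deriveRD (is_deriveRD dG dPhi) (is_deriveR_cst (- Phi T) t).
  by rewrite addr0.
rewrite -E0; apply: near_eq_is_derive D.
by near=> r; rewrite decomp//; near: r; [exact: near_above|exact: near_below].
Unshelve. all: by end_near. Qed.

End duhamel_integral.

(** * The mild solution: bounds, spatial derivatives, continuity in time *)

Section mild_solution.
Context {R : realType} {n : nat} (a : R -> 'M[R]_n) (ha : coefficient_matrix a).
Local Notation mu := (@lebesgue_measure R).
Implicit Types (s t r T : R) (i j : 'I_n) (x : 'rV[R]_n) (F : R -> 'rV[R]_n -> R)
  (f : 'rV[R]_n -> R).
Local Notation e := (@unit_vec R n).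
Local Notation duhamel_integrand := (duhamel_integrand a).
Local Notation duhamel := (duhamel a).

Definition mild f F t x := gavg (cholU a 0 t) f x + duhamel F t x.

Lemma schwartz_path_rpds (l : seq 'I_n) F : schwartz_path F ->
  schwartz_path (fun t => rpds l (F t)).
Proof. by move=> FC; elim: l => //= i l IH; exact: schwartz_path_rpd. Qed.

Lemma rschwartz_rpds (l : seq 'I_n) f : rschwartz f -> rschwartz (rpds l f).
Proof. by move=> fS; elim: l => //= i l IH; exact: rschwartz_rpd. Qed.

Lemma rpds_rpd (l : seq 'I_n) i f : rschwartz f -> rpds l (rpd i f) = rpd i (rpds l f).
Proof. by move=> fS; elim: l => //= j l ->; apply: rschwartz_sym; exact: rschwartz_rpds. Qed.

Lemma Rintegral_norm_le (g : R -> R) t (C : R) : 0 <= t ->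
  mu.-integrable `[0, t] (EFin \o g) -> (forall s, 0 <= s <= t -> `|g s| <= C) ->
  `|\int[mu]_(s in `[0, t]) g s| <= C * t.
Proof.
move=> t0 ig gC; rewrite (le_trans (le_normr_Rintegral _ ig))//.
apply: (@le_trans _ _ (\int[mu]_(s in `[0, t]) C)).
  apply: le_Rintegral => //.
  - by have /integrable_norm := ig.
  - exact: (@itv_bounded_integrable _ _ _ _ `|C|).
rewrite [leLHS](_ : _ = \int[mu]_(s in `[0, t]) cst C s)// Rintegral_cst//.
rewrite [X in fine X](_ : _ = t%:E)//; apply: etrans (lebesgue_measure_itv _) _.
rewrite /= lte_fin; case: ltP => t0'; first by rewrite -EFinB subr0.
by rewrite (@le_anti _ _ t 0) ?t0 ?t0'.
Qed.

(** The factor [t], the length of the integration interval, is kept because it yields the initial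
    condition. *)
Lemma duhamel_weight m T K F : schwartz_path F ->
  (forall s, 0 <= s <= T -> weighted_le m K (F s)) ->
  exists2 C, 0 <= C & forall t, 0 <= t <= T -> weighted_le m (C * t) (duhamel F t).
Proof.
move=> FC FK; have [C C0 HC] := duhamel_integrand_bound ha FC FK.
exists C => // t /andP[t0 tT] x.
rewrite mulrC -ler_pdivlMr ?weight_gt0// mulrAC.
apply: Rintegral_norm_le => //; first exact: duhamel_integrand_integrable.
move=> s /andP[s0 st]; rewrite ler_pdivlMr ?weight_gt0// mulrC; apply: HC => //.
by rewrite s0 (le_trans st).
Qed.

Lemma mild0 f F : mild f F 0 = f.
Proof.
apply/funext => x; rewrite /mild /duhamel set_itv1 Rintegral_set1 addr0.
by rewrite cholU_ge// gavg0.
Qed.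

Lemma mild_bound m T f F : rschwartz f -> schwartz_path F ->
  exists K, forall t, 0 <= t <= T -> weighted_le m K (mild f F t).
Proof.
move=> fS FC; have [K1 HK1] := schwartz_path_bound T m [::] (schwartz_path_cst fS).
have [K2 HK2] := schwartz_path_bound T m [::] FC.
have [C1 C10 HC1] := duhamel_integrand_bound ha (schwartz_path_cst fS) HK1.
have [C2 C20 HC2] := duhamel_weight FC HK2.
exists (C1 + C2 * T) => t tT; apply: weighted_leD.
  move=> x; apply: HC1 (andP tT).2; rewrite lexx/=.
  by rewrite (le_trans (andP tT).1) ?(andP tT).2.
by apply: weighted_le_le (HC2 t tT); rewrite ler_wpM2l// (andP tT).2.
Qed.

Lemma duhamel_integrand_lipschitz F K s t x y : bounded_C1 K (F s) ->
  `|duhamel_integrand F x s t - duhamel_integrand F y s t| <= n%:R * K * gmoment n 1 * `|x - y|.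
Proof.
move=> sK; rewrite (le_trans (gavg_lipschitz _ _ _ _ sK))// subrr normr0 mulr0 addr0.
by rewrite mulrAC.
Qed.

Lemma duhamel_is_derive i F t x : schwartz_path F -> 0 <= t ->
  is_derive x (e i) (duhamel F t) (duhamel (fun s => rpd i (F s)) t x).
Proof.
move=> FC t0; have [K HK] := schwartz_path_nice t FC.
apply: is_derive_lineP.
apply: (proj2 (@is_derive_integral R _ _ mu _ (fun r s => duhamel_integrand F (x + r *: e i) s t)
  (fun s => duhamel_integrand (fun s => rpd i (F s)) x s t) (fun=> n%:R * K * gmoment n 1) 0 _ _ _ _ _ _)) => //.
- by near=> r; exact: duhamel_integrand_integrable.
- have /integrableP[/measurable_EFinP H _] := duhamel_integrand_integrable ha x t t (schwartz_path_rpd i FC).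
  exact: H.
- exact: (@itv_bounded_integrable _ _ _ _ `|n%:R * K * gmoment n 1|).
- near=> r => s; rewrite /= in_itv/= => st; rewrite scale0r addr0 subr0.
  have sK := HK s st.
  rewrite (le_trans (duhamel_integrand_lipschitz _ _ _ sK))// [leRHS]mulrC ler_wpM2l//.
    by rewrite !mulr_ge0 ?gmoment_ge0// (bounded_C1_ge0 sK).
  by rewrite addrAC subrr add0r normrZ ler_piMr// norm_unit_vec.
- apply: aeW => s; rewrite /= in_itv/= => st.
  have [d1 d2] := gavg_is_derive (cholU a s t) x i (HK s st).
  have d0 : derivable (gavg (cholU a s t) (F s)) (x + 0 *: e i) (e i).
    by rewrite scale0r addr0.
  have := is_derive_line d0.
  by rewrite scale0r addr0 d2.
Unshelve. all: by end_near. Qed.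

Lemma mild_is_derive_x i f F t x : rschwartz f -> schwartz_path F -> 0 <= t ->
  is_derive x (e i) (mild f F t) (mild (rpd i f) (fun s => rpd i (F s)) t x).
Proof.
move=> fS FC t0; have [K fK] := rschwartz_nice fS.
exact: (is_deriveD (gavg_is_derive (cholU a 0 t) x i fK) (duhamel_is_derive i x FC t0)).
Qed.

Lemma mild_rpd i f F t : rschwartz f -> schwartz_path F -> 0 <= t ->
  rpd i (mild f F t) = mild (rpd i f) (fun s => rpd i (F s)) t.
Proof.
move=> fS FC t0; apply/funext => x; rewrite rpdE.
by have [_ ->] := mild_is_derive_x i x fS FC t0.
Qed.

(** Derivatives pass to the data, so every bound on a derivative of the solution is a bound on a
    solution with other Schwartz data. *)
Lemma mild_rpds (l : seq 'I_n) f F t : rschwartz f -> schwartz_path F -> 0 <= t ->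
  rpds l (mild f F t) = mild (rpds l f) (fun s => rpds l (F s)) t.
Proof.
move=> fS FC t0; elim: l => [|i l IH]; first by [].
rewrite (_ : rpds (i :: l) _ = rpd i (rpds l (mild f F t))); last by [].
exact: etrans (congr1 (rpd i) IH) (mild_rpd i (rschwartz_rpds l fS) (schwartz_path_rpds l FC) t0).
Qed.

Lemma mild_continuous f F t : rschwartz f -> schwartz_path F -> 0 <= t -> continuous (mild f F t).
Proof.
move=> fS FC t0; have [K0 fK] := rschwartz_nice fS; have [K HK] := schwartz_path_nice t FC.
have K00 : 0 <= K0 := bounded_C1_ge0 fK.
have K1 : 0 <= K by apply: bounded_C1_ge0 (HK 0 _); rewrite lexx.
pose C := n%:R * K0 * gmoment n 1 + n%:R * K * gmoment n 1 * t.
have C0 : 0 <= C by rewrite addr_ge0 ?mulr_ge0 ?gmoment_ge0.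
have lip x y : `|mild f F t x - mild f F t y| <= C * `|x - y|.
  rewrite /mild opprD addrACA (le_trans (ler_normD _ _))// mulrDl lerD//.
    rewrite (le_trans (gavg_lipschitz _ _ _ _ fK))// subrr normr0 mulr0 addr0.
    by rewrite mulrAC.
  rewrite /duhamel -RintegralB//; [|exact: duhamel_integrand_integrable..].
  rewrite [leRHS]mulrAC; apply: Rintegral_norm_le => //.
    by apply: RintegrableB => //; exact: duhamel_integrand_integrable.
  by move=> s st; apply: duhamel_integrand_lipschitz; exact: HK.
move=> x; apply/(@cvgrPdist_le _ _ _ (nbhs x)) => eps eps0.
have C1 : 0 < C + 1 by rewrite ltr_wpDl.
apply/nbhs_ballP; exists (eps / (C + 1)); first by rewrite /= divr_gt0.
move=> y; rewrite -ball_normE/= => xy; rewrite (le_trans (lip _ _))//.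
apply: (@le_trans _ _ ((C + 1) * `|x - y|)); first by rewrite ler_wpM2r// lerDl.
by rewrite mulrC -ler_pdivlMr// ltW.
Qed.

Lemma mild_rschwartz f F t : rschwartz f -> schwartz_path F -> 0 <= t -> rschwartz (mild f F t).
Proof.
move=> fS FC t0; split.
- by move=> l; rewrite mild_rpds//; apply: mild_continuous => //;
  [exact: rschwartz_rpds|exact: schwartz_path_rpds].
- move=> l i x; rewrite mild_rpds//.
  by have [] := mild_is_derive_x i x (rschwartz_rpds l fS) (schwartz_path_rpds l FC) t0.
- move=> m l; rewrite mild_rpds//.
  have [K HK] := mild_bound m t (rschwartz_rpds l fS) (schwartz_path_rpds l FC).
  by exists K; apply: HK; rewrite t0 lexx.
Qed.

(** The second derivatives are left on the data, where [mild_bound] applies directly;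
    [mild_is_derive] restates the same as the equation for the solution. *)
Lemma mild_is_derive_aux f F t x : rschwartz f -> schwartz_path F -> 0 < t ->
  is_derive t (1 : R) (fun r => mild f F r x)
   (\sum_i \sum_j a t i j * mild (rpd i (rpd j f)) (fun s => rpd i (rpd j (F s))) t x + F t x).
Proof.
move=> fS FC t0.
have := is_deriveRD (gavg_cholU_is_derive ha x fS (lexx 0) t0) (duhamel_derive ha x FC t0).
move/is_deriveR_ext; apply => //; rewrite addrA; congr (_ + _).
rewrite -big_split/=; apply: eq_bigr => i _; rewrite -big_split/=; apply: eq_bigr => j _.
by rewrite -mulrDr.
Qed.

Lemma mild_is_derive f F t x : rschwartz f -> schwartz_path F -> 0 < t ->
  is_derive t (1 : R) (fun r => mild f F r x)
   (\sum_i \sum_j a t i j * rpd i (rpd j (mild f F t)) x + F t x).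
Proof.
move=> fS FC t0; have := mild_is_derive_aux x fS FC t0; move/is_deriveR_ext; apply => //.
congr (_ + _); apply: eq_bigr => i _; apply: eq_bigr => j _; congr (_ * _).
by rewrite (mild_rpd j)// ?ltW// mild_rpd//;
  [exact: rschwartz_rpd|exact: schwartz_path_rpd|exact: ltW].
Qed.

Lemma mild_within f F x T : rschwartz f -> schwartz_path F -> 0 < T ->
  {within `[0, T], continuous (fun r => mild f F r x)}.
Proof.
move=> fS FC T0; apply: within_itv_right => //; last first.
  by move=> r r0; exact: is_derive_continuous (mild_is_derive x fS FC r0).
rewrite mild0 -[X in _ --> X]addr0; apply: cvgD; first exact: gavg_cholU_right.
have [K HK] := schwartz_path_bound 1 0 [::] FC.
have [C C0 HC] := duhamel_weight FC HK.
have C1 : 0 < C + 1 by rewrite ltr_wpDl.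
apply/cvgr0Pnorm_le => eps eps0; near=> r.
have r0 : 0 < r by near: r; exact: nbhs_right_gt.
have r1 : r <= 1 by apply: ltW; near: r; exact: nbhs_right_lt.
rewrite (le_trans (weighted_le_norm x (HC r _)))// ?(ltW r0)//.
apply: (@le_trans _ _ ((C + 1) * r)); first by rewrite ler_wpM2r ?(ltW r0)// lerDl.
rewrite mulrC -ler_pdivlMr//; apply: ltW; near: r; apply: nbhs_right_lt.
by rewrite divr_gt0.
Unshelve. all: by end_near. Qed.

(** For each fixed [x] the weight is a constant, so it is divided out and the mean value theorem is
    applied to a scalar function of time whose derivative is bounded by [mild_bound] and the bound
    on [F]. *)
Lemma mild_lipschitz_t m T f F : rschwartz f -> schwartz_path F ->
  exists K, forall t1 t2, 0 <= t1 -> t1 <= t2 -> t2 <= T ->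
  weighted_le m (K * (t2 - t1)) (fun x => mild f F t2 x - mild f F t1 x).
Proof.
move=> fS FC; have [M M0 aM] := coef_bounded ha T.
have /choice[K HK] : forall ij : 'I_n * 'I_n, exists K, forall t, 0 <= t <= T ->
    weighted_le m K (mild (rpd ij.1 (rpd ij.2 f)) (fun s => rpd ij.1 (rpd ij.2 (F s))) t).
  by move=> [i j]; apply: mild_bound; [do 2!apply: rschwartz_rpd|do 2!apply: schwartz_path_rpd].
have [K1 HK1] := schwartz_path_bound T m [::] FC.
exists (\sum_i \sum_j M * K (i, j) + K1) => t1 t2 t10 t12 t2T x.
rewrite mulrC -ler_pdivlMr ?weight_gt0// mulrAC.
apply: (@MVT_lipschitz _ (fun r => mild f F r x) _ _ _ _ t12).
- by move=> r /andP[r1 _]; apply: mild_is_derive_aux => //; exact: le_lt_trans r1.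
- have [T0|T0] := ltP 0 T.
    apply: (@continuous_subspaceW _ _ _ `[0, T]); last exact: mild_within.
    move=> r /=; rewrite !in_itv/= => /andP[r1 r2].
    by rewrite (le_trans t10 r1) (le_trans r2 t2T).
  have -> : t1 = t2 by apply/le_anti; rewrite t12 (le_trans t2T) ?(le_trans T0).
  by rewrite set_itv1; exact: continuous_subspace1.
- move=> r /andP[r1 r2].
  have r0 : 0 <= r := le_trans t10 (ltW r1).
  have rT : r <= T := le_trans (ltW r2) t2T.
  rewrite ler_pdivlMr ?weight_gt0// mulrC.
  apply: le_trans (ler_wpM2l (weight_ge0 m x) (ler_normD _ _)) _.
  rewrite mulrDr lerD//; last by apply: HK1; rewrite r0.
  apply: le_trans (ler_wpM2l (weight_ge0 m x) (ler_norm_sum _ _ _)) _.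
  rewrite mulr_sumr; apply: ler_sum => i _.
  apply: le_trans (ler_wpM2l (weight_ge0 m x) (ler_norm_sum _ _ _)) _.
  rewrite mulr_sumr; apply: ler_sum => j _.
  rewrite normrM mulrCA ler_pM ?mulr_ge0 ?weight_ge0//; first by apply: aM; rewrite r0.
  have r0T : 0 <= r <= T by rewrite r0.
  exact: HK (i, j) r r0T x.
Qed.

Lemma lipschitz_weight m K t eps (P : R -> 'rV[R]_n -> R) : 0 < eps ->
  (forall t1 t2, 0 <= t1 -> t1 <= t2 -> t2 <= t + 1 ->
    weighted_le m (K * (t2 - t1)) (fun x => P t2 x - P t1 x)) ->
  0 <= t -> \forall r \near t, 0 <= r -> weighted_le m eps (fun x => P r x - P t x).
Proof.
(* [K] is not assumed nonnegative, hence the denominator [|K| + 1]; times are kept below [t + 1],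
   where the Lipschitz bound holds. *)
move=> eps0 HK t0; pose d := eps / (`|K| + 1).
have K1 : 0 < `|K| + 1 by rewrite ltr_wpDl.
have d0 : 0 < d by rewrite divr_gt0.
have bd r1 r2 : 0 <= r1 -> r1 <= r2 -> r2 <= t + 1 -> r2 - r1 <= d ->
    weighted_le m eps (fun x => P r2 x - P r1 x).
  move=> r10 r12 r2t rd; apply: weighted_le_le (HK r1 r2 r10 r12 r2t).
  apply: (@le_trans _ _ ((`|K| + 1) * (r2 - r1))).
    rewrite ler_wpM2r ?subr_ge0//; apply: (le_trans (ler_norm _)); by rewrite lerDl.
  by rewrite mulrC -ler_pdivlMr.
have near1 : \forall r \near t, `|r - t| <= Num.min 1 d.
  apply/nbhs_ballP; exists (Num.min 1 d); first by rewrite /= lt_min ltr01.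
  by move=> r; rewrite -ball_normE/= distrC => /ltW.
apply: filterS near1 => r; rewrite le_min => /andP[h1 h2] r0.
have [tr|rt] := leP t r.
  rewrite ger0_norm ?subr_ge0// in h1 h2.
  by apply: bd => //; rewrite -lerBlDl.
rewrite distrC ger0_norm ?subr_ge0 ?(ltW rt)// in h1 h2.
have tt : t <= t + 1 by rewrite lerDl.
move=> x; rewrite distrC; exact: (bd r t r0 (ltW rt) tt h2 x).
Qed.

Lemma mild_schwartz_path f F : rschwartz f -> schwartz_path F -> schwartz_path (mild f F).
Proof.
move=> fS FC; split=> [t t0|m l t eps t0 eps0]; first exact: mild_rschwartz.
have [K HK] := mild_lipschitz_t m (t + 1) (rschwartz_rpds l fS) (schwartz_path_rpds l FC).
apply: (@lipschitz_weight m K t eps (fun r => rpds l (mild f F r))) => //.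
move=> t1 t2 t10 t12 t2t x.
have E1 := congr1 (fun p => p x) (mild_rpds l fS FC t10).
have E2 := congr1 (fun p => p x) (mild_rpds l fS FC (le_trans t10 t12)).
move: (HK t1 t2 t10 t12 t2t x); congr (_ * `| _ | <= _).
exact: (f_equal2 (fun p q => p - q) (esym E2) (esym E1)).
Qed.

End mild_solution.

(** * Differentiability with values in the Schwartz space *)

Section schwartz_space.
Context {R : realType} {n : nat}.
Implicit Types (t r h eps c K : R) (f g : 'rV[R]_n -> R) (x : 'rV[R]_n)
  (F G : R -> 'rV[R]_n -> R) (l : seq 'I_n) (i j : 'I_n).
Local Notation e := (@unit_vec R n).

Lemma rschwartz_derive l i f x : rschwartz f -> is_derive x (e i) (rpds l f) (rpd i (rpds l f) x).
Proof. by move=> fS; rewrite rpdE; apply/derivableP; exact: rschwartz_der. Qed.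

Lemma rpdsD l f g : rschwartz f -> rschwartz g ->
  rpds l (fun x => f x + g x) = fun x => rpds l f x + rpds l g x.
Proof.
move=> fS gS; elim: l => //= i l ->; apply/funext => x; rewrite rpdE.
by have [_ ->] := is_deriveD (rschwartz_derive l i x fS) (rschwartz_derive l i x gS).
Qed.

Lemma rpdsZ l c f : rschwartz f -> rpds l (fun x => c * f x) = fun x => c * rpds l f x.
Proof.
move=> fS; elim: l => //= i l ->; apply/funext => x; rewrite rpdE.
by have [_ ->] := is_deriveZ c (rschwartz_derive l i x fS).
Qed.

Lemma rpds0 l : rpds l (fun=> 0 : R) = fun _ : 'rV[R]_n => 0.
Proof. by elim: l => //= i l ->; apply/funext => x; rewrite rpdE; exact: derive_cst. Qed.

Lemma rschwartz0 : rschwartz (fun _ : 'rV[R]_n => 0 : R).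
Proof.
split=> [l|l i x|m l]; rewrite rpds0; first exact: cst_continuous.
  exact: derivable_cst.
by exists 0 => x; rewrite normr0 mulr0.
Qed.

Lemma rschwartzD f g : rschwartz f -> rschwartz g -> rschwartz (fun x => f x + g x).
Proof.
move=> fS gS; split=> [l|l i x|m l]; rewrite rpdsD//.
- by apply: contD; exact: rschwartz_cont.
- by apply: derivableD; exact: rschwartz_der.
- have [K HK] := rschwartz_bound fS m l; have [K' HK'] := rschwartz_bound gS m l.
  by exists (K + K'); exact: weighted_leD.
Qed.

Lemma rschwartzZ c f : rschwartz f -> rschwartz (fun x => c * f x).
Proof.
move=> fS; split=> [l|l i x|m l]; rewrite rpdsZ//.
- by apply: contM; [exact: cont_cst|exact: rschwartz_cont].
- by apply: derivableZ; exact: rschwartz_der.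
- by have [K HK] := rschwartz_bound fS m l; exists (`|c| * K); exact: weighted_leZ.
Qed.

Lemma rschwartzB f g : rschwartz f -> rschwartz g -> rschwartz (fun x => f x - g x).
Proof.
move=> fS gS; have := rschwartzD fS (rschwartzZ (-1) gS).
by congr rschwartz; apply/funext => x; rewrite mulN1r.
Qed.

Lemma rpdsB l f g : rschwartz f -> rschwartz g ->
  rpds l (fun x => f x - g x) = fun x => rpds l f x - rpds l g x.
Proof.
move=> fS gS; rewrite (_ : (fun x => _) = fun x => f x + (-1) * g x).
  rewrite rpdsD//; last exact: rschwartzZ.
  by rewrite rpdsZ//; apply/funext => x; rewrite mulN1r.
by apply/funext => x; rewrite mulN1r.
Qed.

Lemma rpdB i f g : rschwartz f -> rschwartz g ->
  rpd i (fun x => f x - g x) = fun x => rpd i f x - rpd i g x.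
Proof. exact: (@rpdsB [:: i]). Qed.

Lemma rpdZ i c f : rschwartz f -> rpd i (fun x => c * f x) = fun x => c * rpd i f x.
Proof. exact: (@rpdsZ [:: i]). Qed.

Lemma rschwartz_sum (I : Type) (s : seq I) (P : I -> 'rV[R]_n -> R) :
  (forall k, rschwartz (P k)) -> rschwartz (fun x => \sum_(k <- s) P k x).
Proof.
move=> PS; elim: s => [|k s IH].
  by rewrite (_ : (fun _ => _) = fun=> 0); [exact: rschwartz0|apply/funext => x; rewrite big_nil].
rewrite (_ : (fun _ => _) = fun x => P k x + \sum_(k <- s) P k x); first exact: rschwartzD.
by apply/funext => x; rewrite big_cons.
Qed.

Lemma rpds_sum (I : Type) (s : seq I) (P : I -> 'rV[R]_n -> R) l :
  (forall k, rschwartz (P k)) ->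
  rpds l (fun x => \sum_(k <- s) P k x) = fun x => \sum_(k <- s) rpds l (P k) x.
Proof.
move=> PS; elim: s => [|k s IH].
  rewrite (_ : (fun _ => _) = fun=> 0); last by apply/funext => x; rewrite big_nil.
  by rewrite rpds0; apply/funext => x; rewrite big_nil.
rewrite (_ : (fun _ => _) = fun x => P k x + \sum_(k <- s) P k x).
  by rewrite rpdsD//; [rewrite IH; apply/funext => x; rewrite big_cons|exact: rschwartz_sum].
by apply/funext => x; rewrite big_cons.
Qed.

Definition rschwartz_cvg (Flt : set_system R) F f := forall m l eps, 0 < eps ->
  \forall r \near Flt, weighted_le m eps (rpds l (fun x => F r x - f x)).

Section rschwartz_cvg_filter.
Context {Flt : set_system R} {FF : Filter Flt}.

Lemma rschwartz_cvgD F G f g : (\forall r \near Flt, rschwartz (F r)) -> rschwartz f ->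
  (\forall r \near Flt, rschwartz (G r)) -> rschwartz g -> rschwartz_cvg Flt F f -> rschwartz_cvg Flt G g ->
  rschwartz_cvg Flt (fun r x => F r x + G r x) (fun x => f x + g x).
Proof.
move=> FS fS GS gS Ff Gg m l eps eps0; near=> r.
have Fr : rschwartz (F r) by near: r.
have Gr : rschwartz (G r) by near: r.
rewrite (_ : (fun x => _) = (fun x => (F r x - f x) + (G r x - g x))).
  rewrite rpdsD; [|exact: rschwartzB|exact: rschwartzB].
  rewrite [eps]splitr; apply: weighted_leD.
    by near: r; apply: Ff; rewrite divr_gt0.
  by near: r; apply: Gg; rewrite divr_gt0.
by apply/funext => x; rewrite opprD addrACA.
Unshelve. all: by end_near. Qed.

Lemma rschwartz_cvgZ (c : R -> R) (c0 : R) F f : c r @[r --> Flt] --> c0 ->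
  (\forall r \near Flt, rschwartz (F r)) -> rschwartz f -> rschwartz_cvg Flt F f ->
  rschwartz_cvg Flt (fun r x => c r * F r x) (fun x => c0 * f x).
Proof.
move=> cc FS fS Ff m l eps eps0.
have [K HK] := rschwartz_bound fS m l.
pose d := eps / 2 / (`|K| + 1); pose d' := eps / 2 / (`|c0| + 1).
have K1 : 0 < `|K| + 1 by rewrite ltr_wpDl.
have c1 : 0 < `|c0| + 1 by rewrite ltr_wpDl.
have d0 : 0 < d by rewrite !divr_gt0.
have d'0 : 0 < d' by rewrite !divr_gt0.
have cn1 : \forall r \near Flt, `|c0 - c r| <= d by move/cvgrPdist_le : cc; apply.
have cn2 : \forall r \near Flt, `|c0 - c r| <= 1 by move/cvgrPdist_le : cc; apply.
near=> r.
have Fr : rschwartz (F r) by near: r.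
have Sr : rschwartz (fun x => F r x - f x) by exact: rschwartzB.
(* The usual splitting for a product: the first term needs [c] bounded near the limit, the second a
   fixed bound on [f]. The radii [d'] and [d] give each term half of [eps]. *)
rewrite (_ : (fun x => _) = (fun x => c r * (F r x - f x) + (c r - c0) * f x)).
  rewrite rpdsD; [|exact: rschwartzZ|exact: rschwartzZ].
  rewrite (rpdsZ _ (c r) Sr) (rpdsZ _ (c r - c0) fS) [eps]splitr; apply: weighted_leD.
    apply: (@weighted_le_le _ _ m (`|c r| * d')).
      have cr : `|c r| <= `|c0| + 1.
        rewrite -[c r](subrK c0) addrC (le_trans (ler_normD _ _))// lerD// distrC.
        by near: r.
      rewrite -[leRHS](@divfK _ (`|c0| + 1)) ?gt_eqF// -/d' mulrC ler_wpM2l// ltW//.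
    by apply: weighted_leZ; near: r; exact: Ff.
  apply: weighted_le_le (weighted_leZ _ HK).
  rewrite -[leRHS](@divfK _ (`|K| + 1)) ?gt_eqF// -/d distrC.
  apply: (@le_trans _ _ (`|c0 - c r| * (`|K| + 1))).
    by rewrite ler_wpM2l// (le_trans (ler_norm _))// lerDl.
  by rewrite ler_wpM2r ?(ltW K1)//; near: r.
by apply/funext => x; rewrite mulrBr mulrBl addrA subrK.
Unshelve. all: by end_near. Qed.

Lemma rschwartz_cvg_rpd i F f : (\forall r \near Flt, rschwartz (F r)) -> rschwartz f ->
  rschwartz_cvg Flt F f ->
  rschwartz_cvg Flt (fun r => rpd i (F r)) (rpd i f).
Proof.
move=> FS fS Ff m l eps eps0; apply: filterS2 FS (Ff m (rcons l i) eps eps0) => r Fr.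
by rewrite -rpds_rcons (rpdB i Fr fS).
Qed.

Lemma rschwartz_cvg_cst f : rschwartz_cvg Flt (fun=> f) f.
Proof.
move=> m l eps eps0; apply: filterE => r x.
rewrite (_ : (fun _ => _) = fun=> 0); last by apply/funext => y; rewrite subrr.
by rewrite rpds0 normr0 mulr0 ltW.
Qed.

Lemma rschwartz_cvg_near F G f : (\forall r \near Flt, F r = G r) -> rschwartz_cvg Flt F f ->
  rschwartz_cvg Flt G f.
Proof.
move=> FG Ff m l eps eps0; apply: filterS2 FG (Ff m l eps eps0) => r Fr.
by rewrite Fr.
Qed.

End rschwartz_cvg_filter.

Definition dquot F t h x := h^-1 * (F (t + h) x - F t x).

Fixpoint schwartz_path_Ck (k : nat) F : Prop :=
  (forall t, 0 < t -> rschwartz (F t) /\ rschwartz_cvg (nbhs t) F (F t)) /\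
  if k is k'.+1 then exists F' : R -> 'rV[R]_n -> R,
      (forall t, 0 < t -> rschwartz_cvg (0 : R)^' (dquot F t) (F' t)) /\ schwartz_path_Ck k' F'
  else True.

Lemma schwartz_path_Ck_C0 k F t : schwartz_path_Ck k F -> 0 < t ->
  rschwartz (F t) /\ rschwartz_cvg (nbhs t) F (F t).
Proof. by case: k => [|k] [FC _]; exact: FC. Qed.

Lemma schwartz_path_CkW k F : schwartz_path_Ck k.+1 F -> schwartz_path_Ck k F.
Proof.
elim: k F => [|k IH] F [F0 [F' [dF FC]]]; split => //.
by exists F'; split => //; exact: IH.
Qed.

Lemma near_rschwartz k F t : schwartz_path_Ck k F -> 0 < t -> \forall r \near t, rschwartz (F r).
Proof.
move=> FC t0; have := near_above t0; apply: filterS => r r0.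
exact: (schwartz_path_Ck_C0 FC r0).1.
Qed.

Lemma near_shift_pos t : 0 < t -> \forall h \near (0 : R)^', 0 < t + h.
Proof.
move=> t0; apply: nbhs_dnbhs; apply/nbhs_ballP; exists t => //= h.
rewrite -ball_normE/= sub0r normrN => ht.
by rewrite -ltrBlDl sub0r (lt_le_trans _ (lerNnormlW (lexx _)))// ltrN2.
Qed.

Lemma rschwartz_dquot k F t h : schwartz_path_Ck k F -> 0 < t -> 0 < t + h ->
  rschwartz (dquot F t h).
Proof.
move=> FC t0 th0; apply: rschwartzZ; apply: rschwartzB.
  exact: (schwartz_path_Ck_C0 FC th0).1.
exact: (schwartz_path_Ck_C0 FC t0).1.
Qed.

Lemma near_rschwartz_dquot k F t : schwartz_path_Ck k F -> 0 < t ->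
  \forall h \near (0 : R)^', rschwartz (dquot F t h).
Proof. by move=> FC t0; apply: filterS (near_shift_pos t0) => h; exact: rschwartz_dquot FC t0. Qed.

Lemma schwartz_path_CkD k F G : schwartz_path_Ck k F -> schwartz_path_Ck k G ->
  schwartz_path_Ck k (fun t x => F t x + G t x).
Proof.
elim: k F G => [|k IH] F G FC GC; (split; first (move=> t t0;
  have [FS Fc] := schwartz_path_Ck_C0 FC t0; have [GS Gc] := schwartz_path_Ck_C0 GC t0;
  split; [exact: rschwartzD|by apply: rschwartz_cvgD => //; [exact: near_rschwartz FC t0|exact: near_rschwartz GC t0]])) => //.
have [_ [F' [dF F'C]]] := FC; have [_ [G' [dG G'C]]] := GC.
exists (fun t x => F' t x + G' t x); split; last exact: IH.
move=> t t0; rewrite (_ : dquot _ t = fun h x => dquot F t h x + dquot G t h x).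
  exact: rschwartz_cvgD (near_rschwartz_dquot FC t0) (schwartz_path_Ck_C0 F'C t0).1
    (near_rschwartz_dquot GC t0) (schwartz_path_Ck_C0 G'C t0).1 (dF t t0) (dG t t0).
apply/funext => h; apply/funext => x.
by rewrite /dquot -mulrDr opprD addrACA.
Qed.

Lemma schwartz_path_Ck_rpd i k F : schwartz_path_Ck k F ->
  schwartz_path_Ck k (fun t => rpd i (F t)).
Proof.
elim: k F => [|k IH] F FC; (split; first (move=> t t0;
  have [FS Fc] := schwartz_path_Ck_C0 FC t0;
  split; [exact: rschwartz_rpd|by apply: rschwartz_cvg_rpd => //; exact: near_rschwartz FC t0])) => //.
have [_ [F' [dF F'C]]] := FC.
exists (fun t => rpd i (F' t)); split; last exact: IH.
move=> t t0; apply: rschwartz_cvg_near (rschwartz_cvg_rpd i (near_rschwartz_dquot FC t0) (schwartz_path_Ck_C0 F'C t0).1 (dF t t0)).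
apply: filterS (near_shift_pos t0) => h th0.
have S1 := (schwartz_path_Ck_C0 FC th0).1; have S2 := (schwartz_path_Ck_C0 FC t0).1.
by rewrite /dquot (rpdZ i _ (rschwartzB S1 S2)) (rpdB i S1 S2).
Qed.

Lemma schwartz_path_Ck0 k : schwartz_path_Ck k (fun _ _ => 0).
Proof.
elim: k => [|k IH]; (split; first by move=> t t0; split; [exact: rschwartz0|exact: rschwartz_cvg_cst]) => //.
exists (fun _ _ => 0); split => // t t0.
rewrite (_ : dquot _ t = fun _ _ => 0); first exact: rschwartz_cvg_cst.
by apply/funext => h; apply/funext => x; rewrite /dquot subrr mulr0.
Qed.

Lemma schwartz_path_Ck_sum (I : Type) (s : seq I) (P : I -> R -> 'rV[R]_n -> R) k :
  (forall q, schwartz_path_Ck k (P q)) -> schwartz_path_Ck k (fun t x => \sum_(q <- s) P q t x).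
Proof.
move=> PC; elim: s => [|q s IH].
  rewrite (_ : (fun _ => _) = fun _ _ => 0); first exact: schwartz_path_Ck0.
  by apply/funext => t; apply/funext => x; rewrite big_nil.
rewrite (_ : (fun _ => _) = fun t x => P q t x + \sum_(q <- s) P q t x);
  first exact: schwartz_path_CkD.
by apply/funext => t; apply/funext => x; rewrite big_cons.
Qed.

(** Convergence at a positive time and small difference quotients there involve only positive times,
    so agreement on them suffices. *)
Lemma schwartz_path_Ck_ext k F G : (forall t, 0 < t -> F t = G t) -> schwartz_path_Ck k F ->
  schwartz_path_Ck k G.
Proof.
move=> FG FC.
have G0 t : 0 < t -> rschwartz (G t) /\ rschwartz_cvg (nbhs t) G (G t).
  move=> t0; have [FS Fc] := schwartz_path_Ck_C0 FC t0; rewrite -FG//; split => //.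
  by apply: rschwartz_cvg_near Fc; apply: filterS (near_above t0) => r; exact: FG.
case: k FC => [|k] [_ FC]; split => //.
have [F' [dF F'C]] := FC; exists F'; split => // t t0.
apply: rschwartz_cvg_near (dF t t0); apply: filterS (near_shift_pos t0) => h th0.
by rewrite /dquot !FG.
Qed.

Lemma derive1_shift (c : R -> R) t : derivable c t (1 : R) ->
  h^-1 * (c (t + h) - c t) @[h --> (0 : R)^'] --> c^`()%classic t.
Proof. by move=> ct; apply/is_derive1P; rewrite derive1E; exact/derivableP. Qed.

Lemma cvg_shift (c : R -> R) t : derivable c t (1 : R) -> c (t + h) @[h --> (0 : R)^'] --> c t.
Proof.
move=> ct; have cc : {for t, continuous c} by apply: differentiable_continuous;
  exact/derivable1_diffP.
have H : t + h @[h --> (0 : R)^'] --> t.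
  rewrite -[X in _ --> X]addr0; apply: cvgD; first exact: cvg_cst.
  exact: (@cvg_within _ (nbhs (0 : R))).
exact: (cvg_comp _ _ H cc).
Qed.

Lemma schwartz_path_CkZ k (c : R -> R) F :
  (forall m t, 0 < t -> derivable (derive1n m c) t (1 : R)) -> schwartz_path_Ck k F ->
  schwartz_path_Ck k (fun t x => c t * F t x).
Proof.
elim: k c F => [|k IH] c F cs FC; (split; first (move=> t t0;
  have [FS Fc] := schwartz_path_Ck_C0 FC t0; split;
    [exact: rschwartzZ|apply: rschwartz_cvgZ => //; [
  by apply: differentiable_continuous; apply/derivable1_diffP; exact: (cs 0%N)
  |exact: near_rschwartz FC t0]])) => //.
have [_ [F' [dF F'C]]] := FC.
(* The term with the derivative of [c] uses [F] at the lower order [k], and a new coefficient; the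
   induction therefore ranges over all [c]. *)
exists (fun t x => c t * F' t x + derive1 c t * F t x); split; last first.
  apply: schwartz_path_CkD; first exact: IH.
  by apply: IH; [move=> m t t0; rewrite -derive1Sn; exact: cs|exact: schwartz_path_CkW].
move=> t t0; have ct : derivable c t (1 : R) := cs 0%N t t0;
  have FS := (schwartz_path_Ck_C0 FC t0).1.
have F'S := (schwartz_path_Ck_C0 F'C t0).1; have dS := near_rschwartz_dquot FC t0.
have S1 : \forall h \near (0 : R)^', rschwartz (fun x => c (t + h) * dquot F t h x).
  by apply: filterS dS => h hS; exact: rschwartzZ.
have S2 : \forall h \near (0 : R)^', rschwartz (fun x => h^-1 * (c (t + h) - c t) * F t x).
  by apply: filterE => h; exact: rschwartzZ.
rewrite (_ : dquot _ t = fun h x => c (t + h) * dquot F t h x + h^-1 * (c (t + h) - c t) * F t x).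
  apply: (rschwartz_cvgD S1 (rschwartzZ (c t) F'S) S2 (rschwartzZ _ FS)).
    exact: rschwartz_cvgZ (cvg_shift ct) dS F'S (dF t t0).
  have S3 : \forall h \near (0 : R)^', rschwartz ((fun _ => F t) h) by near=> h.
  exact: rschwartz_cvgZ (derive1_shift ct) S3 FS (@rschwartz_cvg_cst (0 : R)^' _ (F t)).
by apply/funext => h; apply/funext => x; rewrite /dquot; ring.
Unshelve. all: by end_near. Qed.

(** Upgrades pointwise time derivatives to a derivative in S, given that [G] is continuous in S. The
    mean value theorem for [F r - r G t], whose derivative is [G r - G t], bounds the error of the
    difference quotient by a quantity small in the weighted norm. *)
Lemma rschwartz_cvg_dquot F G t : 0 < t -> schwartz_path_Ck 0 F -> schwartz_path_Ck 0 G ->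
  (forall l x r, 0 < r ->
    is_derive r (1 : R) (fun r => rpds l (F r) x) (rpds l (G r) x)) ->
  rschwartz_cvg (0 : R)^' (dquot F t) (G t).
Proof.
move=> t0 FC GC dF m l eps eps0; have [GS Gc] := schwartz_path_Ck_C0 GC t0.
have [d d0 dG] : exists2 d, 0 < d & forall r, `|t - r| < d -> 0 < r /\
    weighted_le m eps (rpds l (fun x => G r x - G t x)).
  have [d d0 H] := (nbhs_ballP _ _).1 (filterI (near_above t0) (Gc m l eps eps0)).
  by exists d => // r tr; apply: H; rewrite -ball_normE.
have FS := (schwartz_path_Ck_C0 FC t0).1.
(* The Lipschitz constant carries the inverse weight at [x], while the radius [d] does not depend on
   [x]; this yields uniformity after multiplying back by the weight. *)
have lip x r1 r2 : r1 <= r2 -> `|t - r1| < d -> `|t - r2| < d ->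
    `|(rpds l (F r2) x - r2 * rpds l (G t) x) - (rpds l (F r1) x - r1 * rpds l (G t) x)|
    <= eps / (1 + `|x|) ^+ m * (r2 - r1).
  move=> r12 tr1 tr2.
  have bt r : r1 <= r <= r2 -> `|t - r| < d.
    move=> /andP[h1 h2]; move: tr1 tr2; rewrite !ltr_norml => /andP[a1 a2] /andP[a3 a4].
    by apply/andP; split; lra.
  have dg r : r1 <= r <= r2 -> is_derive r (1 : R)
      (fun r => rpds l (F r) x - r * rpds l (G t) x) (rpds l (G r) x - rpds l (G t) x).
    move=> rr; have [r0 _] := dG r (bt r rr).
    have := is_deriveRD (dF l x r r0) (is_deriveRN (is_deriveRM (is_deriveR_id r) (is_deriveR_cst (rpds l (G t) x) r))).
    by move/is_deriveR_ext; apply => //; rewrite mulr0 addr0 mul1r.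
  apply: (@MVT_lipschitz _ (fun r => rpds l (F r) x - r * rpds l (G t) x)
    (fun r => rpds l (G r) x - rpds l (G t) x) _ _ _ r12) => [r /andP[h1 h2]||r /andP[h1 h2]].
  - by apply: dg; rewrite (ltW h1) (ltW h2).
  - apply/continuous_in_subspaceT => r; rewrite inE/= in_itv/= => rr.
    exact: is_derive_continuous (dg r rr).
  - have [r0 H] : 0 < r /\ weighted_le m eps (rpds l (fun x => G r x - G t x)).
      by apply: dG; apply: bt; rewrite (ltW h1) (ltW h2).
    rewrite ler_pdivlMr ?weight_gt0// mulrC.
    by move: (H x); rewrite rpdsB//; exact: (schwartz_path_Ck_C0 GC r0).1.
near=> h.
have hd : `|h| < d.
  near: h; apply: nbhs_dnbhs; apply/nbhs_ballP; exists d => // h.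
  by rewrite -ball_normE/= sub0r normrN.
have h0 : h != 0 by near: h; exact: nbhs_dnbhs_neq.
have td : `|t - t| < d by rewrite subrr normr0.
have thd : `|t - (t + h)| < d by rewrite opprD addrA subrr sub0r normrN.
have [th0 _] := dG _ thd; have FhS := (schwartz_path_Ck_C0 FC th0).1.
have DS : rschwartz (dquot F t h) by exact: rschwartz_dquot FC t0 th0.
rewrite rpdsB// /dquot (rpdsZ l h^-1 (rschwartzB FhS FS)) (rpdsB l FhS FS) => x /=.
rewrite mulrC -ler_pdivlMr ?weight_gt0//.
have H : `|(rpds l (F (t + h)) x - rpds l (F t) x) - h * rpds l (G t) x| <=
    eps / (1 + `|x|) ^+ m * `|h|.
  have [hge|hlt] := leP 0 h.
    have tth : t <= t + h by rewrite lerDl.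
    move: (lip x _ _ tth td thd); rewrite [`|h|]ger0_norm//.
    move: (rpds l (F (t + h)) x) (rpds l (F t) x) (rpds l (G t) x) (eps / _) => A B C K.
    rewrite (_ : A - (t + h) * C - (B - t * C) = A - B - h * C); last by ring.
    by rewrite (_ : t + h - t = h)//; ring.
  have tth : t + h <= t by rewrite gerDl ltW.
  move: (lip x _ _ tth thd td); rewrite [`|h|]ltr0_norm// distrC.
  move: (rpds l (F (t + h)) x) (rpds l (F t) x) (rpds l (G t) x) (eps / _) => A B C K.
  rewrite (_ : A - (t + h) * C - (B - t * C) = A - B - h * C); last by ring.
  by rewrite (_ : t - (t + h) = - h)//; ring.
have -> : h^-1 * (rpds l (F (t + h)) x - rpds l (F t) x) - rpds l (G t) x =
    h^-1 * (rpds l (F (t + h)) x - rpds l (F t) x - h * rpds l (G t) x).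
  by rewrite [RHS]mulrBr mulKf.
by rewrite normrM normfV ler_pdivrMl ?normr_gt0// [leRHS]mulrC.
Unshelve. all: by end_near. Qed.

End schwartz_space.

(** * Smoothness in time of the mild solution *)

Section mild_smooth.
Context {R : realType} {n : nat} (a : R -> 'M[R]_n) (ha : coefficient_matrix a).
Implicit Types (t r : R) (i j : 'I_n) (x : 'rV[R]_n) (F : R -> 'rV[R]_n -> R)
  (f : 'rV[R]_n -> R) (l : seq 'I_n).

Lemma schwartz_path_cvg F t : schwartz_path F -> 0 <= t ->
  rschwartz_cvg (within `[0, +oo[%classic (nbhs t)) F (F t).
Proof.
move=> [FS Fc] t0 m l eps eps0; apply: filterS (Fc m l t eps t0 eps0) => r H.
rewrite /= in_itv/= andbT => r0; rewrite rpdsB; [exact: H|exact: FS|exact: FS].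
Qed.

Lemma rschwartz_cvg_path F : (forall t, 0 <= t -> rschwartz (F t)) ->
  (forall t, 0 <= t -> rschwartz_cvg (within `[0, +oo[%classic (nbhs t)) F (F t)) -> schwartz_path F.
Proof.
move=> FS Fc; split => // m l t eps t0 eps0.
have H : \forall r \near t, r \in `[0, +oo[ -> weighted_le m eps (rpds l (fun x => F r x - F t x)).
  exact: Fc t t0 m l eps eps0.
apply: filterS H => r; rewrite in_itv/= andbT => H r0; move: (H r0).
by rewrite rpdsB//; exact: FS.
Qed.

Lemma schwartz_path_C0 F : schwartz_path F -> schwartz_path_Ck 0 F.
Proof.
move=> FC; split => // t t0; split; first by apply: FC.1; exact: ltW.
move=> m l eps eps0; have H := schwartz_path_cvg FC (ltW t0) m l eps0.
apply: filterS2 (near_above t0) H => r r0; apply.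
by rewrite /= in_itv/= ltW.
Qed.

Definition mild_deriv f F t x :=
  \sum_i \sum_j a t i j * rpd i (rpd j (mild a f F t)) x + F t x.

Lemma rschwartz_elliptic f t i j : rschwartz f -> rschwartz (fun x => a t i j * rpd i (rpd j f) x).
Proof. by move=> fS; apply: rschwartzZ; do 2!apply: rschwartz_rpd. Qed.

Lemma mild_rpds_is_derive f F l x t : rschwartz f -> schwartz_path F -> 0 < t ->
  is_derive t (1 : R) (fun r => rpds l (mild a f F r) x) (rpds l (mild_deriv f F t) x).
Proof.
move=> fS FC t0; have t0' := ltW t0.
have US := mild_rschwartz ha fS FC t0'.
have E : rpds l (mild_deriv f F t) x =
    \sum_i \sum_j a t i j * rpd i (rpd j (mild a (rpds l f) (fun s => rpds l (F s)) t)) x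
    + rpds l (F t) x.
  rewrite /mild_deriv rpdsD; last 2 first.
  - by do 2!(apply: rschwartz_sum => ?); apply: rschwartz_elliptic.
  - exact: FC.1.
  congr (_ + _); rewrite rpds_sum; last by move=> i; apply: rschwartz_sum => j;
    exact: rschwartz_elliptic.
  apply: eq_bigr => i _; rewrite rpds_sum; last by move=> j; exact: rschwartz_elliptic.
  apply: eq_bigr => j _; rewrite rpdsZ; last by do 2!apply: rschwartz_rpd.
  by rewrite rpds_rpd ?rpds_rpd -?(mild_rpds ha l fS FC t0')//; exact: rschwartz_rpd.
rewrite E; have D := mild_is_derive ha x (rschwartz_rpds l fS) (schwartz_path_rpds l FC) t0.
apply: near_eq_is_derive D.
apply: filterS (near_above t0) => r r0.
by rewrite -(mild_rpds ha l fS FC (ltW r0)).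
Qed.

(** The two spatial derivatives in the equation cost no regularity in time, since paths of class C^k
    in S are stable under [rpd]. Each use of the equation therefore gains one order. *)
Lemma mild_schwartz_path_Ck k f F : rschwartz f -> schwartz_path F ->
  (forall k, schwartz_path_Ck k F) -> schwartz_path_Ck k (mild a f F).
Proof.
move=> fS FC Fk; elim: k => [|k IH]; first by apply: schwartz_path_C0; exact: mild_schwartz_path.
have WC k' : schwartz_path_Ck k' (mild a f F) -> schwartz_path_Ck k' (mild_deriv f F).
  move=> Uk; apply: schwartz_path_CkD => //; apply: schwartz_path_Ck_sum => i;
    apply: schwartz_path_Ck_sum => j.
  apply: (@schwartz_path_CkZ _ _ k' (fun t => a t i j) (fun t => rpd i (rpd j (mild a f F t)))).
    by move=> m t t0; exact: (coef_smooth ha).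
  by do 2!apply: schwartz_path_Ck_rpd.
have U0 : schwartz_path_Ck 0 (mild a f F) by apply: schwartz_path_C0; exact: mild_schwartz_path.
split; first by have [] := U0.
exists (mild_deriv f F); split; last exact: WC.
move=> t t0; apply: rschwartz_cvg_dquot => //; first exact: WC.
by move=> l x r r0; exact: mild_rpds_is_derive.
Qed.

End mild_smooth.

(** * Independence of the order of partial derivatives *)

Section reorder.
Context {R : realType} {n : nat}.
Implicit Types (l : seq 'I_n) (f : 'rV[R]_n -> R).

Definition rsmooth f := (forall l, continuous (rpds l f)) /\
  forall l i x, derivable (rpds l f) x (unit_vec i).

Lemma rsmooth_rpds l f : rsmooth f -> rsmooth (rpds l f).
Proof.
by move=> [fc fd]; split=> [l'|l' i x]; rewrite /rpds -foldr_cat; [exact: fc|exact: fd].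
Qed.

Lemma rsmooth_sym i l f : rsmooth f -> rpd i (rpds l f) = rpds l (rpd i f).
Proof.
move=> fS; elim: l => //= j l <-; apply/funext => x.
have [gc gd] := rsmooth_rpds l fS; apply: rpd_comm.
- exact: (gd [::]).
- exact: (gd [::]).
- exact: (gd [:: i]).
- exact: (gd [:: j]).
- exact: (gc [:: i; j]).
- exact: (gc [:: j; i]).
Qed.

(** Bridges two encodings: seminorms use multi-indices, whose derivatives are applied in one fixed
    order, whereas smoothness and [rschwartz] quantify over arbitrary lists of directions. *)
Lemma rpds_perm l l' f : rsmooth f -> perm_eq l l' -> rpds l f = rpds l' f.
Proof.
(* A property stable under exchanging two adjacent blocks passes to every permutation; a block is
   moved across the other one derivative at a time. *)
move=> fS ll; apply: (catCA_perm_ind (P := fun s => rpds l f = rpds s f)) ll erefl.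
move=> s1 s2 s3 ->; rewrite /rpds !foldr_cat -/(rpds s3 f).
elim: s1 => [|i s1 IH]; first by [].
have fS' := rsmooth_rpds s1 (rsmooth_rpds s3 fS).
exact: etrans (congr1 (rpd i) IH) (rsmooth_sym i s2 fS').
Qed.

Lemma perm_flatten_count l :
  perm_eq (flatten [seq nseq (count_mem i l) i | i <- enum 'I_n]) l.
Proof.
apply/allP => j _ /=; apply/eqP; rewrite count_flatten sumnE -map_comp big_map.
rewrite big_enum/= (bigD1 j)//= count_nseq/= eqxx mul1n big1 ?addn0// => i /negPf ij.
by rewrite count_nseq/= ij.
Qed.

End reorder.

(** * Complex-valued Schwartz functions *)

Section complex_parts.
Context {R : realType}.
Implicit Types (z w : R[i]) (c : R) (b : bool).

(* [true] selects the imaginary part. *)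
Definition part b z : R := if b then complex.Im z else complex.Re z.

Lemma partD b z w : part b (z + w) = part b z + part b w.
Proof. by case: b z w => -[? ?] [? ?]. Qed.

Lemma partB b z w : part b (z - w) = part b z - part b w.
Proof. by case: b z w => -[? ?] [? ?]. Qed.

Lemma partZ b c z : part b (c%:C%C * z) = c * part b z.
Proof. by case: b z => -[x y] /=; rewrite !mul0r ?subr0 ?addr0. Qed.

Lemma part_sum b (I : Type) (s : seq I) (F : I -> R[i]) :
  part b (\sum_(k <- s) F k) = \sum_(k <- s) part b (F k).
Proof.
elim: s => [|k s IH]; first by rewrite !big_nil; case: b.
by rewrite !big_cons partD IH.
Qed.

Lemma part_inj z w : (forall b, part b z = part b w) -> z = w.
Proof. by case: z w => [x y] [x' y'] H; have /= -> := H false; have /= -> := H true. Qed.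

Lemma part_le b z : `|part b z| <= Normc.normc z.
Proof.
case: z => x y; rewrite -sqrtr_sqr ler_wsqrtr//.
by case: b; rewrite /= ?lerDl ?lerDr sqr_ge0.
Qed.

Lemma normc_ge0 z : 0 <= Normc.normc z.
Proof. by case: z => x y; exact: sqrtr_ge0. Qed.

Lemma normc_le z : Normc.normc z <= `|part false z| + `|part true z|.
Proof.
case: z => x y /=; rewrite -[leRHS]ger0_norm ?addr_ge0// -[leRHS]sqrtr_sqr ler_wsqrtr//.
by rewrite sqrrD !real_normK ?num_real// addrAC lerDl mulrn_wge0// mulr_ge0.
Qed.

Lemma normc_real c : Normc.normc c%:C%C = `|c|.
Proof. by rewrite /Normc.normc/= expr0n/= addr0 sqrtr_sqr. Qed.

Lemma part_ge0 z : 0 <= z <-> part true z = 0 /\ 0 <= part false z.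
Proof.
rewrite lecE /=; split; first by move=> /andP[/eqP].
by move=> [-> ->]; rewrite eqxx.
Qed.

Lemma part_cintegral b d (T : measurableType d) (mu : {measure set T -> \bar R})
    (D : set T) (g : T -> R[i]) :
  part b (cintegral mu D g) = \int[mu]_(y in D) part b (g y).
Proof. by case: b. Qed.

Context {n : nat}.
Implicit Types (v : 'rV[R]_n -> R[i]) (l : seq 'I_n).

Definition cpart b v : 'rV[R]_n -> R := fun x => part b (v x).

Lemma cpart_pderivs b l v : cpart b (pderivs l v) = rpds l (cpart b v).
Proof.
elim: l => //= i l <-; apply/funext => x; rewrite rpdE.
by case: b.
Qed.

Lemma smoothP v : smooth v <-> forall b, rsmooth (cpart b v).
Proof.
split=> [vs b|vs l]; last first.
  have E b := cpart_pderivs b l v.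
  split; first by split; [have := (vs false).1 l|have := (vs true).1 l]; rewrite -E.
  by move=> i x; split; [have := (vs false).2 l i x|have := (vs true).2 l i x]; rewrite -E.
split=> [l|l i x]; rewrite -cpart_pderivs; have [vc vd] := vs l.
  by case: b; [exact: vc.2|exact: vc.1].
by case: b; [exact: (vd i x).2|exact: (vd i x).1].
Qed.

Lemma le_seminorm alpha beta v x :
  ((`|monomial alpha x| * Normc.normc (mpderiv beta v x))%:E <= seminorm alpha beta v)%E.
Proof.
by apply: ereal_sup_ubound => /=; exists x => //; rewrite Normc.normcM normc_real.
Qed.

Lemma seminorm_le alpha beta v (K : R) :
  (forall x, `|monomial alpha x| * Normc.normc (mpderiv beta v x) <= K) ->
  (seminorm alpha beta v <= K%:E)%E.
Proof.
move=> vK; apply: ge_ereal_sup => _ /= [x _ <-].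
by rewrite Normc.normcM normc_real lee_fin.
Qed.

Lemma seminorm_ge0 alpha beta v : (0 <= seminorm alpha beta v)%E.
Proof.
by apply: le_trans (le_seminorm alpha beta v 0); rewrite lee_fin mulr_ge0// normc_ge0.
Qed.

Lemma monomial0 (x : 'rV[R]_n) : monomial (fun _ : 'I_n => 0%N) x = 1 :> R.
Proof. by rewrite /monomial big1. Qed.

Lemma monomial1 i m (x : 'rV[R]_n) :
  monomial (fun j : 'I_n => if j == i then m else 0%N) x = x 0 i ^+ m :> R.
Proof. by rewrite /monomial (bigD1 i)//= eqxx big1 ?mulr1// => j /negPf ->. Qed.

Lemma monomial_le alpha (x : 'rV[R]_n) :
  `|monomial alpha x| <= (1 + `|x|) ^+ (\sum_i alpha i)%N :> R.
Proof.
rewrite /monomial normr_prod -prodrXr/=; apply: ler_prod => i _.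
rewrite normr_ge0 normrX lerXn2r ?nnegrE ?addr_ge0//.
by rewrite (le_trans (coord_le_norm x i))// lerDr.
Qed.

(** If [|x| <= 1] the weight is at most [2^m]; otherwise it is at most [(2 |x|)^m], and the sup norm
    is attained at some coordinate. *)
Lemma weight_le m (x : 'rV[R]_n) : (1 + `|x|) ^+ m <= 2 ^+ m * (1 + \sum_i `|x 0 i| ^+ m) :> R.
Proof.
have S0 : 0 <= \sum_i `|x 0 i| ^+ m by apply: sumr_ge0 => i _; rewrite exprn_ge0.
have [x1|x1] := leP `|x| 1.
  apply: (@le_trans _ _ (2 ^+ m)); last by rewrite ler_peMr ?exprn_ge0// lerDl.
  by rewrite lerXn2r ?nnegrE ?addr_ge0//; move: x1; rewrite -(lerD2l 1).
have x0 : `|x| != 0 by rewrite gt_eqF// (lt_trans ltr01).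
have [[k i]/= xi] := mx_norm_neq0 x0.
apply: (@le_trans _ _ ((2 * `|x|) ^+ m)).
  by rewrite lerXn2r ?nnegrE ?addr_ge0 ?mulr_ge0//; move: x1 => /ltW; lra.
rewrite exprMn ler_wpM2l ?exprn_ge0// (bigD1 i)//= -(ord1 k) -xi addrCA lerDl.
by rewrite addr_ge0//; apply: sumr_ge0 => j _; rewrite exprn_ge0.
Qed.

Definition multiplicities l : 'I_n -> nat := fun i => count_mem i l.

Lemma mpderivE l v : smooth v -> mpderiv (multiplicities l) v = pderivs l v.
Proof.
move=> /smoothP vs; apply/funext => x; apply: part_inj => b.
move: (congr1 (fun p => p x) (cpart_pderivs b l v)).
move: (congr1 (fun p => p x) (cpart_pderivs b (flatten [seq nseq (multiplicities l i) i | i <- enum 'I_n]) v)).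
by rewrite /cpart/mpderiv => -> ->; rewrite (rpds_perm (vs b) (perm_flatten_count l)).
Qed.

(** By [weight_le] the weight is controlled by the constant monomial and the [n] pure powers, so
    [n + 1] seminorms suffice. *)
Lemma weighted_le_seminorm b l m K v : smooth v ->
  (seminorm (fun=> 0%N) (multiplicities l) v <= K%:E)%E ->
  (forall i, (seminorm (fun j => if j == i then m else 0%N) (multiplicities l) v <= K%:E)%E) ->
  weighted_le m (2 ^+ m * n.+1%:R * K) (rpds l (cpart b v)).
Proof.
move=> vs K0 Ki x; rewrite -cpart_pderivs -mpderivE//.
apply: (@le_trans _ _ (2 ^+ m * ((1 + \sum_i `|x 0 i| ^+ m) * Normc.normc (mpderiv (multiplicities l) v x)))).
  by rewrite mulrA ler_pM ?weight_ge0 ?weight_le ?part_le.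
rewrite -mulrA ler_wpM2l ?exprn_ge0// mulrDl mul1r -natr1 mulrDl mul1r addrC lerD//.
  rewrite mulr_suml mulr_natl -[X in _ *+ X](card_ord n) -sumr_const; apply: ler_sum => i _.
  rewrite -normrX -monomial1 -lee_fin; exact: le_trans (le_seminorm _ _ _ _) (Ki i).
rewrite -[leLHS]mul1r -[X in X * _]normr1 -(monomial0 x) -lee_fin.
exact: le_trans (le_seminorm _ _ _ _) K0.
Qed.

(** The weight exponent is the degree of the monomial; the bound doubles because the modulus is
    estimated by the sum of both parts. *)
Lemma seminorm_weighted_le alpha beta K v :
  (forall b, weighted_le (\sum_i alpha i)%N K
    (rpds (flatten [seq nseq (beta i) i | i <- enum 'I_n]) (cpart b v))) ->
  (seminorm alpha beta v <= (K + K)%:E)%E.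
Proof.
move=> vK; apply: seminorm_le => x.
apply: le_trans (lerD (vK false x) (vK true x)); rewrite -mulrDr ler_pM ?monomial_le//.
  exact: normc_ge0.
by rewrite -!cpart_pderivs; exact: normc_le.
Qed.

Lemma seminorm_fin alpha beta v : schwartz v ->
  exists2 K, 0 <= K & (seminorm alpha beta v <= K%:E)%E.
Proof.
move=> [_ /(_ alpha beta) vK]; exists (fine (seminorm alpha beta v)).
  by rewrite fine_ge0 ?seminorm_ge0.
by rewrite fineK// ge0_fin_numE ?seminorm_ge0.
Qed.

Lemma schwartzP v : schwartz v <-> forall b, rschwartz (cpart b v).
Proof.
split=> [vs b|vS].
  have [vc vd] := (smoothP v).1 vs.1 b; split => // m l.
  have [K0 _ HK0] := seminorm_fin (fun=> 0%N) (multiplicities l) vs.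
  have /choice[K HK] : forall i, exists K, 0 <= K /\
      (seminorm (fun j => if j == i then m else 0%N) (multiplicities l) v <= K%:E)%E.
    by move=> i; have [K] := seminorm_fin (fun j => if j == i then m else 0%N) (multiplicities l) vs; exists K.
  exists (2 ^+ m * n.+1%:R * (`|K0| + \sum_i K i)); apply: weighted_le_seminorm; first exact: vs.1.
    rewrite (le_trans HK0)// lee_fin (le_trans (ler_norm _))// lerDl sumr_ge0// => i _.
    by have [] := HK i.
  move=> i; apply: le_trans (HK i).2 _; rewrite lee_fin (bigD1 i)//= addrCA lerDl.
  by rewrite addr_ge0// sumr_ge0// => j _; have [] := HK j.
split; first by apply/smoothP => b; split;
  [exact: rschwartz_cont|move=> l i x; exact: rschwartz_der].
move=> alpha beta; set l := flatten [seq nseq (beta i) i | i <- enum 'I_n].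
have [K HK] := rschwartz_bound (vS false) (\sum_i alpha i)%N l.
have [K' HK'] := rschwartz_bound (vS true) (\sum_i alpha i)%N l.
apply: (@le_lt_trans _ _ (`|K| + `|K'| + (`|K| + `|K'|))%:E); last exact: ltry.
apply: seminorm_weighted_le => -[]; [apply: weighted_le_le HK'|apply: weighted_le_le HK].
  by rewrite (le_trans (ler_norm _))// lerDr.
by rewrite (le_trans (ler_norm _))// lerDl.
Qed.

Lemma cvg_seminorm0 (T : Type) (F : set_system T) (FF : Filter F) (q : T -> \bar R) :
  (forall r, (0 <= q r)%E) ->
  (q r @[r --> F] --> 0%E) <-> forall eps : R, 0 < eps -> \forall r \near F, (q r <= eps%:E)%E.
Proof.
move=> q0; split=> [qc eps eps0|H A].
  apply: (qc [set y | (y <= eps%:E)%E]); rewrite /nbhs/=/ereal_nbhs/=.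
  apply/nbhs_ballP; exists eps => //= r; rewrite -ball_normE/= sub0r normrN => rn.
  by rewrite lee_fin (le_trans (ler_norm _))// ltW.
rewrite /nbhs/=/ereal_nbhs/= => /nbhs_ballP[eps /= eps0 eA].
have e2 : 0 < eps / 2 by rewrite divr_gt0.
apply: filterS (H _ e2) => r qe; have qf : q r \is a fin_num.
  by rewrite ge0_fin_numE// (le_lt_trans qe)// ltry.
rewrite /= -(fineK qf); apply: eA; rewrite -ball_normE/= sub0r normrN ger0_norm ?fine_ge0//.
rewrite -lte_fin fineK//; apply: le_lt_trans qe _; rewrite lte_fin ltr_pdivrMr//.
by rewrite mulr_natr mulr2n ltrDl.
Qed.

End complex_parts.

(** * Paths of complex Schwartz functions through their parts *)

Section complex_schwartz.
Context {R : realType} {n : nat}.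
Implicit Types (t r h : R) (b : bool) (l : seq 'I_n) (i j : 'I_n)
  (v w : 'rV[R]_n -> R[i]) (g : R -> 'rV[R]_n -> R[i]).

Lemma cpartB b v w : cpart b (fun x => v x - w x) = fun x => cpart b v x - cpart b w x.
Proof. by apply/funext => x; exact: partB. Qed.

Lemma schwartzB v w : schwartz v -> schwartz w -> schwartz (fun x => v x - w x).
Proof.
move=> /schwartzP vS /schwartzP wS; apply/schwartzP => b.
by rewrite cpartB; exact: rschwartzB.
Qed.

Lemma schwartz_cvgP (F : set_system R) (FF : Filter F) g v :
  (\forall r \near F, schwartz (g r)) -> schwartz v ->
  schwartz_cvg F g v <-> forall b, rschwartz_cvg F (fun r => cpart b (g r)) (cpart b v).
Proof.
move=> gS vS; split=> [gv b m l eps eps0|gv alpha beta].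
  (* Undoes the constant of [weighted_le_seminorm]. *)
  pose K := eps / (2 ^+ m * n.+1%:R).
  have c0 : 0 < 2 ^+ m * n.+1%:R :> R by rewrite mulr_gt0// exprn_gt0.
  have K0 : 0 < K by rewrite divr_gt0.
  have small alpha : \forall r \near F,
      (seminorm alpha (multiplicities l) (fun x => (g r x - v x)%R) <= K%:E)%E.
    by apply: (cvg_seminorm0 FF _).1 K0 => // r; exact: seminorm_ge0.
  near=> r.
  have gr : schwartz (g r) by near: r.
  rewrite -cpartB; apply: weighted_le_le (weighted_le_seminorm (K := K) b (schwartzB gr vS).1 _ _).
  - by rewrite mulrC divfK// gt_eqF.
  - by near: r; exact: small.
  - by near: r; apply: filter_forall => i; exact: small.
apply/cvg_seminorm0 => [r|eps eps0]; first exact: seminorm_ge0.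
have e2 : 0 < eps / 2 by rewrite divr_gt0.
set l := flatten [seq nseq (beta i) i | i <- enum 'I_n].
apply: filterS2 (gv false (\sum_i alpha i)%N l _ e2) (gv true (\sum_i alpha i)%N l _ e2) => r H1 H2.
rewrite [eps]splitr; apply: seminorm_weighted_le => b; rewrite cpartB.
by case: b.
Unshelve. all: by end_near. Qed.

Lemma schwartz_C0P g :
  (forall t, 0 < t -> schwartz (g t) /\ schwartz_cvg (nbhs t) g (g t)) <->
  forall b, schwartz_path_Ck 0 (fun t => cpart b (g t)).
Proof.
have near_S : (forall t, 0 < t -> schwartz (g t)) ->
    forall t, 0 < t -> \forall r \near t, schwartz (g r).
  by move=> gS t t0; apply: filterS (near_above t0) => r; exact: gS.
split=> [gC b|gC].
  split => // t t0; have [gS gc] := gC t t0.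
  split; first by move/schwartzP : gS.
  apply: (schwartz_cvgP _ _ gS).1 gc b.
  by apply: near_S t0 => r /gC[].
have gS t : 0 < t -> schwartz (g t).
  by move=> t0; apply/schwartzP => b; exact: (schwartz_path_Ck_C0 (gC b) t0).1.
move=> t t0; split; first exact: gS.
apply/schwartz_cvgP; [exact: near_S|exact: gS|].
by move=> b; exact: (schwartz_path_Ck_C0 (gC b) t0).2.
Qed.

Lemma cpart_diff_quotient b g t h :
  cpart b (diff_quotient g t h) = dquot (fun t => cpart b (g t)) t h.
Proof. by apply/funext => x; rewrite /cpart partZ partB. Qed.

Lemma schwartz_diff_quotient g t h : schwartz (g t) -> schwartz (g (t + h)) ->
  schwartz (diff_quotient g t h).
Proof.
move=> /schwartzP gt /schwartzP gth; apply/schwartzP => b.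
by rewrite cpart_diff_quotient; apply: rschwartzZ; exact: rschwartzB.
Qed.

Lemma schwartz_CkP k g : schwartz_Ck k g <-> forall b, schwartz_path_Ck k (fun t => cpart b (g t)).
Proof.
have base k' g' : schwartz_Ck k' g' ->
    forall t, 0 < t -> schwartz (g' t) /\ schwartz_cvg (nbhs t) g' (g' t).
  by case: k' => [|k'] [].
have near_dq g' : (forall t, 0 < t -> schwartz (g' t)) -> forall t, 0 < t ->
    \forall h \near (0 : R)^', schwartz (diff_quotient g' t h).
  move=> gS t t0; apply: filterS (near_shift_pos t0) => h th0.
  by apply: schwartz_diff_quotient; exact: gS.
have dqE b g' t : (fun h => cpart b (diff_quotient g' t h)) = dquot (fun t => cpart b (g' t)) t.
  by apply/funext => h; exact: cpart_diff_quotient.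
elim: k g => [|k IH] g.
  split=> [[/schwartz_C0P//]|gC]; split => //; exact/schwartz_C0P.
split=> [gC b|gC].
  split; first by have [] := (schwartz_C0P g).1 (base _ _ gC) b.
  have [g0 [g' [dg g'C]]] := gC; exists (fun t => cpart b (g' t)); split; last exact: (IH g').1.
  move=> t t0; rewrite -dqE; apply: (schwartz_cvgP _ _ _).1 (dg t t0) b.
    by apply: near_dq t0 => r /g0[].
  by have [] := base _ _ g'C t t0.
have C0 : forall b, schwartz_path_Ck 0 (fun t => cpart b (g t)).
  by move=> b; split => // t t0; exact: schwartz_path_Ck_C0 (gC b) t0.
have g0 := (schwartz_C0P g).2 C0.
split => //.
(* Each part supplies its own derivative path; the two are assembled into one complex path. *)
have [F' HF'] := choice (fun b => (gC b).2).
pose g' t x := (F' false t x +i* F' true t x)%C.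
have g'E b : (fun t => cpart b (g' t)) = F' b by case: b.
have g'C : schwartz_Ck k g' by apply/IH => b; rewrite g'E; exact: (HF' b).2.
exists g'; split => // t t0; apply/schwartz_cvgP.
- by apply: near_dq t0 => r /g0[].
- by have [] := base _ _ g'C t t0.
- by move=> b; rewrite dqE (_ : cpart b (g' t) = F' b t); [exact: (HF' b).1|case: b].
Qed.

Lemma schwartz_continuousP g :
  schwartz_continuous g <-> forall b, schwartz_path (fun t => cpart b (g t)).
Proof.
have near_S t : (forall t, 0 <= t -> schwartz (g t)) ->
    \forall r \near within `[0, +oo[%classic (nbhs t), schwartz (g r).
  by move=> gS; apply: (@filterE _ (nbhs t)) => r; rewrite /= in_itv/= andbT; exact: gS.
split=> [gC b|gC].
  have gS t : 0 <= t -> schwartz (g t) by move=> /gC[].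
  apply: rschwartz_cvg_path => [t t0|t t0]; first by have /schwartzP := gS t t0.
  by apply: (schwartz_cvgP _ _ (gS t t0)).1 (gC t t0).2 b; exact: near_S.
have gS t : 0 <= t -> schwartz (g t).
  by move=> t0; apply/schwartzP => b; exact: (gC b).1.
move=> t t0; split; first exact: gS.
apply/schwartz_cvgP; [exact: near_S|exact: gS|].
by move=> b; exact: schwartz_path_cvg.
Qed.

Lemma schwartz_cvg_right g :
  schwartz_cvg (within `[0, +oo[%classic (nbhs (0 : R))) g (g 0) ->
  schwartz_cvg (0 : R)^'+ g (g 0).
Proof.
move=> gc alpha beta; apply: cvg_trans (gc alpha beta); apply: cvg_app.
move=> A HA; apply: (@filterS _ (nbhs (0 : R))) HA => r H r0; apply: H.
by rewrite /= in_itv/= ltW.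
Qed.

End complex_schwartz.

Section propagator_parts.
Context {R : realType} {n : nat} (a : R -> 'M[R]_n) (ha : coefficient_matrix a).
Implicit Types (s t : R) (b : bool) (x : 'rV[R]_n) (v : 'rV[R]_n -> R[i]).

(** Replaces the convolution by the Gaussian average, including [s = t], where [cholU] is zero and
    both sides are the function itself. *)
Lemma part_Wop b s t v x : 0 <= s -> s <= t -> schwartz v ->
  part b (Wop a s t v x) = gavg (cholU a s t) (cpart b v) x.
Proof.
move=> s0 st /schwartzP/(_ b) vS; rewrite /Wop /cholU; case: ifPn => [st'|_]; last by rewrite gavg0.
rewrite part_cintegral -(gkernel_convolution x (primitive_posdef ha s0 st') (rschwartz_continuous vS)).
by apply: eq_Rintegral => y _; rewrite partZ.
Qed.

Lemma part_elliptic_op b t v x : part b (elliptic_op a t v x) =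
  \sum_i \sum_j a t i j * rpd i (rpd j (cpart b v)) x.
Proof.
rewrite part_sum; apply: eq_bigr => i _; rewrite part_sum; apply: eq_bigr => j _.
by rewrite partZ -[RHS]/(_ * rpds [:: i; j] (cpart b v) x) -cpart_pderivs.
Qed.

Lemma mild_ge0 (f : 'rV[R]_n -> R) F t x : (forall x, 0 <= f x) ->
  (forall s x, 0 <= s -> 0 <= F s x) -> 0 <= mild a f F t x.
Proof.
move=> f0 F0; rewrite addr_ge0 ?gavg_ge0//; apply: Rintegral_ge0 => s /=.
by rewrite in_itv/= => /andP[s0 _]; apply: gavg_ge0 => z; exact: F0.
Qed.

(** Serves the imaginary part in the positivity claim: [0 <= z] in the complex numbers includes that
    the imaginary part vanishes. *)
Lemma mild_eq0 (f : 'rV[R]_n -> R) F t x : (forall x, f x = 0) ->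
  (forall s x, 0 <= s -> F s x = 0) -> mild a f F t x = 0.
Proof.
have gavg_eq0 (U : 'M[R]_n) (g : 'rV[R]_n -> R) : (forall z, g z = 0) -> gavg U g x = 0.
  by move=> g0; rewrite (_ : g = fun=> 0) /gavg ?gint_cst//; exact/funext.
move=> f0 F0; rewrite /mild gavg_eq0// add0r.
rewrite /duhamel (@eq_Rintegral _ _ _ _ _ (fun=> 0)); last first.
  move=> s; rewrite inE/= in_itv/= => /andP[s0 _]; apply: gavg_eq0 => z; exact: F0.
by rewrite /Rintegral integral0.
Qed.

End propagator_parts.

Local Open Scope complex_scope.

Theorem proposition3 (R : realType) (n : nat) (hn : (0 < n)%N)
    (a : R -> 'M[R]_n) (ha : coefficient_matrix a)
    (u0 : 'rV[R]_n -> R[i]) (hu0 : schwartz u0)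
    (f : R -> 'rV[R]_n -> R[i])
    (hf : schwartz_Cinfty f) (hf0 : schwartz_continuous f)
    (u : R -> 'rV[R]_n -> R[i])
    (hu : forall (t : R) (x : 'rV[R]_n), 0 < t ->
       u t x = Wop a 0 t u0 x
               + cintegral lebesgue_measure `[0, t] (fun s => Wop a s t (f s) x))
    (hu_0 : u 0 = u0) :
  [/\ schwartz_Cinfty u /\ schwartz_continuous u,
      forall (t : R) (x : 'rV[R]_n), 0 < t ->
        cderive (fun s => u s x) t 1 - elliptic_op a t (u t) x = f t x,
      schwartz_cvg (0 : R)^'+ u u0 &
      (forall x, 0 <= u0 x) -> (forall (t : R) x, 0 <= t -> 0 <= f t x) ->
      forall (t : R) x, 0 < t -> 0 <= u t x].
Proof.
have fC b : schwartz_path (fun t => cpart b (f t)) by move/schwartz_continuousP : hf0.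
have fk b k : schwartz_path_Ck k (fun t => cpart b (f t)) by have /schwartz_CkP := hf k.
have u0S b : rschwartz (cpart b u0) by move/schwartzP : hu0.
pose U b := mild a (cpart b u0) (fun t => cpart b (f t)).
(* At [t = 0] the integral formula for [u] is not assumed; there [hu_0] is matched with [mild0]. *)
have uU b t : 0 <= t -> cpart b (u t) = U b t.
  rewrite le_eqVlt => /predU1P[<-|t0]; first by rewrite hu_0 /U mild0.
  apply/funext => x; rewrite /cpart hu// partD part_cintegral (part_Wop ha)// ?ltW//.
  congr (_ + _); apply: eq_Rintegral => s; rewrite inE/= in_itv/= => /andP[s0 st].
  by apply: (part_Wop ha) => //; have [] := hf0 s s0.
have UC b : schwartz_path (U b) := mild_schwartz_path ha (u0S b) (fC b).
have uC : schwartz_continuous u.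
  apply/schwartz_continuousP => b; apply: rschwartz_cvg_path => t t0; rewrite uU//;
    first exact: (UC b).1.
  apply: rschwartz_cvg_near (schwartz_path_cvg (UC b) t0); apply: (@filterE _ (nbhs t)) => r.
  by rewrite /= in_itv/= andbT => r0; rewrite uU.
split.
- split => // k; apply/schwartz_CkP => b.
  apply: schwartz_path_Ck_ext (mild_schwartz_path_Ck ha k (u0S b) (fC b) (fk b)) => t t0.
  by rewrite uU// ltW.
- move=> t x t0; apply: part_inj => b.
  have D : is_derive t (1 : R) (fun s => part b (u s x))
      (\sum_i \sum_j a t i j * rpd i (rpd j (U b t)) x + cpart b (f t) x).
    apply: near_eq_is_derive (mild_is_derive ha x (u0S b) (fC b) t0).
    apply: filterS (near_above t0) => r r0.
    by rewrite -[RHS]/(cpart b (u r) x) uU// ltW.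
  have dE : part b (cderive (fun s => u s x) t 1) = 'D_1 (fun s => part b (u s x)) t.
    by clear D; case: b.
  rewrite partB dE (@derive_val _ _ _ _ _ _ _ D) part_elliptic_op uU ?ltW//.
  by rewrite addrAC subrr add0r.
- rewrite -hu_0; apply: schwartz_cvg_right; exact: (uC 0 (lexx _)).2.
- move=> u0_ge0 f_ge0 t x t0.
  have uE b : part b (u t x) = U b t x by rewrite -uU// ltW.
  apply/part_ge0; rewrite !uE; split.
    apply: mild_eq0 => [y|s y s0]; first exact: ((part_ge0 _).1 (u0_ge0 y)).1.
    exact: ((part_ge0 _).1 (f_ge0 s y s0)).1.
  apply: mild_ge0 => [y|s y s0]; first exact: ((part_ge0 _).1 (u0_ge0 y)).2.
  exact: ((part_ge0 _).1 (f_ge0 s y s0)).2.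
Qed.
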